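(* Consider the exponential random graph model (ERGM) on $n$ vertices with fixed graphs $H_1,\dots,H_k$ and parameters $\beta=(\beta_1,\dots,\beta_k)$ as in the context, and let $W=W_n$ be the normalized number of edges $W_n=\sigma_n^{-1}\big(\sum_{1\le i<j\le n}Y_{ij}-\mu_n\big)$. Let $Z\sim N(0,1)$. (i) If $\beta$ lies in the subcritical region, then there is a constant $C=C(\beta,H_1,\dots,H_k)>0$, depending only on $\beta_1,\dots,\beta_k$ and $H_1,\dots,H_k$, such that for all $n\ge2$ $$d_{\mathrm{Wass}}(W_n,Z)\le\frac{C}{n^{1/4}}\quad\text{and}\quad d_{\mathrm{Kol}}(W_n,Z)\le\frac{C}{n^{1/4}}.$$ (ii) If moreover $\beta$ lies in Dobrushin's uniqueness region, i.e. $\Phi_\beta'(1)<2$, then there is a constant $C=C(\beta,H_1,\dots,H_k)>0$ such that for all $n\ge2$ $$d_{\mathrm{Wass}}(W_n,Z)\le\frac{C}{\sqrt n}\quad\text{and}\quad d_{\mathrm{Kol}}(W_n,Z)\le\frac{C}{\sqrt n}.$$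
   Context: Graphs are simple (undirected, no loops or multiple edges). Let $k\ge1$; $H_1$ is a single edge, $H_2,\dots,H_k$ are fixed simple graphs without isolated vertices, each having at least two edges; $\beta_1\in\mathbb{R}$ and $\beta_2,\dots,\beta_k>0$. Let $v_j=|\mathcal{V}(H_j)|$ and $e_j$ be the numbers of vertices and edges of $H_j$. For graphs $H,G$, $|\mathrm{Hom}(H,G)|$ is the number of injective maps $\mathcal{V}(H)\to\mathcal{V}(G)$ sending every edge of $H$ to an edge of $G$. The ERGM is the random graph on vertex set $\{1,\dots,n\}$ whose edge indicators $Y=(Y_{ij})_{1\le i<j\le n}\in\{0,1\}^{\binom n2}$ have probability mass function $$p_\beta(y)=\frac1{Z(\beta)}\exp\Big\{\sum_{j=1}^k\frac{\beta_j}{n^{v_j-2}}|\mathrm{Hom}(H_j,G_y)|\Big\},$$ where $G_y$ is the graph with edge indicators $y$ and $Z(\beta)$ is the normalizing constant. Define $\Phi_\beta(a)=\sum_{i=1}^k\beta_ie_ia^{e_i-1}$ and $\varphi_\beta(a)=\frac{e^{2\Phi_\beta(a)}}{e^{2\Phi_\beta(a)}+1}$. The subcritical region is the set of $\beta$ for which the equation $\varphi_\beta(a)=a$ has a unique solution $p=p(\beta)$ in $(0,1)$ and $\varphi_\beta'(p)<1$. Throughout $p$ denotes this solution. Put $N=\binom n2$, $\mu_n=\mathbb{E}\sum_{1\le i<j\le n}Y_{ij}$ and $$\sigma_n^2=\frac{Np(1-p)}{1-\sum_{j=2}^k\beta_je_j(e_j-1)2p^{e_j-1}(1-p)}$$ (the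 denominator equals $1-\varphi_\beta'(p)>0$ in the subcritical region). $d_{\mathrm{Kol}}(W,Z)=\sup_{x}|\mathbb{P}(W\le x)-\mathbb{P}(Z\le x)|$; $d_{\mathrm{Wass}}(W,Z)=\sup_\psi|\mathbb{E}\psi(W)-\mathbb{E}\psi(Z)|$ over absolutely continuous $\psi:\mathbb{R}\to\mathbb{R}$ with $\|\psi'\|_\infty\le1$. *)

(* Defs.v *)
From HB Require Import structures.
From mathcomp Require Import all_boot all_order all_algebra.
From mathcomp Require Import all_classical all_reals all_analysis.

Set Implicit Arguments.
Unset Strict Implicit.
Unset Printing Implicit Defensive.

Import Order.TTheory GRing.Theory Num.Theory.
Import numFieldNormedType.Exports.

Local Open Scope classical_set_scope.
Local Open Scope ring_scope.

Record sgraph := SGraph {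
  svertex :> finType;
  sedge : rel svertex;
  sedge_sym : symmetric sedge;
  sedge_irr : irreflexive sedge }.

Definition edge_set (G : sgraph) : {set {set G}} :=
  [set e : {set G} | [exists u, exists v, sedge u v && (e == [set u; v]%SET)]]%SET.

Definition nverts (G : sgraph) : nat := #|G|.
Definition nedges (G : sgraph) : nat := #|edge_set G|.

Definition single_edge (G : sgraph) : Prop :=
  exists u v : G, sedge u v /\ [set: G]%SET = [set u; v]%SET.

Definition no_isolated (G : sgraph) : Prop :=
  forall u : G, exists v : G, sedge u v.

Definition hom_set (H G : sgraph) : {set {ffun H -> G}} :=
  [set f : {ffun H -> G} | injectiveb f &&
    [forall u, forall v, sedge u v ==> sedge (f u) (f v)]]%SET.

Definition hom_count (H G : sgraph) : nat := #|hom_set H G|.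

Definition pairs (n : nat) := {e : 'I_n * 'I_n | (e.1 < e.2)%N}.

Definition config (n : nat) := {ffun pairs n -> bool}.

HB.instance Definition _ n := Finite.on (config n).
HB.instance Definition _ n := isPointed.Build (config n) [ffun=> false].
HB.instance Definition _ n := @isMeasurable.Build default_measure_display
  (config n) discrete_measurable discrete_measurable0
  discrete_measurableC discrete_measurableU.

Definition config_adj n (y : config n) : rel 'I_n := fun i j =>
  [exists e : pairs n, y e && ((val e == (i, j)) || (val e == (j, i)))].

Lemma config_adj_sym n (y : config n) : symmetric (config_adj y).
Proof. by move=> i j; apply: eq_existsb => e; rewrite orbC. Qed.

Lemma config_adj_irr n (y : config n) : irreflexive (config_adj y).
Proof.
move=> i; apply/existsP => -[[e he]] /=; rewrite orbb => /andP[_ /eqP ei].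
by move: he; rewrite ei ltnn.
Qed.

Definition graph_of n (y : config n) : sgraph :=
  SGraph (config_adj_sym y) (config_adj_irr y).

Definition edge_count (R : realType) n (y : config n) : R :=
  \sum_(e : pairs n) (y e)%:R.

Section ergm.
Context {R : realType} {k : nat} (H : 'I_k.+1 -> sgraph) (beta : 'I_k.+1 -> R).

(* In the intended use [H ord0] is the single edge; the other graphs are indexed
   by the nonzero elements of ['I_k.+1].

   The truncated subtractions [nverts _ - 2] and [nedges _ - 1] are genuine
   ones for graphs without isolated vertices that have at least one edge. *)

Definition ergm_weight n (y : config n) : R :=
  expR (\sum_j beta j / n%:R ^+ (nverts (H j) - 2)
               * (hom_count (H j) (graph_of y))%:R).

Definition ergm_Z n : R := \sum_(y : config n) ergm_weight y.

Definition ergm_pmf n (y : config n) : R := ergm_weight y / ergm_Z n.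

Definition ergm_prob n (A : set (config n)) : \bar R :=
  (\sum_(y \in A) (ergm_pmf y)%:E)%E.

Lemma ergm_Z_gt0 n : 0 < ergm_Z n.
Proof.
rewrite /ergm_Z (bigD1 ([ffun=> false] : config n))//= ltr_pwDl ?expR_gt0//.
by apply: sumr_ge0 => y _; exact: expR_ge0.
Qed.

Lemma ergm_pmf_ge0 n (y : config n) : 0 <= ergm_pmf y.
Proof. by rewrite divr_ge0 ?expR_ge0// ltW// ergm_Z_gt0. Qed.

Section measure.
Variable n : nat.
Local Notation P := (@ergm_prob n).

Let finP (A : set (config n)) : finite_set A. Proof. exact: finite_finset. Qed.

Let P0 : P set0 = 0%E. Proof. by rewrite /ergm_prob fsbig_set0. Qed.

Let P_ge0 A : (0 <= P A)%E.
Proof.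
rewrite /ergm_prob fsbig_finite//= sumEFin lee_fin.
by apply: sumr_ge0 => /= y _; exact: ergm_pmf_ge0.
Qed.

Let P_sigma_additive : semi_sigma_additive P.
Proof.
move=> F mF tF mUF; rewrite /ergm_prob; apply: cvg_toP.
  apply: ereal_nondecreasing_is_cvgn => a b ab.
  by apply: lee_sum_nneg_natr => // i _ _; exact: P_ge0.
transitivity (\sum_(0 <= i <oo) (\esum_(y in F i) (ergm_pmf y)%:E))%E.
  apply: eq_eseriesr => i _; rewrite esum_fset//= => y _.
  by rewrite lee_fin ergm_pmf_ge0.
rewrite -nneseries_sum_bigcup//=; last first.
  by move=> y; rewrite lee_fin ergm_pmf_ge0.
by rewrite esum_fset//= => y _; rewrite lee_fin ergm_pmf_ge0.
Qed.

HB.instance Definition _ := isMeasure.Build _ _ _ P P0 P_ge0 P_sigma_additive.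

Let P_setT : P [set: _] = 1%E.
Proof.
rewrite /ergm_prob fsbig_finite//= sumEFin; congr (_%:E).
transitivity (\sum_(y : config n) ergm_pmf y); last first.
  rewrite /ergm_pmf -mulr_suml divff// gt_eqF//; exact: ergm_Z_gt0.
rewrite -big_enum; apply: perm_big; apply: uniq_perm.
- exact: finmap.fset_uniq.
- exact: enum_uniq.
- by move=> y; rewrite in_fset_set// mem_enum in_setT.
Qed.

HB.instance Definition _ := @Measure_isProbability.Build _ _ R P P_setT.

End measure.

Definition Phi (a : R) : R :=
  \sum_i beta i * (nedges (H i))%:R * a ^+ (nedges (H i) - 1).

Definition phi (a : R) : R := expR (2 * Phi a) / (expR (2 * Phi a) + 1).

(* [p] is the solution that the parameters determine. *)
Definition subcritical (p : R) : Prop :=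
  [/\ 0 < p < 1, phi p = p,
      forall q : R, 0 < q < 1 -> phi q = q -> q = p &
      derive1 phi p < 1].

Definition dobrushin : Prop := derive1 Phi 1 < 2.

Definition ergm_mean n : R := fine 'E_(@ergm_prob n)[@edge_count R n].

(* In the subcritical region the denominator is [1 - derive1 phi p > 0]. *)
Definition ergm_var (p : R) n : R :=
  'C(n, 2)%:R * p * (1 - p) /
  (1 - \sum_(j | j != ord0)
         beta j * (nedges (H j))%:R * (nedges (H j) - 1)%:R
         * 2 * p ^+ (nedges (H j) - 1) * (1 - p)).

Definition normalized_edges (p : R) n (y : config n) : measurableTypeR R :=
  (edge_count R y - ergm_mean n) / Num.sqrt (ergm_var p n).

Lemma measurable_normalized_edges p n :
  measurable_fun [set: config n] (@normalized_edges p n).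
Proof. by []. Qed.

HB.instance Definition _ p n := @isMeasurableFun.Build _ _ (config n)
  (measurableTypeR R) (@normalized_edges p n)
  (@measurable_normalized_edges p n).

Definition normalized_law (p : R) n : probability (measurableTypeR R) R :=
  distribution (@ergm_prob n) (@normalized_edges p n).

End ergm.

Section distances.
Context {R : realType}.
Implicit Types mu nu : probability (measurableTypeR R) R.

Definition d_Kol mu nu : \bar R :=
  ereal_sup [set `|mu `]-oo, x]%classic - nu `]-oo, x]%classic|%E | x in [set: R]].

(* Absolute continuity on every compact interval [[a, b]]. *)
Definition abs_continuous (psi : R -> R) : Prop :=
  forall a b eps : R, 0 < eps -> exists2 delta : R, 0 < delta &
    forall m (x y : 'I_m -> R),
      (forall i, [/\ a <= x i, x i <= y i & y i <= b]) ->
      trivIset [set: 'I_m] (fun i => `]x i, y i[%classic) ->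
      \sum_i (y i - x i) < delta ->
      \sum_i `|psi (y i) - psi (x i)| < eps.

(* An absolutely continuous function is differentiable almost everywhere; this
   is recorded explicitly, as [derive1 psi] is meaningless at the other points. *)
Definition wass_test (psi : R -> R) : Prop :=
  [/\ abs_continuous psi,
      {ae @lebesgue_measure R, forall x, derivable psi x 1} &
      ('N[@lebesgue_measure R]_+oo[EFin \o derive1 psi] <= 1)%E].

(* Meant for laws with a finite first moment, so that both integrals below are
   finite for every test function. *)
Definition d_Wass mu nu : \bar R :=
  ereal_sup [set `|\int[mu]_x (psi x)%:E - \int[nu]_x (psi x)%:E|%E
            | psi in wass_test].

End distances.

Definition std_normal (R : realType) : probability (measurableTypeR R) R :=
  normal_prob (0 : R) 1.

(* Main.v *)
Require Import Defs.
From mathcomp Require Import all_boot all_order all_algebra all_fingroup.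
From mathcomp Require Import all_classical all_reals all_analysis.
From mathcomp Require Import measurable_realfun ess_sup_inf ring lra zify.

(* Let X be the number of edges and Q the sum over all edges e of the conditional
   probability q_e that e is present given the other edges, a logistic function of
   the discrete derivative of the Hamiltonian.  With V = 2 Phi and
   lam = V'(p) p (1 - p) = phi'(p), the argument rests on three estimates, for a
   rate rho: Var X = O(N), Var (Q - lam X) = O(rho^2 N) and
   E (q_e - p)^2 = O(rho^2).  Writing
   (1 - lam) (X - E X) = (X - Q) + (Q - lam X) - E (Q - lam X) and using
   E (X - Q) f(X) = sum_e E q_e (1 - q_e) (f(X_e^1) - f(X_e^0)), where
   X_e^1 and X_e^0 count the edges when e is added or removed, Stein's method
   gives both distances up to O(rho + 1/sigma); for the Kolmogorov distance the
   test functions are monotone, so that the error coming from their increments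
   telescopes by the same identity.

   In the subcritical region, rho = n^(-1/4).  Trivially q_e <= 1; if all q_e are
   at most a with high probability, the model is dominated on increasing events by
   independent edges of density a, under which the discrete derivatives of the
   Hamiltonian concentrate at V(a), so that all q_e are at most phi(a) + n^(-1/4)
   with high probability.  As p is an attracting fixed point of phi, O(log n)
   iterations, and the same from below, show that the derivatives are typically
   within O(n^(-1/4)) of V(p).  Between typical configurations both
   C rho X + (Q - lam X) and C rho X - (Q - lam X) are increasing.  Since
   beta_j > 0 for j > 1 the Hamiltonian is supermodular, and the FKG inequality
   makes their covariance C^2 rho^2 Var X - Var (Q - lam X) almost nonnegative.

   In Dobrushin's region, rho = n^(-1/2): the Glauber dynamics contracts, which
   yields a Poincare inequality, from which all the variance bounds follow. *)

Set Implicit Arguments.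
Unset Strict Implicit.
Unset Printing Implicit Defensive.

Import Order.TTheory GRing.Theory Num.Theory.
Import numFieldNormedType.Exports.
Local Open Scope classical_set_scope.
Local Open Scope ring_scope.

(** The two regions differ in where sig' can be estimated. As sig' <= 1/4 everywhere, Phi'(1) < 2
    keeps the increments of Q below some kappa < 1 at every configuration, and the dynamics
    contracts globally. In the subcritical region the slope is only assumed to be below 1 at p: far
    from density p one more edge may raise Q by more than 1, and a global contraction cannot be
    expected. Hence the detour through typical configurations. The FKG inequality asks for
    monotonicity everywhere, so the functions have to be altered outside the typical set; this works
    because the exceptional set is the union of an increasing and a decreasing event. Comparison
    with independent edges fails exactly on the events q_e > a, which are increasing themselves, so
    each round of the iteration controls the exceptions of the next one. A round multiplies the
    failure probability by 2 N. Over O(log n) rounds a deviation eta is affordable once eta^2 n is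
    much larger than (log n)^2, which n^(-1/4) satisfies. For monotone test functions the final
    bound does not involve their slope, so passing to indicators costs nothing in the rate. *)

Lemma is_derive_mvt (R : realType) (f df : R -> R) :
  (forall x : R, is_derive x 1 f (df x)) -> forall x y : R, x <= y ->
  exists2 z, x <= z <= y & f y - f x = df z * (y - x).
Proof.
move=> fE x y xy.
have ds z : z \in `]x, y[%R -> is_derive z 1 f (df z) by [].
have cs : {within `[x, y]%classic, continuous f}.
  apply: continuous_subspaceT => z; apply: differentiable_continuous.
  by apply/derivable1_diffP; have [] := fE z.
have [z zi ->] := MVT_segment xy ds cs.
by exists z; rewrite ?(itvP zi).
Qed.

(** * The logistic function *)

Section sigmoid.
Context {R : realType}.
Implicit Types x y : R.

Definition sig x : R := expR x / (expR x + 1).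

Lemma expRD1_gt0 x : 0 < expR x + 1.
Proof. by rewrite addr_gt0// expR_gt0. Qed.

Lemma expRD1_neq0 x : expR x + 1 != 0.
Proof. by rewrite gt_eqF// expRD1_gt0. Qed.

Lemma sig_gt0 x : 0 < sig x.
Proof. by rewrite divr_gt0 ?expR_gt0// expRD1_gt0. Qed.

Lemma sig_lt1 x : sig x < 1.
Proof. by rewrite ltr_pdivrMr ?expRD1_gt0// mul1r ltrDl. Qed.

Lemma sig_ge0 x : 0 <= sig x. Proof. exact/ltW/sig_gt0. Qed.
Lemma sig_le1 x : sig x <= 1. Proof. exact/ltW/sig_lt1. Qed.

Lemma is_derive_sig x : is_derive x 1 sig (sig x * (1 - sig x)).
Proof.
have h := expRD1_neq0 x.
have H : is_derive x 1 (fun y => expR y * (expR y + 1)^-1)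
  (expR x *: (- (expR x + 1) ^- 2 *: (expR x + 0)) + (expR x + 1)^-1 *: expR x).
  apply: is_deriveM.
  apply: is_deriveV => //.
have -> : sig = (fun y => expR y * (expR y + 1)^-1) by [].
by apply: is_derive_eq; rewrite /GRing.scale /= /sig; field.
Qed.

Lemma sig_mvt x y : x <= y ->
  exists2 z, x <= z <= y & sig y - sig x = sig z * (1 - sig z) * (y - x).
Proof. exact: is_derive_mvt is_derive_sig _ _. Qed.

Lemma sig_deriv_ge0 x : 0 <= sig x * (1 - sig x).
Proof. by rewrite mulr_ge0 ?sig_ge0// subr_ge0 sig_le1. Qed.

Lemma sig_deriv_le x : sig x * (1 - sig x) <= 4^-1.
Proof. by have := sqr_ge0 (sig x - 2^-1); nra. Qed.

Lemma sig_homo x y : x <= y -> sig x <= sig y.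
Proof.
move=> xy; have [z _ e] := sig_mvt xy.
by rewrite -subr_ge0 e mulr_ge0 ?sig_deriv_ge0// subr_ge0.
Qed.

Lemma sig_mono x y : (sig x < sig y) = (x < y).
Proof.
apply/idP/idP; first by apply: contraTT; rewrite -!leNgt; exact: sig_homo.
move=> xy; have [z _ e] := sig_mvt (ltW xy).
by rewrite -subr_gt0 e mulr_gt0 ?subr_gt0// mulr_gt0 ?sig_gt0// subr_gt0 sig_lt1.
Qed.

Lemma sig_lip x y : `|sig x - sig y| <= `|x - y|.
Proof.
wlog xy : x y / y <= x.
  move=> H; have /orP[|] := le_total x y; last exact: H.
  by rewrite distrC (distrC x); exact: H.
have [z _ ->] := sig_mvt xy.
rewrite normrM ler_piMl// ger0_norm ?sig_deriv_ge0//.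
by have := sig_deriv_le z; lra.
Qed.

Lemma sig_deriv_lip x y :
  `|sig x * (1 - sig x) - sig y * (1 - sig y)| <= `|sig x - sig y|.
Proof.
have -> : sig x * (1 - sig x) - sig y * (1 - sig y) =
  (sig x - sig y) * (1 - sig x - sig y) by ring.
rewrite normrM ler_piMr// ler_norml.
by have := sig_gt0 x; have := sig_gt0 y; have := sig_lt1 x; have := sig_lt1 y; lra.
Qed.

End sigmoid.

(** * Gibbs measures on a Boolean cube *)

Lemma quad_form_ge0_CS (R : realType) (A B C : R) : 0 <= A -> 0 <= B ->
  (forall a b, 0 <= a ^+ 2 * A - 2 * a * b * C + b ^+ 2 * B) -> C ^+ 2 <= A * B.
Proof.
move=> A0 B0 H; have [A1|A1] := eqVneq A 0.
  (* With [A = 0], the values a = B + 1, b = C leave - (B + 2) C^2 >= 0. Otherwise a = C, b = A turn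
     the form into A (A B - C^2). *)
  have h1 := H (B + 1) C; have h2 := mulr_ge0 B0 (sqr_ge0 C).
  have h3 := sqr_ge0 C; rewrite A1 !expr2 in h1 h2 h3 *. lra.
have {}A1 : 0 < A by rewrite lt_def A1.
have h := H C A; rewrite -(ler_pM2l A1); rewrite !expr2 in h *; lra.
Qed.

Section gibbs.
Context {R : realType} {E : finType}.
Notation conf := {ffun E -> bool}.
Implicit Types (e : E) (x y : conf) (f g : conf -> R).

Definition upd e c y : conf := [ffun e' => if e' == e then c else y e'].

Lemma upd_same e c y : upd e c y e = c. Proof. by rewrite ffunE eqxx. Qed.

Lemma upd_neq e e' c y : e' != e -> upd e c y e' = y e'.
Proof. by move=> h; rewrite ffunE (negbTE h). Qed.

Lemma upd_upd e c c' y : upd e c (upd e c' y) = upd e c y.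
Proof. by apply/ffunP => z; rewrite !ffunE; case: eqP. Qed.

Lemma updC e e' c c' y : e != e' ->
  upd e c (upd e' c' y) = upd e' c' (upd e c y).
Proof.
move=> h; apply/ffunP => z; rewrite !ffunE; case: (eqVneq z e) => // ->.
by rewrite (negbTE h).
Qed.

Lemma upd_id e y : upd e (y e) y = y.
Proof. by apply/ffunP => z; rewrite !ffunE; case: eqP => // ->. Qed.

Definition D e f y := f (upd e true y) - f (upd e false y).

Definition incr f := forall e y, 0 <= D e f y.

Lemma D_upd e c f y : D e f (upd e c y) = D e f y.
Proof. by rewrite /D !upd_upd. Qed.

Lemma upd_case e f y : f y = (y e)%:R * f (upd e true y) +
  (1 - (y e)%:R) * f (upd e false y).
Proof.
by rewrite -{1}(upd_id e y); case: (y e); rewrite ?subrr ?subr0 mul0r mul1r ?addr0 ?add0r.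
Qed.

Lemma upd_rcomb e f (a : R) y : a * f (upd e true y) + (1 - a) * f (upd e false y) =
  f (upd e false y) + a * D e f y.
Proof. by rewrite /D; ring. Qed.

Section paths.
Variables x y : conf.

(** Along the suffixes of [enum E] this is a path from [x] to [y] changing one coordinate at a time,
    so bounds on [D] add up to bounds on differences. *)
Definition mix (s : seq E) : conf := [ffun e => if e \in s then y e else x e].

Lemma mix_nil : mix [::] = x. Proof. by apply/ffunP => e; rewrite ffunE. Qed.

Lemma mix_enum : mix (enum E) = y.
Proof. by apply/ffunP => e; rewrite ffunE mem_enum. Qed.

Lemma mix_cons e s : mix (e :: s) = upd e (y e) (mix s).
Proof.
by apply/ffunP => z; rewrite !ffunE inE; case: eqP => [->|].
Qed.

End paths.

Lemma incrP f : incr f -> forall x y, (forall e, x e -> y e) -> f x <= f y.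
Proof.
move=> If x y xy; rewrite -[X in _ <= f X](mix_enum x y).
have := enum_uniq E.
elim: (enum E) => [|e s IH] /= ; first by rewrite mix_nil.
move=> /andP[es us]; rewrite mix_cons (le_trans (IH us))//.
have h := If e (mix x y s); rewrite /D subr_ge0 in h.
have xe : mix x y s e = x e by rewrite ffunE (negbTE es).
rewrite -{1}(upd_id e (mix x y s)) xe.
case: (boolP (x e)) => [/xy ->//|_]; by case: (y e).
Qed.

Lemma lip_osc f (L : R) : (forall e y, `|D e f y| <= L) ->
  forall x y, `|f x - f y| <= #|E|%:R * L.
Proof.
move=> Lf x y; rewrite -[X in _ - f X](mix_enum x y) cardE.
elim: (enum E) => [|e s IH] /=; first by rewrite mix_nil subrr normr0 mul0r.
rewrite mix_cons -[f x - _](subrKA (f (mix x y s))) (le_trans (ler_normD _ _))//.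
rewrite -[(size s).+1]addn1 natrD mulrDl mul1r lerD//.
rewrite -{1}(upd_id e (mix x y s)).
have := Lf e (mix x y s); rewrite /D.
have L0 := le_trans (normr_ge0 _) (Lf e x).
by case: (mix x y s e); case: (y e); rewrite ?subrr ?normr0 // distrC.
Qed.

(** The two updates of [y] at [e] are [y] and its flip, and flipping is an involution. This is how a
    single edge is averaged out. *)
Lemma sum_flip e (F : conf -> R) :
  \sum_y (F (upd e true y) + F (upd e false y)) = 2 * \sum_y F y.
Proof.
pose flip y := upd e (~~ y e) y.
have flipK : involutive flip.
  by move=> y; rewrite /flip upd_upd upd_same negbK upd_id.
have -> : \sum_y (F (upd e true y) + F (upd e false y)) =
    \sum_y (F y + F (flip y)).
  apply: eq_bigr => y _; rewrite /flip -{3}(upd_id e y).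
  by case: (y e) => //=; rewrite addrC.
rewrite big_split /= mulr2n mulrDl mul1r; congr (_ + _).
by rewrite [RHS](reindex_inj (inv_inj flipK)).
Qed.

Variable T : conf -> R.

Definition gibbsZ : R := \sum_y expR (T y).
Definition gmass y : R := expR (T y) / gibbsZ.
Definition mean f : R := \sum_y gmass y * f y.

Lemma gibbsZ_gt0 : 0 < gibbsZ.
Proof.
rewrite /gibbsZ (bigD1 ([ffun=> false] : conf))//= ltr_pwDl ?expR_gt0//.
by apply: sumr_ge0 => y _; exact: expR_ge0.
Qed.

Lemma gmass_gt0 y : 0 < gmass y.
Proof. by rewrite divr_gt0 ?expR_gt0// gibbsZ_gt0. Qed.

Lemma gmass_ge0 y : 0 <= gmass y. Proof. exact/ltW/gmass_gt0. Qed.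

Lemma sum_gmass : \sum_y gmass y = 1.
Proof. by rewrite -mulr_suml divff// gt_eqF// gibbsZ_gt0. Qed.

Lemma eq_mean f g : f =1 g -> mean f = mean g.
Proof. by move=> fg; apply: eq_bigr => y _; rewrite fg. Qed.

Lemma mean_cst (c : R) : mean (fun=> c) = c.
Proof. by rewrite /mean -mulr_suml sum_gmass mul1r. Qed.

Lemma meanD f g : mean (fun y => f y + g y) = mean f + mean g.
Proof. by rewrite /mean -big_split; apply: eq_bigr => y _; rewrite mulrDr. Qed.

Lemma meanN f : mean (fun y => - f y) = - mean f.
Proof. by rewrite /mean -sumrN; apply: eq_bigr => y _; rewrite mulrN. Qed.

Lemma meanB f g : mean (fun y => f y - g y) = mean f - mean g.
Proof. by rewrite meanD meanN. Qed.

Lemma meanZ (c : R) f : mean (fun y => c * f y) = c * mean f.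
Proof. by rewrite /mean mulr_sumr; apply: eq_bigr => y _; rewrite mulrCA. Qed.

Lemma mean_sum (J : Type) (s : seq J) (P : pred J) (F : J -> conf -> R) :
  mean (fun y => \sum_(j <- s | P j) F j y) = \sum_(j <- s | P j) mean (F j).
Proof.
rewrite /mean [RHS]exchange_big /=; apply: eq_bigr => y _; by rewrite mulr_sumr.
Qed.

Lemma ler_mean f g : (forall y, f y <= g y) -> mean f <= mean g.
Proof. by move=> fg; apply: ler_sum => y _; rewrite ler_wpM2l// gmass_ge0. Qed.

Lemma mean_ge0 f : (forall y, 0 <= f y) -> 0 <= mean f.
Proof. by move=> f0; apply: sumr_ge0 => y _; rewrite mulr_ge0// gmass_ge0. Qed.

Lemma norm_mean f : `|mean f| <= mean (fun y => `|f y|).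
Proof.
apply: le_trans (ler_norm_sum _ _ _) _; apply: ler_sum => y _.
by rewrite normrM ger0_norm// gmass_ge0.
Qed.

Lemma mean_le f (c : R) : (forall y, f y <= c) -> mean f <= c.
Proof. by move=> fc; rewrite -(mean_cst c); exact: ler_mean. Qed.

Lemma mean_ge f (c : R) : (forall y, c <= f y) -> c <= mean f.
Proof. by move=> fc; rewrite -(mean_cst c); exact: ler_mean. Qed.

Lemma mean_CS f g :
  mean (fun y => f y * g y) ^+ 2 <= mean (fun y => f y ^+ 2) * mean (fun y => g y ^+ 2).
Proof.
set A := mean (fun y => f y ^+ 2); set B := mean (fun y => g y ^+ 2).
set C := mean _.
have A0 : 0 <= A by apply: mean_ge0 => y; exact: sqr_ge0.
have B0 : 0 <= B by apply: mean_ge0 => y; exact: sqr_ge0.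
have H (a b : R) : 0 <= a ^+ 2 * A - 2 * a * b * C + b ^+ 2 * B.
  have -> : a ^+ 2 * A - 2 * a * b * C + b ^+ 2 * B =
      mean (fun y => (a * f y - b * g y) ^+ 2).
    rewrite /A /B /C -!meanZ -meanB -meanD; apply: eq_mean => y; ring.
  by apply: mean_ge0 => y; exact: sqr_ge0.
exact: quad_form_ge0_CS.
Qed.

Lemma mean_sqr f : mean f ^+ 2 <= mean (fun y => f y ^+ 2).
Proof.
have := mean_CS f (fun=> 1); rewrite mean_cst expr1n mulr1.
by under eq_mean do rewrite mulr1.
Qed.

Definition cov f g := mean (fun y => f y * g y) - mean f * mean g.
Definition var f := cov f f.

Lemma covE f g : cov f g = mean (fun y => (f y - mean f) * (g y - mean g)).
Proof.
rewrite /cov; under [RHS]eq_mean do rewrite mulrBl !mulrBr.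
rewrite !meanB mean_cst !meanZ.
under [mean (fun y => f y * mean g)]eq_mean do rewrite mulrC.
by rewrite meanZ; ring.
Qed.

Lemma varE f : var f = mean (fun y => (f y - mean f) ^+ 2).
Proof. by rewrite /var covE. Qed.

Lemma var_ge0 f : 0 <= var f.
Proof. by rewrite varE; apply: mean_ge0 => y; exact: sqr_ge0. Qed.

(* The conditional probability that [e] is present given the other edges;
   [glaub e] is the corresponding conditional expectation. *)
Definition q e y : R := sig (D e T y).

Definition glaub e f y : R :=
  q e y * f (upd e true y) + (1 - q e y) * f (upd e false y).

Lemma q_upd e c y : q e (upd e c y) = q e y.
Proof. by rewrite /q D_upd. Qed.

Lemma q_ge0 e y : 0 <= q e y. Proof. exact: sig_ge0. Qed.
Lemma q_le1 e y : q e y <= 1. Proof. exact: sig_le1. Qed.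

(** The weights of the two updates at [e] are in the ratio q_e to 1 - q_e, so resampling [e] from
    its conditional law preserves the measure. *)
Lemma mean_glaub e f : mean (glaub e f) = mean f.
Proof.
apply: (@mulfI _ 2) => //; rewrite /mean -!(sum_flip e).
apply: eq_bigr => y _.
rewrite /glaub !upd_upd !q_upd /gmass.
set t1 := T (upd e true y); set t0 := T (upd e false y).
have -> : q e y = expR t1 / (expR t1 + expR t0).
  rewrite /q /sig /D -/t1 -/t0 expRD expRN.
  have h0 : expR t0 != 0 by rewrite gt_eqF// expR_gt0.
  have h1 : expR t1 + expR t0 != 0 by rewrite gt_eqF// addr_gt0// expR_gt0.
  by field; rewrite h0 h1.
have h0 := gibbsZ_gt0.
have h1 : expR t1 + expR t0 != 0 by rewrite gt_eqF// addr_gt0// expR_gt0.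
by field; rewrite h1 gt_eqF.
Qed.

Lemma mean_Yq e f : mean (fun y => (y e)%:R * f (upd e true y)) =
  mean (fun y => q e y * f (upd e true y)).
Proof.
rewrite -[LHS](mean_glaub e); apply: eq_mean => y.
by rewrite /glaub !upd_same upd_upd mul1r mul0r mulr0 addr0.
Qed.

(* Plays the role of Gaussian integration by parts. *)
Lemma mean_Yq_stein e f : mean (fun y => ((y e)%:R - q e y) * f y) =
  mean (fun y => q e y * (1 - q e y) * D e f y).
Proof.
rewrite -[LHS](mean_glaub e); apply: eq_mean => y.
by rewrite /glaub !upd_same !q_upd /D /=; ring.
Qed.

End gibbs.

(** * The four functions theorem and the FKG inequality *)

Lemma four_functions_step (R : realType) (a0 a1 b0 b1 c0 c1 d0 d1 : R) :
  0 <= a0 -> 0 <= a1 -> 0 <= b0 -> 0 <= b1 ->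
  0 <= c0 -> 0 <= c1 -> 0 <= d0 -> 0 <= d1 ->
  a0 * b0 <= c0 * d0 -> a0 * b1 <= c1 * d0 -> a1 * b0 <= c1 * d0 ->
  a1 * b1 <= c1 * d1 -> (a1 + a0) * (b1 + b0) <= (c1 + c0) * (d1 + d0).
Proof.
move=> A0 A1 B0 B1 C0 C1 D0 D1 h00 h01 h10 h11.
(* The mixed products u, v are at most M = c1 d0 and satisfy u v <= M w with w = c0 d1; hence (M -
   u) (M - v) >= 0 gives M (u + v) <= M (M + w). *)
have H : a0 * b1 + a1 * b0 <= c1 * d0 + c0 * d1.
  have [z|nz] := eqVneq (c1 * d0) 0.
    have := mulr_ge0 C0 D1; rewrite z in h01 h10; lra.
  have z : 0 < c1 * d0 by rewrite lt_def nz mulr_ge0.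
  have k : (a0 * b1) * (a1 * b0) <= (c1 * d0) * (c0 * d1).
    have -> : (a0 * b1) * (a1 * b0) = (a0 * b0) * (a1 * b1) by ring.
    have -> : (c1 * d0) * (c0 * d1) = (c0 * d0) * (c1 * d1) by ring.
    by apply: ler_pM => //; exact: mulr_ge0.
  have l : 0 <= (c1 * d0 - a0 * b1) * (c1 * d0 - a1 * b0).
    by rewrite mulr_ge0// subr_ge0.
  rewrite -(ler_pM2l z).
  set M := c1 * d0 in z h01 h10 k l *; set u := a0 * b1 in h01 k l *.
  set v := a1 * b0 in h10 k l *; set w := c0 * d1 in k *.
  by clearbody M u v w; nra.
by rewrite !mulrDl !mulrDr; lra.
Qed.

Section fkg.
Context {R : realType} {E : finType}.
Notation conf := {ffun E -> bool}.
Implicit Types (e : E) (x y : conf) (f g : conf -> R).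

Definition sumc e f y := f (upd e true y) + f (upd e false y).

Definition conf_or x y : conf := [ffun e => x e || y e].
Definition conf_and x y : conf := [ffun e => x e && y e].

Lemma upd_or e c c' x y :
  conf_or (upd e c x) (upd e c' y) = upd e (c || c') (conf_or x y).
Proof. by apply/ffunP => z; rewrite !ffunE; case: eqP. Qed.

Lemma upd_and e c c' x y :
  conf_and (upd e c x) (upd e c' y) = upd e (c && c') (conf_and x y).
Proof. by apply/ffunP => z; rewrite !ffunE; case: eqP. Qed.

Lemma foldr_sumc_ge0 s f : (forall y, 0 <= f y) ->
  forall y, 0 <= foldr sumc f s y.
Proof. by move=> f0; elim: s => //= e s IH y; rewrite addr_ge0. Qed.

Lemma foldr_sumc_four (fa fb fc fd : conf -> R) s :
  (forall y, 0 <= fa y) -> (forall y, 0 <= fb y) ->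
  (forall y, 0 <= fc y) -> (forall y, 0 <= fd y) ->
  (forall x y, fa x * fb y <= fc (conf_or x y) * fd (conf_and x y)) ->
  forall x y, foldr sumc fa s x * foldr sumc fb s y <=
    foldr sumc fc s (conf_or x y) * foldr sumc fd s (conf_and x y).
Proof.
move=> a0 b0 c0 d0 H; elim: s => //= e s IH x y; rewrite /sumc.
apply: four_functions_step; try exact: foldr_sumc_ge0.
- by have := IH (upd e false x) (upd e false y); rewrite upd_or upd_and.
- by have := IH (upd e false x) (upd e true y); rewrite upd_or upd_and.
- by have := IH (upd e true x) (upd e false y); rewrite upd_or upd_and.
- by have := IH (upd e true x) (upd e true y); rewrite upd_or upd_and.
Qed.

Lemma foldr_sumc_const f s x y : (forall e, e \notin s -> x e = y e) ->
  foldr sumc f s x = foldr sumc f s y.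
Proof.
elim: s x y => [|e s IH] x y /= xy.
  by congr f; apply/ffunP => e; exact: xy.
rewrite /sumc; congr (_ + _); apply: IH => e' es; rewrite !ffunE;
  by case: eqP => // /eqP ee; apply: xy; rewrite inE negb_or ee.
Qed.

Lemma sum_foldr_sumc f s :
  \sum_y foldr sumc f s y = 2 ^+ size s * \sum_y f y.
Proof.
elim: s => [|e s IH] /=; first by rewrite expr0 mul1r.
by rewrite (sum_flip e) IH exprS mulrA.
Qed.

(** Once all coordinates are summed out the fold is a constant function, and comparing its total
    over the 2^|E| configurations with [sum_foldr_sumc] identifies the constant. *)
Lemma foldr_sumc_enum f y : foldr sumc f (enum E) y = \sum_y f y.
Proof.
have h : #|{: conf}| = (2 ^ size (enum E))%N.
  by rewrite card_ffun card_bool -cardE.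
have h2 : (2 ^+ size (enum E) : R) != 0 by rewrite expf_neq0 ?pnatr_eq0.
apply: (mulfI h2); rewrite -sum_foldr_sumc.
rewrite [RHS](eq_bigr (fun=> foldr sumc f (enum E) y)) => [|x _]; last first.
  by apply: foldr_sumc_const => e; rewrite mem_enum.
by rewrite sumr_const h -[RHS]mulr_natl natrX.
Qed.

Lemma four_functions (fa fb fc fd : conf -> R) :
  (forall y, 0 <= fa y) -> (forall y, 0 <= fb y) ->
  (forall y, 0 <= fc y) -> (forall y, 0 <= fd y) ->
  (forall x y, fa x * fb y <= fc (conf_or x y) * fd (conf_and x y)) ->
  (\sum_y fa y) * (\sum_y fb y) <= (\sum_y fc y) * (\sum_y fd y).
Proof.
move=> a0 b0 c0 d0 H; pose z : conf := [ffun=> false].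
have := foldr_sumc_four (enum E) a0 b0 c0 d0 H z z.
by rewrite !foldr_sumc_enum.
Qed.

Variable T : conf -> R.
Hypothesis supT : forall x y, T x + T y <= T (conf_or x y) + T (conf_and x y).

(** The four functions are f, g, f g and 1, each times the mass: supermodularity of [T] compares the
    masses, monotonicity the values at the join. *)
Let fkg_ge0 f g : incr f -> incr g -> (forall y, 0 <= f y) ->
  (forall y, 0 <= g y) -> mean T f * mean T g <= mean T (fun y => f y * g y).
Proof.
move=> If Ig f0 g0.
rewrite -[leRHS]mulr1 -(sum_gmass T) /mean.
apply: four_functions => [y|y|y|y|x y].
- by rewrite mulr_ge0 ?gmass_ge0.
- by rewrite mulr_ge0 ?gmass_ge0.
- by rewrite mulr_ge0 ?gmass_ge0// mulr_ge0.
- exact: gmass_ge0.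
rewrite mulrACA [leRHS]mulrAC.
apply: ler_pM.
- exact: mulr_ge0 (gmass_ge0 _ _) (gmass_ge0 _ _).
- exact: mulr_ge0.
- have gm u v : gmass T u * gmass T v = expR (T u + T v) / gibbsZ T ^+ 2.
    by rewrite expRD /gmass expr2 invfM; ring.
  by rewrite !gm ler_pM2r ?ler_expR// invr_gt0 exprn_gt0// gibbsZ_gt0.
- by apply: ler_pM => //; apply: incrP => // e; rewrite ffunE => ->; rewrite ?orbT.
Qed.

Lemma fkg f g : incr f -> incr g -> 0 <= cov T f g.
Proof.
move=> If Ig.
have shift (h : conf -> R) : exists c, forall y, 0 <= h y + c :> R.
  exists (\sum_y `|h y|) => y; rewrite (bigD1 y)//= addrA addr_ge0//.
    by have := ler_norm (- h y); rewrite normrN; lra.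
  by apply: sumr_ge0.
have [c hc] := shift f; have [d hd] := shift g.
have Ish (h : conf -> R) k : incr h -> incr (fun y => h y + k).
  by move=> Ih e y; have := Ih e y; rewrite /D; lra.
have := fkg_ge0 (Ish f c If) (Ish g d Ig) hc hd.
rewrite !meanD !mean_cst.
have -> : mean T (fun y => (f y + c) * (g y + d)) =
   mean T (fun y => f y * g y) + c * mean T g + d * mean T f + c * d.
  rewrite -!meanZ -!meanD -[X in _ + X](mean_cst T) -meanD.
  by apply: eq_mean => y; ring.
by rewrite /cov; lra.
Qed.

End fkg.

(** * Comparison with independent edges, and their exponential moments *)

Section domination.
Context {R : realType} {E : finType}.
Notation conf := {ffun E -> bool}.
Implicit Types (e : E) (x y : conf) (f g : conf -> R) (a : R) (s : seq E).

Definition bern a e f y := a * f (upd e true y) + (1 - a) * f (upd e false y).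

(* The mean of [f] when the edges of [s] are resampled independently, each
   being present with probability [a]. *)
Definition bmean a s f := foldr (bern a) f s.
Arguments bmean : simpl never.

Lemma bmean_cons a e s f : bmean a (e :: s) f = bern a e (bmean a s f).
Proof. by []. Qed.

Lemma bern_le a e f g : 0 <= a <= 1 -> (forall y, f y <= g y) ->
  forall y, bern a e f y <= bern a e g y.
Proof. by move=> /andP[a0 a1] fg y; rewrite lerD// ler_wpM2l// subr_ge0. Qed.

Lemma bmean_le a s f g : 0 <= a <= 1 -> (forall y, f y <= g y) ->
  forall y, bmean a s f y <= bmean a s g y.
Proof. by move=> a01 fg; elim: s => // e s IH; exact: bern_le. Qed.

Lemma bern_cst a e (c : R) y : bern a e (fun=> c) y = c.
Proof. by rewrite /bern /=; ring. Qed.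

Lemma bmean_cst a s (c : R) y : bmean a s (fun=> c) y = c.
Proof.
elim: s y => // e s IH y; rewrite bmean_cons -[RHS](bern_cst a e c y).
by rewrite /bern !IH.
Qed.

Lemma bmean01 a s f : 0 <= a <= 1 -> (forall y, 0 <= f y <= 1) ->
  forall y, 0 <= bmean a s f y <= 1.
Proof.
move=> a01 f01 y; apply/andP; split.
  by rewrite -(bmean_cst a s 0 y); apply: bmean_le => // z; case/andP: (f01 z).
by rewrite -[leRHS](bmean_cst a s 1 y); apply: bmean_le => // z; case/andP: (f01 z).
Qed.

Lemma bmean_sum a s (J : finType) (P : pred J) (F : J -> conf -> R) y :
  bmean a s (fun y => \sum_(j | P j) F j y) y = \sum_(j | P j) bmean a s (F j) y.
Proof.
elim: s y => // e s IH y; rewrite bmean_cons.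
by rewrite /bern !IH !mulr_sumr -big_split.
Qed.

Lemma bmeanZ a s (c : R) f y : bmean a s (fun y => c * f y) y = c * bmean a s f y.
Proof. by elim: s y => // e s IH y; rewrite !bmean_cons /bern !IH; ring. Qed.

Lemma bmean_affine a s (c m : R) f y :
  bmean a s (fun y => c * f y + m) y = c * bmean a s f y + m.
Proof. by elim: s y => // e s IH y; rewrite !bmean_cons /bern !IH; ring. Qed.

Lemma D_bern a e e' f y : D e' (bern a e f) y =
  if e' == e then 0 else a * D e' f (upd e true y) + (1 - a) * D e' f (upd e false y).
Proof.
rewrite /D /bern; case: eqVneq => [->|h]; first by rewrite !upd_upd subrr.
by rewrite !(updC _ _ _ h) /D; ring.
Qed.

Lemma bern_incr a e f : 0 <= a <= 1 -> incr f -> incr (bern a e f).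
Proof.
move=> /andP[a0 a1] If e' y; rewrite D_bern; case: ifP => // _.
by apply: addr_ge0; apply: mulr_ge0; rewrite ?If// subr_ge0.
Qed.

Lemma bmean_incr a s f : 0 <= a <= 1 -> incr f -> incr (bmean a s f).
Proof. by move=> a01 If; elim: s => // e s IH; exact: bern_incr. Qed.

Lemma bmean_lip a s f e (L : R) : 0 <= a <= 1 -> (forall y, `|D e f y| <= L) ->
  forall y, `|D e (bmean a s f) y| <= L.
Proof.
move=> /andP[a0 a1] fL; elim: s => // e' s IH y; rewrite bmean_cons D_bern.
have L0 := le_trans (normr_ge0 _) (fL y).
case: ifP => _; first by rewrite normr0.
apply: le_trans (ler_normD _ _) _; rewrite !normrM.
rewrite (ger0_norm a0) [`|1 - a|]ger0_norm ?subr_ge0//.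
rewrite [leRHS](_ : L = a * L + (1 - a) * L); last by ring.
by rewrite lerD// ler_wpM2l// subr_ge0.
Qed.

Variable T : conf -> R.

(* Resampling one edge with probability [a] can only increase the mean of an
   increasing function, except where its conditional probability exceeds [a]. *)
Lemma dom_up a s f : 0 <= a <= 1 -> incr f -> (forall y, 0 <= f y <= 1) ->
  mean T f <= mean T (bmean a s f) +
    \sum_(e <- s) mean T (fun y => (a < q T e y)%R%:R).
Proof.
move=> a01 If f01; elim: s => [|e s IH]; first by rewrite big_nil addr0.
rewrite bmean_cons.
rewrite big_cons addrA (le_trans IH)// lerD2r.
have g01 := bmean01 s a01 f01.
have Ig := bmean_incr s a01 If.
set g := bmean a s f in g01 Ig *.
rewrite -[leLHS](mean_glaub T e) -meanD; apply: ler_mean => y.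
rewrite /glaub /bern !upd_rcomb -addrA lerD2l.
have h1 := Ig e y; have h2 : D e g y <= 1.
  by rewrite /D; have /andP[_ ?] := g01 (upd e true y);
    have /andP[? _] := g01 (upd e false y); lra.
have q0 := q_ge0 T e y; have q1 := q_le1 T e y; case/andP: a01 => a0 a1.
case: ltP => qa /=; last by rewrite addr0 ler_wpM2r.
by have := mulr_ge0 a0 h1; nra.
Qed.

Lemma dom_down a s f : 0 <= a <= 1 -> incr f -> (forall y, 0 <= f y <= 1) ->
  mean T (bmean a s f) <= mean T f +
    \sum_(e <- s) mean T (fun y => (q T e y < a)%R%:R).
Proof.
move=> a01 If f01; elim: s => [|e s IH]; first by rewrite big_nil addr0.
rewrite bmean_cons.
rewrite big_cons addrCA -lerBlDl (le_trans _ IH)// lerBlDl.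
have g01 := bmean01 s a01 f01.
have Ig := bmean_incr s a01 If.
set g := bmean a s f in g01 Ig *.
rewrite -[mean T g](mean_glaub T e) -meanD; apply: ler_mean => y.
rewrite /glaub /bern !upd_rcomb addrCA lerD2l.
have h1 := Ig e y; have h2 : D e g y <= 1.
  by rewrite /D; have /andP[_ ?] := g01 (upd e true y);
    have /andP[? _] := g01 (upd e false y); lra.
have q0 := q_ge0 T e y; have q1 := q_le1 T e y; case/andP: a01 => a0 a1.
case: ltP => qa /=; last by rewrite add0r ler_wpM2r.
by have := mulr_ge0 q0 h1; nra.
Qed.

Lemma expR_le_quad (x : R) : x <= 2^-1 -> expR x <= 1 + x + 2 * x ^+ 2.
Proof.
move=> x2; have h : 0 < 1 - x by lra.
have : 1 - x <= expR (- x) by have := expR_ge1Dx (- x).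
rewrite expRN => k.
have k2 : expR x <= (1 - x)^-1.
  by rewrite -[expR x]invrK lef_pV2// posrE invr_gt0 expR_gt0.
rewrite (le_trans k2)// -[X in X <= _]mul1r ler_pdivrMr//.
by have := mulr_ge0 (sqr_ge0 x) (_ : 0 <= 1 - 2 * x); rewrite expr2; lra.
Qed.

(** After factoring out the exponential of the mean, the deviations are (1 - a) d and - a d. Their
    linear terms cancel, and [expR_le_quad] leaves 2 a (1 - a) d^2. *)
Lemma bern_expR a (u v : R) : 0 <= a <= 1 -> `|u - v| <= 2^-1 ->
  a * expR u + (1 - a) * expR v <= expR (a * u + (1 - a) * v + 2 * (u - v) ^+ 2).
Proof.
move=> /andP[a0 a1] uv; set d := u - v in uv *; set m := a * u + (1 - a) * v.
have -> : expR u = expR m * expR ((1 - a) * d).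
  by rewrite -expRD; congr expR; rewrite /m /d; ring.
have -> : expR v = expR m * expR (- (a * d)).
  by rewrite -expRD; congr expR; rewrite /m /d; ring.
clearbody m; rewrite expRD !(mulrCA _ (expR m)) -mulrDr ler_pM2l ?expR_gt0//.
apply: (@le_trans _ _ (1 + 2 * d ^+ 2)); last first.
  exact: expR_ge1Dx.
have nd : `|(1 - a) * d| <= 2^-1 /\ `|- (a * d)| <= 2^-1.
  rewrite normrN !normrM (ger0_norm a0) [`|1 - a|]ger0_norm ?subr_ge0//.
  by have := normr_ge0 d; nra.
case: nd => /(le_trans (ler_norm _))/expR_le_quad e1.
move=> /(le_trans (ler_norm _))/expR_le_quad e2.
have b1 : 0 <= 1 - a by lra.
apply: (@le_trans _ _ _ _ _ (lerD (ler_wpM2l a0 e1) (ler_wpM2l b1 e2))).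
have -> : a * (1 + (1 - a) * d + 2 * ((1 - a) * d) ^+ 2) +
  (1 - a) * (1 - a * d + 2 * (- (a * d)) ^+ 2) =
  1 + 2 * (a * (1 - a)) * d ^+ 2 by ring.
rewrite lerD2l ler_wpM2r ?sqr_ge0// ler_piMr//.
by have := mulr_ge0 a0 b1; nra.
Qed.

(** A bounded-difference inequality, one edge at a time: averaging over the edges already treated
    keeps the increment bounds ([bmean_lip]), so that each new edge costs 2 L(e)^2 in the
    exponent. *)
Lemma bmean_expR a s f (L : E -> R) : 0 <= a <= 1 -> (forall e, L e <= 2^-1) ->
  (forall e y, `|D e f y| <= L e) -> forall y,
  bmean a s (fun y => expR (f y)) y <=
    expR (bmean a s f y + 2 * \sum_(e <- s) L e ^+ 2).
Proof.
move=> a01 L1 fL; elim: s => [|e s IH] y.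
  by rewrite big_nil mulr0 addr0.
rewrite !bmean_cons.
have h := @bern_le a e _ _ a01 IH y; apply: le_trans h _.
rewrite big_cons mulrDr addrA [leRHS]expRD /bern !(expRD _ (2 * \sum_(_ <- s) _)).
rewrite !mulrA -mulrDl ler_pM2r ?expR_gt0//.
have DL := bmean_lip s a01 (fL e) y.
apply: le_trans (bern_expR a01 (le_trans DL (L1 e))) _.
rewrite ler_expR lerD2l -[leRHS]mulrA -expr2 ler_pM2l// -real_normK ?num_real//.
by rewrite ler_sqr ?nnegrE// (le_trans _ DL).
Qed.

End domination.

(* Upgrades a geometric bound with an arbitrary constant to a one-step bound:
   this is how contraction of the oscillation under the Glauber dynamics yields
   a spectral gap. *)
Lemma log_convex_growth (R : realType) (a : nat -> R) (C r : R) :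
  0 <= r -> (forall m, 0 <= a m) -> (forall m, a m <= C * r ^+ m) ->
  (forall m, a m.+1 ^+ 2 <= a m * a m.+2) -> a 1%N <= r * a 0%N.
Proof.
move=> r0 a0 aC conv; rewrite leNgt; apply/negP => h.
have a1 : 0 < a 1%N by rewrite (le_lt_trans _ h)// mulr_ge0.
have apos : forall m, 0 < a m.
  case=> //; first by rewrite lt_def a0 andbT; apply/eqP => z;
    have := conv 0%N; rewrite z mul0r leNgt exprn_gt0.
  elim=> // m IH; rewrite lt_def a0 andbT; apply/eqP => z.
  by have := conv m; rewrite z mulr0 leNgt exprn_gt0.
(* Suppose the first ratio exceeds [r]. By log-convexity the later ratios are at least [rho], so
   rho^m a_0 <= C r^m for all m, which Bernoulli's inequality refutes for large m. *)
pose rho := a 1%N / a 0%N.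
have rr : r < rho by rewrite ltr_pdivlMr.
have step m : rho * a m <= a m.+1.
  elim: m => [|m IH]; first by rewrite /rho divfK// gt_eqF.
  rewrite -(ler_pM2l (apos m)) (le_trans _ (conv m))//.
  by rewrite mulrCA expr2 mulrA ler_wpM2r// ltW.
have grow m : rho ^+ m * a 0%N <= a m.
  elim: m => [|m IH]; first by rewrite expr0 mul1r.
  rewrite exprS -mulrA (le_trans _ (step m))// ler_wpM2l//.
  exact: (le_trans r0 (ltW rr)).
have rho0 : 0 < rho by exact: le_lt_trans rr.
have r0' : 0 < r.
  rewrite lt_def r0 andbT; apply/eqP => z.
  by have := aC 1%N; rewrite z expr1 mulr0 leNgt a1.
have C0 : 0 < C by have := aC 0%N; rewrite expr0 mulr1; exact: lt_le_trans.
have x1 : 0 < rho / r - 1 by rewrite subr_gt0 ltr_pdivlMr// mul1r.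
have bern m : 1 + m%:R * (rho / r - 1) <= (rho / r) ^+ m.
  elim: m => [|m IH]; first by rewrite mul0r addr0 expr0.
  rewrite exprS; set t := rho / r in x1 IH *.
  have t0 : 0 <= t by rewrite /t divr_ge0// ltW.
  apply: le_trans (ler_wpM2l t0 IH); rewrite -natr1.
  have := mulr_ge0 (ler0n R m) (sqr_ge0 (t - 1)); rewrite expr2; lra.
pose m := Num.trunc ((C / a 0%N) / (rho / r - 1)).
have hm : C / a 0%N < 1 + m.+1%:R * (rho / r - 1).
  rewrite (@lt_trans _ _ (m.+1%:R * (rho / r - 1)))// ?ltrDr//.
  by rewrite -ltr_pdivrMr//; exact: Num.Theory.truncnS_gt.
have := lt_le_trans hm (bern m.+1).
rewrite ltr_pdivrMr// expr_div_n mulrAC ltr_pdivlMr ?exprn_gt0// ltNge.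
by rewrite (le_trans (grow _))//.
Qed.

Lemma sum_cst (R : pzSemiRingType) (J : finType) (c : R) :
  \sum_(j : J) c = #|J|%:R * c.
Proof. by rewrite big_const iter_addr_0 mulr_natl. Qed.

(** * Glauber dynamics and the Poincare inequality *)

Section poincare.
Context {R : realType} {E : finType}.
Notation conf := {ffun E -> bool}.
Implicit Types (e : E) (x y : conf) (f g : conf -> R).
Variable T : conf -> R.

Definition edges y : R := \sum_e (y e)%:R.
Definition Qsum y : R := \sum_e q T e y.

Lemma D_edges e y : D e edges y = 1.
Proof.
rewrite /D /edges (bigD1 e)//= [X in _ - X](bigD1 e)//= !upd_same /=.
under eq_bigr do rewrite upd_neq//.
under [X in _ - (_ + X)]eq_bigr do rewrite upd_neq//.
by ring.
Qed.

Definition glauber f y : R := #|E|%:R^-1 * \sum_e glaub T e f y.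

Hypothesis q_incr : forall e, incr (q T e).

(** Raising another edge raises both outcomes of the resampling and, by [q_incr], the chance of the
    larger outcome. *)
Lemma glaub_incr e f : incr f -> incr (glaub T e f).
Proof.
move=> If e' y; rewrite /D /glaub !upd_rcomb.
have [->|h] := eqVneq e' e; first by rewrite !q_upd !D_upd !upd_upd subrr.
have q1 := q_incr e e' y; rewrite /D in q1.
have f0 := If e' (upd e false y); have f1 := If e' (upd e true y).
have d0 := If e (upd e' false y); rewrite /D in f0 f1 d0.
rewrite !(updC _ _ _ h) in f0 f1.
rewrite /D.
have k0 := q_ge0 T e (upd e' false y); have k1 := q_le1 T e (upd e' false y).
have k2 := q_ge0 T e (upd e' true y); have k3 := q_le1 T e (upd e' true y).
move: (q T e (upd e' true y)) (q T e (upd e' false y)) q1 k0 k1 k2 k3 => u v *.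
move: f0 f1 d0.
move: (f _) (f _) (f _) (f _) => a b c d *.
nra.
Qed.

Lemma glauber_incr f : incr f -> incr (glauber f).
Proof.
move=> If e y; rewrite /D /glauber -mulrBr mulr_ge0 ?invr_ge0 ?ler0n//.
by rewrite -sumrB sumr_ge0// => e' _; exact: glaub_incr.
Qed.

(** Reversibility: conditionally on the other edges, both sides average to
    [glaub T e f * glaub T e g]. *)
Lemma mean_glaub_adj e f g :
  mean T (fun y => glaub T e f y * g y) = mean T (fun y => f y * glaub T e g y).
Proof.
rewrite -[LHS](mean_glaub T e) -[RHS](mean_glaub T e); apply: eq_mean => y.
by rewrite /glaub !q_upd !upd_upd; ring.
Qed.

Lemma glauber_adj f g :
  mean T (fun y => glauber f y * g y) = mean T (fun y => f y * glauber g y).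
Proof.
under eq_mean do rewrite /glauber -mulrA mulr_suml.
under [RHS]eq_mean do rewrite /glauber mulrCA mulr_sumr.
by rewrite !meanZ !mean_sum; congr (_ * _); apply: eq_bigr => e _; exact: mean_glaub_adj.
Qed.

Lemma glaub_lin e (c : R) f g y :
  glaub T e (fun y => c * f y + g y) y = c * glaub T e f y + glaub T e g y.
Proof. by rewrite /glaub; ring. Qed.

Lemma glauber_lin (c : R) f g y :
  glauber (fun y => c * f y + g y) y = c * glauber f y + glauber g y.
Proof.
rewrite /glauber; under eq_bigr do rewrite glaub_lin.
by rewrite big_split /= -mulr_sumr; ring.
Qed.

Hypothesis E0 : (0 < #|E|)%N.
Let N : R := #|E|%:R.
Let N0 : 0 < N. Proof. by rewrite ltr0n. Qed.

Lemma mean_glauber f : mean T (glauber f) = mean T f.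
Proof.
rewrite /glauber meanZ mean_sum (eq_bigr (fun=> mean T f)).
  by rewrite sum_cst mulKf// gt_eqF.
by move=> e _; exact: mean_glaub.
Qed.

Lemma glauber_edges y : glauber edges y = edges y + N^-1 * (Qsum y - edges y).
Proof.
rewrite /glauber (eq_bigr (fun e => edges y + (q T e y - (y e)%:R))); last first.
  move=> e _; rewrite /glaub upd_rcomb D_edges [edges y](upd_case e) upd_rcomb D_edges.
  by ring.
by rewrite big_split /= sum_cst sumrB mulrDr mulKf// gt_eqF.
Qed.

Variable kappa : R.
Hypothesis kappa1 : kappa < 1.
Hypothesis DQ : forall e y, D e Qsum y <= kappa.

(** Adding an edge e changes [glauber edges] by 1 - (1 - D_e Q) / N: with probability 1/N the edge
    is itself resampled, and the other edges respond by D_e Q / N in total. *)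
Let r : R := 1 - (1 - kappa) / N.

Let DQ0 e y : 0 <= D e Qsum y.
Proof. by rewrite /D /Qsum -sumrB sumr_ge0// => e' _; exact: q_incr. Qed.

Let kappa0 : 0 <= kappa.
Proof.
have /card_gt0P[e _] := E0.
exact: le_trans (DQ0 e [ffun=> false]) (DQ e _).
Qed.

Let r0 : 0 <= r.
Proof.
rewrite /r subr_ge0 ler_pdivrMr// mul1r.
by have : 1 <= N by [rewrite ler1n]; have := kappa0; lra.
Qed.

Lemma D_glauber_edges e y : D e (glauber edges) y <= r.
Proof.
rewrite /D !glauber_edges; have := DQ e y; have := D_edges e y.
rewrite /D => h1 h2.
have -> : edges (upd e true y) = 1 + edges (upd e false y) by lra.
have := ler_wpM2l (ltW (_ : 0 < N^-1)) h2.
rewrite invr_gt0 => /(_ N0); rewrite /r; lra.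
Qed.

(** Increments of [f] are bounded by [L] exactly when L X + f and L X - f are increasing, with X =
    [edges]. The dynamics preserves this monotonicity, so the contraction need only be known for
    X. *)
Lemma glauber_lip f (L : R) : (forall e y, `|D e f y| <= L) ->
  forall e y, `|D e (glauber f) y| <= r * L.
Proof.
move=> fL e y.
have L0 : 0 <= L by exact: le_trans (normr_ge0 _) (fL e y).
have I1 : incr (fun y => L * edges y + f y).
  move=> e' z; have := fL e' z; rewrite ler_norml => /andP[h _].
  by have := D_edges e' z; rewrite /D in h *; nra.
have I2 : incr (fun y => L * edges y + -1 * f y).
  move=> e' z; have := fL e' z; rewrite ler_norml => /andP[_ h].
  by have := D_edges e' z; rewrite /D in h *; nra.
have := glauber_incr I1 e y; have := glauber_incr I2 e y.
rewrite /D !glauber_lin.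
have GN z : glauber (fun y => -1 * f y) z = - glauber f z.
  rewrite /glauber -mulrN -sumrN; congr (_ * _); apply: eq_bigr => e' _.
  by rewrite /glaub; ring.
rewrite !GN => h1 h2.
have := ler_wpM2l L0 (D_glauber_edges e y); rewrite /D => h3.
by rewrite ler_norml; lra.
Qed.

Lemma iter_glauber_lip f (L : R) m : (forall e y, `|D e f y| <= L) ->
  forall e y, `|D e (iter m glauber f) y| <= r ^+ m * L.
Proof.
elim: m => [|m IH] fL e y /=; first by rewrite expr0 mul1r.
by rewrite exprS -mulrA; apply: glauber_lip => e' z; exact: IH.
Qed.

(** Spectral gap. By reversibility the squared norms of the iterates are log-convex, and the
    contraction of increments bounds them by a multiple of r^(2 m); hence already the first step
    contracts the squared norm by r^2. *)
Let poincare0 f : mean T f = 0 ->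
  mean T (fun y => f y * glauber f y) <= r * mean T (fun y => f y ^+ 2).
Proof.
move=> f0; pose fm m := iter m glauber f.
have fm0 m : mean T (fm m) = 0.
  by elim: m => //= m IH; rewrite mean_glauber.
have adj m k : mean T (fun y => fm m.+1 y * fm k y) = mean T (fun y => fm m y * fm k.+1 y).
  by rewrite glauber_adj.
have sq m : mean T (fun y => fm m y * fm m.+2 y) = mean T (fun y => fm m.+1 y ^+ 2).
  by rewrite -adj.
pose a m := mean T (fun y => fm m y ^+ 2).
have a0 m : 0 <= a m by apply: mean_ge0 => y; exact: sqr_ge0.
pose L := \sum_e \sum_y `|D e f y|.
have fL e y : `|D e f y| <= L.
  rewrite /L (bigD1 e)//= (bigD1 y)//= -addrA lerDl addr_ge0//.
    by apply: sumr_ge0.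
  by apply: sumr_ge0 => e' _; apply: sumr_ge0.
have ub m : a m <= (N * L) ^+ 2 * (r ^+ 2) ^+ m.
  rewrite -exprM mulnC exprM -exprMn; apply: mean_le => y.
  have : `|fm m y| <= N * L * r ^+ m.
    rewrite -[fm m y]subr0 -(fm0 m) -[fm m y](mean_cst T) -meanB.
    apply: le_trans (norm_mean _ _) _; apply: mean_le => z.
    rewrite -mulrA [L * _]mulrC; apply: lip_osc; exact: iter_glauber_lip.
  move=> h; rewrite -real_normK ?num_real// ler_sqr ?nnegrE//.
  exact: le_trans h.
have cv m : a m.+1 ^+ 2 <= a m * a m.+2.
  by rewrite {1}/a -sq; exact: mean_CS.
have h := log_convex_growth (sqr_ge0 r) a0 ub cv.
have cs := mean_CS T f (glauber f).
have {}cs : mean T (fun y => f y * glauber f y) ^+ 2 <= (r * a 0%N) ^+ 2.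
  apply: le_trans cs _; rewrite -/(a 0%N) -/(a 1%N).
  by have := ler_wpM2l (a0 0%N) h; rewrite !expr2; lra.
have ra0 : 0 <= r * a 0%N by apply: mulr_ge0 => //; exact: a0.
apply: le_trans (ler_norm _) _; rewrite -ler_sqr ?nnegrE//.
by rewrite real_normK ?num_real.
Qed.

(** The Dirichlet form is 1/N times the sum of E q_e (1 - q_e) (D_e f)^2. The gap (1 - kappa) / N
    and q (1 - q) <= 1/4 produce the constant. *)
Lemma poincare f :
  var T f <= (4 * (1 - kappa))^-1 * \sum_e mean T (fun y => D e f y ^+ 2).
Proof.
pose g y := f y - mean T f.
have g0 : mean T g = 0 by rewrite meanB mean_cst subrr.
have k1 : 0 < 1 - kappa by rewrite subr_gt0.
have Dg e y : D e g y = D e f y by rewrite /D /g; ring.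
have := poincare0 g0; rewrite varE.
have -> : mean T (fun y => g y * glauber g y) = mean T (fun y => g y ^+ 2) -
   N^-1 * \sum_e mean T (fun y => q T e y * (1 - q T e y) * D e g y ^+ 2).
  have -> : mean T (fun y => g y ^+ 2) =
      N^-1 * \sum_(e : E) mean T (fun y => g y ^+ 2).
    by rewrite sum_cst mulKf// gt_eqF.
  rewrite -mulrBr -sumrB.
  under eq_mean do rewrite /glauber mulrCA mulr_sumr.
  rewrite meanZ mean_sum; congr (_ * _); apply: eq_bigr => e _.
  rewrite -[LHS](mean_glaub T e) -[X in X - _](mean_glaub T e) -meanB.
  by apply: eq_mean => y; rewrite /glaub !q_upd !upd_upd /D; ring.
set V := mean T (fun y => g y ^+ 2).
set S1 := \sum_e _; set S2 := \sum_e _.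
have S12 : S1 <= 4^-1 * S2.
  rewrite mulr_sumr; apply: ler_sum => e _; rewrite -meanZ; apply: ler_mean => y.
  by rewrite Dg ler_wpM2r ?sqr_ge0//; exact: sig_deriv_le.
rewrite /r => h.
have {}h : (1 - kappa) * V <= S1.
  rewrite -(@ler_pM2l _ N^-1) ?invr_gt0//; lra.
rewrite invfM mulrAC ler_pdivlMr// mulrC.
exact: le_trans h S12.
Qed.

End poincare.

(** * Polynomials in the edge indicators *)

Section polynomials.
Context {R : realType} {E : finType}.
Notation conf := {ffun E -> bool}.
Implicit Types (e : E) (x y : conf) (B : {set E}) (s : seq E).

Definition mon B y : R := \prod_(e in B) (y e)%:R.

Lemma mon0 y : mon finset.set0 y = 1. Proof. by rewrite /mon big_set0. Qed.

Lemma mon_in e B y : e \in B -> mon B y = (y e)%:R * mon (B :\ e)%SET y.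
Proof. by move=> eB; rewrite /mon (big_setD1 e). Qed.

Lemma mon_upd_notin e c B y : e \notin B -> mon B (upd e c y) = mon B y.
Proof.
move=> eB; apply: eq_bigr => e' e'B; rewrite upd_neq//.
by apply: contraNneq eB => <-.
Qed.

Lemma mon_upd_in e c B y : e \in B -> mon B (upd e c y) = c%:R * mon (B :\ e)%SET y.
Proof.
by move=> eB; rewrite (mon_in _ eB) upd_same mon_upd_notin// !inE eqxx.
Qed.

Lemma D_mon e B y : D e (mon B) y = if e \in B then mon (B :\ e)%SET y else 0.
Proof.
rewrite /D; case: (boolP (e \in B)) => eB.
  by rewrite !mon_upd_in//= mul1r mul0r subr0.
by rewrite !mon_upd_notin// subrr.
Qed.

Lemma mon_bool B y : mon B y = [forall e in B, y e]%:R.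
Proof.
case: (boolP [forall e in B, y e]) => [/forall_inP h|].
  by rewrite /mon big1// => e /h ->.
rewrite negb_forall_in => /exists_inP[e eB /negbTE ye].
by rewrite (mon_in _ eB) ye mul0r.
Qed.

Lemma mon_ge0 B y : 0 <= mon B y.
Proof. by rewrite mon_bool ler0n. Qed.

Lemma mon_le1 B y : mon B y <= 1.
Proof. by rewrite mon_bool lern1 leq_b1. Qed.

Lemma mon_incr B : incr (mon B).
Proof. by move=> e y; rewrite D_mon; case: ifP => // _; exact: mon_ge0. Qed.

(** Monomials are indicators: the value at the meet is the product of the two values, and the value
    at the join dominates both, which leaves finitely many cases. *)
Lemma mon_supmod B x y :
  mon B x + mon B y <= mon B (conf_or x y) + mon B (conf_and x y).
Proof.
have -> : mon B (conf_and x y) = mon B x * mon B y.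
  by rewrite /mon -big_split; apply: eq_bigr => e _ /=; rewrite ffunE -natrM mulnb.
have hx : mon B x <= mon B (conf_or x y).
  by apply: incrP (@mon_incr B) _ _ _ => e; rewrite ffunE => ->.
have hy : mon B y <= mon B (conf_or x y).
  by apply: incrP (@mon_incr B) _ _ _ => e; rewrite ffunE => ->; rewrite orbT.
rewrite !mon_bool in hx hy *.
by move: hx hy; do 3 case: [forall e in B, _] => /=; lra.
Qed.

(** For at most one edge there is equality, so a coefficient of either sign preserves
    supermodularity. This is what lets the parameter of the single edge be negative. *)
Lemma mon_mod B x y : (#|B| <= 1)%N ->
  mon B x + mon B y = mon B (conf_or x y) + mon B (conf_and x y).
Proof.
rewrite leq_eqVlt ltnS leqn0 => /orP[/cards1P[e ->]|/eqP/cards0_eq ->].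
  rewrite /mon !big_set1 !ffunE; case: (x e); case: (y e) => /=; lra.
by rewrite !mon0.
Qed.

Lemma bmean_mon a s B y : uniq s ->
  bmean a s (mon B) y = a ^+ #|(B :&: [set e in s])%SET| *
    mon (B :\: [set e in s])%SET y.
Proof.
elim: s y => [|e s IH] y.
  by move=> _; rewrite (_ : [set e in [::]]%SET = finset.set0) ?finset.setI0 ?cards0 ?finset.setD0 ?mul1r//.
rewrite cons_uniq => /andP[es us]; rewrite bmean_cons /bern !IH//.
rewrite set_cons; set S := [set e in s]%SET.
have eS : e \notin S by rewrite inE.
case: (boolP (e \in B)) => eB.
  have eBS : e \in (B :\: S)%SET by rewrite inE eS eB.
  rewrite !mon_upd_in//= mul0r !mulr0 addr0 mul1r.
  have -> : (B :&: (e |: S))%SET = (e |: (B :&: S))%SET.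
    by apply/finset.setP => z; rewrite !inE; case: eqVneq => [->|_]; rewrite ?eB.
  rewrite cardsU1 inE eB (negbTE eS) /= exprS -mulrA; congr (_ * (_ * mon _ _)).
  by apply/finset.setP => z; rewrite !inE negb_or andbA.
have eBS : e \notin (B :\: S)%SET by rewrite inE (negbTE eB) andbF.
rewrite !mon_upd_notin//.
have -> : (B :&: (e |: S))%SET = (B :&: S)%SET.
  by apply/finset.setP => z; rewrite !inE; case: eqVneq => // ->; rewrite (negbTE eB).
have -> : (B :\: (e |: S))%SET = (B :\: S)%SET.
  by apply/finset.setP => z; rewrite !inE; case: eqVneq => // ->; rewrite (negbTE eB) !andbF.
by ring.
Qed.

Lemma bmean_mon_enum a B y : bmean a (enum E) (mon B) y = a ^+ #|B|.
Proof.
rewrite bmean_mon ?enum_uniq//.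
have -> : [set e in enum E]%SET = finset.setT.
  by apply/finset.setP => e; rewrite !inE mem_enum.
by rewrite finset.setIT finset.setDT mon0 mulr1.
Qed.

Section poly.
Context {J : finType} (P : pred J) (c : J -> R) (B : J -> {set E}).

Definition poly y : R := \sum_(j | P j) c j * mon (B j) y.

(** The discrete derivative of [poly] at [e] when all other edges are present, hence its maximum for
    nonnegative weights. *)
Definition infl e : R := \sum_(j | P j && (e \in B j)) c j.

Lemma D_poly e y : D e poly y =
  \sum_(j | P j && (e \in B j)) c j * mon (B j :\ e)%SET y.
Proof.
rewrite /D /poly -sumrB big_mkcondr /=; apply: eq_bigr => j _.
rewrite -mulrBr -[_ - _]/(D e (mon (B j)) y) D_mon.
by case: ifP => // _; rewrite mulr0.
Qed.

Lemma bmean_poly a y : bmean a (enum E) poly y = \sum_(j | P j) c j * a ^+ #|B j|.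
Proof.
by rewrite bmean_sum; apply: eq_bigr => j _; rewrite bmeanZ bmean_mon_enum.
Qed.

(* No edge has an influence larger than O(1/n), and the mean under the product
   measure of density [z] is [G z + O(1/n)]. *)
Record nice (K n : R) (G : R -> R) : Prop := Nice {
  nice_ge0 : forall j, P j -> (0 < #|B j|)%N -> 0 <= c j;
  nice_infl : forall e, infl e <= K / n;
  nice_sum : \sum_e infl e <= K;
  nice_mf : forall z, 0 <= z <= 1 ->
    `|\sum_(j | P j) c j * z ^+ #|B j| - G z| <= K / n }.

Variables (K n : R) (G : R -> R).
Hypothesis Hn : nice K n G.

Let cge0 j e : P j && (e \in B j) -> 0 <= c j.
Proof. by move=> /andP[Pj ej]; apply: (nice_ge0 Hn) => //; apply/card_gt0P; exists e. Qed.

Lemma infl_ge0 e : 0 <= infl e.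
Proof. by apply: sumr_ge0 => j; exact: cge0. Qed.

Lemma D_poly_bound e y : 0 <= D e poly y <= infl e.
Proof.
rewrite D_poly; apply/andP; split.
  by apply: sumr_ge0 => j Pj; rewrite mulr_ge0 ?mon_ge0 ?(cge0 Pj).
apply: ler_sum => j Pj; rewrite ler_piMr ?mon_le1//; exact: cge0 Pj.
Qed.

Lemma poly_incr : incr poly.
Proof. by move=> e y; have /andP[] := D_poly_bound e y. Qed.

Lemma D_poly_norm e y : `|D e poly y| <= infl e.
Proof. by have /andP[h0 h1] := D_poly_bound e y; rewrite ger0_norm. Qed.

Lemma sum_infl_sqr : \sum_e infl e ^+ 2 <= K ^+ 2 / n.
Proof.
apply: (@le_trans _ _ (\sum_e K / n * infl e)).
  by apply: ler_sum => e _; rewrite expr2 ler_wpM2r ?infl_ge0// (nice_infl Hn).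
rewrite -mulr_sumr expr2 [leRHS]mulrAC; apply: ler_wpM2l; last exact: (nice_sum Hn).
(* What remains is 0 <= K / n: an edge provides it through its influence, and without edges it comes
   from [nice_mf]. *)
have [e _|E0] := pickP (pred_of_simpl (@predT E)).
  exact: le_trans (infl_ge0 e) (nice_infl Hn e).
by have := nice_mf Hn (_ : 0 <= 0 <= 1); rewrite lexx ler01 => /(_ isT) /(le_trans (normr_ge0 _)).
Qed.

Lemma sum_infl : \sum_e infl e = \sum_(j | P j) c j * #|B j|%:R.
Proof.
rewrite /infl; under eq_bigr do rewrite big_mkcondr.
rewrite exchange_big /=; apply: eq_bigr => j _.
by rewrite -big_mkcond /= sumr_const mulr_natr.
Qed.

End poly.

End polynomials.

(** * Mean-field Hamiltonians and their first and second derivatives *)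

Section system.
Context {R : realType} {E I : finType}.
Notation conf := {ffun E -> bool}.
Implicit Types (e : E) (y : conf).
Variables (b : I -> R) (A : I -> {set E}).

Definition ham : conf -> R := poly predT b A.
Definition dT e : conf -> R := poly (fun i => e \in A i) b (fun i => A i :\ e)%SET.
(** The sum over e' of the mixed second derivatives of [ham] at e and e' (see [sum_D_dT]). Up to
    factors sig' it is the increment of Q at [e]. *)
Definition dS e : conf -> R :=
  poly (fun j : I * E => (e \in A j.1) && (j.2 \in A j.1 :\ e)%SET)
    (fun j => b j.1) (fun j => A j.1 :\ j.2 :\ e)%SET.

Lemma D_ham e y : D e ham y = dT e y.
Proof. by rewrite D_poly; apply: eq_bigl => i. Qed.

Lemma sum_D_dT e y : \sum_e' D e (dT e') y = dS e y.
Proof.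
rewrite /dS /poly; under eq_bigr do rewrite D_poly.
rewrite (exchange_big_dep (fun i => e \in A i)) /=; last first.
  by move=> e' i _ /andP[_]; rewrite !inE => /andP[].
rewrite pair_big_dep /=; apply: eq_bigl => -[i e'] /=.
rewrite !inE; case: (e \in A i) => //=; rewrite ?andbF//.
by rewrite andbC eq_sym !andbT.
Qed.

(* [V z] and [V' z] are the limiting means of [dT e] and [dS e] under the product
   measure of density [z]; in the ERGM they are [2 Phi z] and [2 Phi' z], and [n]
   is the number of vertices. *)
Record mean_field (K n : R) (V V' : R -> R) : Prop := MeanField {
  mf_ge0 : forall i, (1 < #|A i|)%N -> 0 <= b i;
  mf_pair : forall e e', e != e' ->
    \sum_(i | (e \in A i) && (e' \in A i)) b i * #|A i|%:R <= K / n;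
  mf_mom : forall e, \sum_(i | e \in A i) b i * (#|A i|.-1 * #|A i|)%:R <= K;
  mf_V : forall e z, 0 <= z <= 1 ->
    `|\sum_(i | e \in A i) b i * z ^+ (#|A i| - 1) - V z| <= K / n;
  mf_V' : forall e z, 0 <= z <= 1 ->
    `|\sum_(i | e \in A i) b i * (#|A i| - 1)%:R * z ^+ (#|A i| - 2) - V' z| <= K / n }.

Variables (K n : R) (V V' : R -> R).
Hypothesis H : mean_field K n V V'.

Lemma ham_supmod x y : ham x + ham y <= ham (conf_or x y) + ham (conf_and x y).
Proof.
rewrite /ham /poly -!big_split; apply: ler_sum => i _ /=; rewrite -!mulrDr.
case: (leqP #|A i| 1%N) => hi; first by rewrite mon_mod.
by rewrite ler_wpM2l ?mon_supmod// (mf_ge0 H).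
Qed.

Lemma cardD1_in (B : {set E}) e : e \in B -> #|(B :\ e)%SET| = (#|B| - 1)%N.
Proof. by move=> eB; rewrite (cardsD1 e B) eB addKn. Qed.

Let gt1 i e e' : e != e' -> e \in A i -> e' \in A i -> (1 < #|A i|)%N.
Proof.
move=> ee eA e'A; rewrite (cardsD1 e) eA add1n ltnS; apply/card_gt0P.
by exists e'; rewrite !inE eq_sym ee.
Qed.

Let infl_dT e e' :
  infl (fun i => e \in A i) b (fun i => A i :\ e)%SET e' =
  if e == e' then 0 else \sum_(i | (e \in A i) && (e' \in A i)) b i.
Proof.
rewrite /infl; case: eqVneq => [->|h].
  by rewrite big_pred0// => i; rewrite !inE eqxx andbF.
by apply: eq_bigl => i; rewrite !inE eq_sym h.
Qed.

Let Kn0 e : 0 <= K / n.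
Proof.
by have := mf_V H e (_ : 0 <= 0 <= 1); rewrite lexx ler01 => /(_ isT) /(le_trans (normr_ge0 _)).
Qed.

Lemma nice_dT e :
  nice (fun i => e \in A i) b (fun i => A i :\ e)%SET K n V.
Proof.
split.
- move=> i eA; rewrite cardD1_in// subn_gt0; exact: (mf_ge0 H).
- move=> e'; rewrite infl_dT; case: eqVneq => [_|h]; first exact: Kn0.
  apply: le_trans (mf_pair H h); apply: ler_sum => i /andP[eA e'A].
  have g1 := gt1 h eA e'A.
  by rewrite ler_peMr ?(mf_ge0 H)// ler1n ltnW.
- rewrite sum_infl; apply: le_trans (mf_mom H e); apply: ler_sum => i eA.
  rewrite cardD1_in// subn1; case: (leqP #|A i| 1%N) => h.
    by move: h; case: #|A i| => [|[]]//= _; rewrite ?mul0n.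
  rewrite ler_wpM2l ?(mf_ge0 H)// ler_nat leq_pmulr//.
  exact: ltnW.
- move=> z z01; have := mf_V H e z01.
  by under eq_bigr => i eA do rewrite -(cardD1_in eA).
Qed.

Lemma nice_dS e :
  nice (fun j : I * E => (e \in A j.1) && (j.2 \in A j.1 :\ e)%SET)
    (fun j => b j.1) (fun j => A j.1 :\ j.2 :\ e)%SET K n V'.
Proof.
have cB (j : I * E) : (e \in A j.1) && (j.2 \in A j.1 :\ e)%SET ->
    (1 < #|A j.1|)%N /\ #|(A j.1 :\ j.2 :\ e)%SET| = (#|A j.1| - 2)%N.
  case: j => i e' /=; rewrite !inE => /and3P[eA ee e'A].
  split; first exact: gt1 ee e'A eA.
  rewrite cardD1_in; last by rewrite !inE eq_sym ee.
  by rewrite cardD1_in// -subnDA.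
have pairS (F : I -> R) :
    \sum_(j : I * E | (e \in A j.1) && (j.2 \in A j.1 :\ e)%SET) F j.1 =
    \sum_(i | e \in A i) (#|A i| - 1)%:R * F i.
  rewrite -(pair_big_dep (fun i => e \in A i) (fun i e' => e' \in (A i :\ e)%SET) (fun i _ => F i)) /=.
  by apply: eq_bigr => i eA; rewrite sumr_const cardD1_in// mulr_natl.
split.
- by move=> j /cB[h _] _; exact: (mf_ge0 H).
- move=> e''; rewrite /infl.
  have [->|h] := eqVneq e e''.
    rewrite big_pred0; first exact: Kn0.
    by move=> j; rewrite !inE eqxx !andbF.
  apply: le_trans (mf_pair H h).
  rewrite (eq_bigl (fun j : I * E => ((e \in A j.1) && (e'' \in A j.1)) &&
     ((j.2 \in A j.1 :\ e)%SET && (e'' \in (A j.1 :\ j.2 :\ e)%SET)))); last first.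
    move=> [i e'] /=; rewrite !inE; case: (e \in A i) => //=.
    by case: (e'' \in A i); rewrite ?andbF.
  rewrite -(pair_big_dep (fun i => (e \in A i) && (e'' \in A i))
    (fun i e' => (e' \in A i :\ e)%SET && (e'' \in (A i :\ e' :\ e)%SET)) (fun i _ => b i)) /=.
  apply: ler_sum => i /andP[eA e''A]; have g1 := gt1 h eA e''A.
  (* For fixed [i] at most |A i| edges e' occur, which is why [mf_pair] carries this factor. *)
  rewrite mulr_natr -sumr_const big_mkcond [leRHS]big_mkcond /=.
  apply: ler_sum => e' _; rewrite !inE.
  have bi := mf_ge0 H g1.
  by case: (e' \in A i); rewrite ?andbT ?andbF //=; case: ifP.
- rewrite sum_infl; apply: le_trans (mf_mom H e).
  rewrite (eq_bigr (fun j : I * E => b j.1 * (#|A j.1| - 2)%:R)); last first.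
    by move=> j /cB[_ ->].
  rewrite (pairS (fun i => b i * (#|A i| - 2)%:R)); apply: ler_sum => i eA.
  rewrite mulrCA -natrM subn1; case: (leqP #|A i| 1%N) => h.
    by move: h; case: #|A i| => [|[]]//= _; rewrite ?mul0n.
  rewrite ler_wpM2l ?(mf_ge0 H)// ler_nat leq_mul2l leq_subr orbT//.
- move=> z z01; have := mf_V' H e z01.
  rewrite (eq_bigr (fun j : I * E => b j.1 * z ^+ (#|A j.1| - 2))); last first.
    by move=> j /cB[_ ->].
  rewrite (pairS (fun i => b i * z ^+ (#|A i| - 2))).
  by under eq_bigr do rewrite -mulrA mulrCA.
Qed.

Lemma dT_q e y : q ham e y = sig (dT e y).
Proof. by rewrite /q D_ham. Qed.

(** Mixed second derivatives commute. The increments at [e] of all the [dT e'] can thus be summed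
    with the bound known for the single polynomial [dT e]. *)
Lemma infl_dT_sym e e' :
  infl (fun i => e \in A i) b (fun i => A i :\ e)%SET e' =
  infl (fun i => e' \in A i) b (fun i => A i :\ e')%SET e.
Proof.
rewrite !infl_dT eq_sym; case: ifP => // _.
by apply: eq_bigl => i; rewrite andbC.
Qed.

Lemma q_ham_incr e : incr (q ham e).
Proof.
move=> e' y; rewrite /D !dT_q subr_ge0 sig_homo// -subr_ge0.
exact: poly_incr (nice_dT e) e' y.
Qed.

End system.

(** * Concentration under independent edges, and iteration of the comparison *)

Section concentration.
Context {R : realType} {E J : finType}.
Notation conf := {ffun E -> bool}.
Variables (P : pred J) (c : J -> R) (B : J -> {set E}) (K n : R) (G : R -> R).
Hypothesis Hn : nice P c B K n G.
Hypotheses (n0 : 0 < n) (K1 : 1 <= K).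
Notation g := (poly P c B).

Lemma bmean_conc (s a eta : R) y : `|s| = 1 -> 0 <= a <= 1 -> 0 < eta <= 1 ->
  bmean a (enum E) (fun y => (s * G a + K / n + eta < s * g y)%R%:R) y <=
    expR (- (eta ^+ 2 * n / (8 * K ^+ 2))).
Proof.
move=> s1 a01 /andP[e0 e1].
have K0 : 0 < K by exact: lt_le_trans ltr01 K1.
(* This minimizes - th eta + 2 th^2 K^2 / n. As eta <= 1 <= K, it also keeps the increments th *
   [infl] below the 1/2 required by [bmean_expR]. *)
pose th := eta * n / (4 * K ^+ 2); pose m := s * G a + K / n + eta.
have thE : th = eta * n / (4 * K ^+ 2) by [].
have mE : m = s * G a + K / n + eta by [].
have th0 : 0 < th by rewrite divr_gt0 ?mulr_gt0// exprn_gt0.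
rewrite -mE; clearbody th m.
pose f (y : conf) := th * (s * g y - m).
have Df e z : `|D e f z| <= th * infl P c B e.
  have -> : D e f z = th * s * D e g z by rewrite /D /f; ring.
  rewrite !normrM s1 mulr1 gtr0_norm// ler_wpM2l ?(ltW th0)//.
  exact: D_poly_norm Hn _ _.
have L1 e : th * infl P c B e <= 2^-1.
  apply: (@le_trans _ _ (th * (K / n))).
    by rewrite ler_wpM2l ?(ltW th0)//; exact: nice_infl Hn e.
  have -> : th * (K / n) = eta / (4 * K) by rewrite thE; field; rewrite !gt_eqF.
  by rewrite ler_pdivrMr ?mulr_gt0//; have := K1; lra.
apply: (@le_trans _ _ (bmean a (enum E) (fun y => expR (f y)) y)).
  apply: bmean_le => // z; case: ltP => /= h; last exact: expR_ge0.
  by rewrite -[leLHS]expR0 ler_expR /f mulr_ge0 ?(ltW th0)// subr_ge0 ltW.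
apply: le_trans (bmean_expR _ a01 L1 Df y) _; rewrite ler_expR.
have -> : bmean a (enum E) f y = th * (s * bmean a (enum E) g y - m).
  rewrite (_ : f = fun y => th * s * g y + (- (th * m))); last first.
    by apply/funext => z; rewrite /f; ring.
  by rewrite bmean_affine; ring.
have hG : s * bmean a (enum E) g y <= s * G a + K / n.
  rewrite -lerBlDl -mulrBr bmean_poly (le_trans (ler_norm _))// normrM s1 mul1r.
  exact: nice_mf Hn _ a01.
have hS : \sum_(e <- enum E) (th * infl P c B e) ^+ 2 <= th ^+ 2 * (K ^+ 2 / n).
  rewrite big_enum /= (eq_bigr (fun e => th ^+ 2 * infl P c B e ^+ 2)).
    rewrite -mulr_sumr ler_wpM2l ?sqr_ge0//; exact: sum_infl_sqr Hn.
  by move=> e _; rewrite exprMn.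
apply: (@le_trans _ _ (th * - eta + 2 * (th ^+ 2 * (K ^+ 2 / n)))).
  apply: lerD; last by rewrite ler_pM2l.
  by rewrite ler_wpM2l ?(ltW th0)// mE; lra.
rewrite le_eqVlt; apply/orP; left; apply/eqP; rewrite thE; field; rewrite !gt_eqF//.

Qed.

End concentration.

Section iteration.
Context {R : realType} {E I : finType}.
Notation conf := {ffun E -> bool}.
Variables (b : I -> R) (A : I -> {set E}) (K n : R) (V V' : R -> R).
Hypothesis H : mean_field b A K n V V'.
Hypotheses (n0 : 0 < n) (K1 : 1 <= K) (E0 : (0 < #|E|)%N).
Variable eta : R.
Hypothesis eta01 : 0 < eta <= 1.
Notation T := (ham b A).
Notation N := (#|E|%:R : R).
Let tau := expR (- (eta ^+ 2 * n / (8 * K ^+ 2))).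

(* Successive upper and lower bounds on the conditional edge probabilities,
   started from the trivial bounds 1 and 0. *)
Fixpoint up_seq k : R := if k is k'.+1 then sig (V (up_seq k') + (K / n + eta)) else 1.
Fixpoint down_seq k : R := if k is k'.+1 then sig (V (down_seq k') - (K / n + eta)) else 0.

Lemma up_seq01 k : 0 <= up_seq k <= 1.
Proof. by case: k => [|k] /=; rewrite ?lexx ?ler01 ?sig_ge0 ?sig_le1. Qed.

Lemma down_seq01 k : 0 <= down_seq k <= 1.
Proof. by case: k => [|k] /=; rewrite ?lexx ?ler01 ?sig_ge0 ?sig_le1. Qed.

Let tau0 : 0 <= tau. Proof. exact: expR_ge0. Qed.
Let N1 : 1 <= N. Proof. by rewrite ler1n. Qed.

Let pw0 k : 0 <= (2 * N) ^+ k * tau.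
Proof. by rewrite mulr_ge0// exprn_ge0// mulr_ge0// ler0n. Qed.

(** A round adds up, over the N edges, a failure probability consisting of [tau] and the previous
    error; this is the origin of the factor 2 N per round. *)
Let err_step k : N * (tau + (2 * N) ^+ k * tau) <= (2 * N) ^+ k.+1 * tau.
Proof.
have : 1 <= (2 * N) ^+ k by rewrite exprn_ege1//; have := N1; lra.
rewrite exprS => h; have h2 := mulr_ge0 (ltW (lt_le_trans ltr01 N1)) tau0.
by have := ler_wpM2l h2 h; lra.
Qed.

Lemma incr_ind_gt (f : conf -> R) (t : R) : incr f -> incr (fun y => (t < f y)%R%:R : R).
Proof.
move=> If e y; have := If e y; rewrite /D !subr_ge0 => h.
by rewrite ler_nat; case: ltP => //= h1; rewrite (lt_le_trans h1 h).
Qed.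

Lemma incr_ind_ge (f : conf -> R) (t : R) : incr f -> incr (fun y => (t <= f y)%R%:R : R).
Proof.
move=> If e y; have := If e y; rewrite /D !subr_ge0 => h.
by rewrite ler_nat; case: leP => //= h1; rewrite (le_trans h1 h).
Qed.

Let bool01 (t : bool) : (0 <= (t%:R : R)) && (t%:R <= (1 : R)).
Proof. by case: t; rewrite ?lexx ?ler01. Qed.

(** The exceptional events of [dom_up] say that [dT b A e] exceeds V(a) + K / n + eta, with a the
    previous density. They are increasing, so the induction hypothesis applies to their indicators,
    and under independent edges of density a they have probability at most [tau]. Initially there is
    no exception, as no q_e exceeds 1. *)
Lemma iter_dom_up k f (M : R) : incr f -> (forall y, 0 <= f y <= 1) ->
  (forall y, bmean (up_seq k) (enum E) f y <= M) -> mean T f <= M + (2 * N) ^+ k * tau.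
Proof.
elim: k f M => [|k IH] f M If f01 hM;
  (apply: le_trans (dom_up T (enum E) (up_seq01 _) If f01) _; apply: lerD;
    [exact: mean_le|]).
  rewrite big1; first exact: pw0.
  move=> e _ /=; rewrite -[RHS](mean_cst T); apply: eq_mean => y.
  by rewrite ltNge q_le1.
apply: le_trans (err_step k); rewrite -sum_cst big_enum /=.
apply: ler_sum => e _; under eq_mean do rewrite dT_q sig_mono addrA.
apply: IH => //; first exact: incr_ind_gt (poly_incr (nice_dT H e)).
move=> y; have := @bmean_conc _ _ _ _ _ _ _ _ _ (nice_dT H e) n0 K1 1 _ _ y
  (normr1 _) (up_seq01 k) eta01.
apply: le_trans; apply: bmean_le; first exact: up_seq01.
by move=> z; rewrite !mul1r.
Qed.

Lemma iter_dom_down k f (M : R) : incr f -> (forall y, 0 <= f y <= 1) ->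
  (forall y, M <= bmean (down_seq k) (enum E) f y) -> M <= mean T f + (2 * N) ^+ k * tau.
Proof.
elim: k f M => [|k IH] f M If f01 hM;
  (apply: le_trans (_ : mean T (bmean (down_seq _) (enum E) f) <= _);
    [exact: mean_ge hM|];
   apply: le_trans (dom_down T (enum E) (down_seq01 _) If f01) _; apply: lerD => //).
  rewrite big1; first exact: pw0.
  move=> e _ /=; rewrite -[RHS](mean_cst T); apply: eq_mean => y.
  by rewrite ltNge q_ge0.
apply: le_trans (err_step k); rewrite -sum_cst big_enum /=.
apply: ler_sum => e _; under eq_mean do rewrite dT_q sig_mono opprD addrA.
set t := V _ - _ - _.
(* The exceptional event is now decreasing, and the induction hypothesis is applied to its
   complement. *)
have cplE y : (dT b A e y < t)%R%:R = -1 * (t <= dT b A e y)%R%:R + 1 :> R.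
  by case: ltP => _ /=; ring.
have -> : mean T (fun y => (dT b A e y < t)%R%:R) =
    1 - mean T (fun y => (t <= dT b A e y)%R%:R).
  rewrite -[X in X - _](mean_cst T) -meanB; apply: eq_mean => y.
  by rewrite cplE; ring.
suff : 1 - tau <= mean T (fun y => (t <= dT b A e y)%R%:R) + (2 * N) ^+ k * tau.
  by lra.
apply: IH => //; first exact: incr_ind_ge (poly_incr (nice_dT H e)).
move=> y; have := @bmean_conc _ _ _ _ _ _ _ _ _ (nice_dT H e) n0 K1 (-1) _ _ y
  (normrN1 _) (down_seq01 k) eta01.
set G1 := bmean _ _ _ y => h; set G2 := bmean _ _ _ y.
suff -> : G2 = 1 - G1 by rewrite lerD2l lerN2.
rewrite /G2 (_ : (fun y => (t <= dT b A e y)%R%:R) =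
  (fun z => -1 * (-1 * V (down_seq k) + K / n + eta < -1 * dT b A e z)%R%:R + 1)).
  by rewrite bmean_affine -/G1; ring.
apply/funext => z; rewrite -[LHS]subr0 -[LHS]opprK.
have -> : (-1 * V (down_seq k) + K / n + eta < -1 * dT b A e z) = (dT b A e z < t).
  by rewrite /t; apply/idP/idP; lra.
by rewrite cplE; ring.
Qed.

Section limit.
Variables (p la : R).
Hypotheses (p01 : 0 <= p <= 1) (Vp : sig (V p) = p).
Hypothesis Vmono : forall x y : R, 0 <= x -> x <= y -> y <= 1 -> V x <= V y.
Hypothesis la01 : 0 <= la < 1.
Hypothesis contr_up : forall x : R, p <= x -> x <= 1 -> sig (V x) - p <= la * (x - p).
Hypothesis contr_down : forall x : R, 0 <= x -> x <= p -> p - sig (V x) <= la * (p - x).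
Notation s := (K / n + eta).
Let s0 : 0 <= s.
Proof.
have := divr_ge0 (le_trans ler01 K1) (ltW n0); case/andP: eta01; lra.
Qed.

Lemma sigD_le x : sig (x + s) <= sig x + s.
Proof.
have := sig_lip (x + s) x; rewrite (_ : x + s - x = s); last by ring.
by move=> /(le_trans (ler_norm _)); rewrite ger0_norm ?s0//; lra.
Qed.

Lemma sigB_ge x : sig x - s <= sig (x - s).
Proof.
have := sig_lip x (x - s); rewrite (_ : x - (x - s) = s); last by ring.
by move=> /(le_trans (ler_norm _)); rewrite ger0_norm ?s0//; lra.
Qed.

Let geom k : la * (la ^+ k + s / (1 - la)) + s = la ^+ k.+1 + s / (1 - la).
Proof. rewrite exprS; case/andP: la01 => _ h; field; rewrite subr_eq0 !gt_eqF//. Qed.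

(** The distance to p obeys x -> la x + s, with fixed point s / (1 - la). The lower bound keeps the
    iterates on the side where [contr_up] applies. *)
Lemma up_seq_lim k : p <= up_seq k <= p + (la ^+ k + s / (1 - la)).
Proof.
case/andP: p01 => p0 p1; have [l0 l1] := andP la01.
have h : 0 <= s / (1 - la) by rewrite divr_ge0// subr_ge0 ltW.
elim: k => [|k /andP[IH1 IH2]] /=; first by rewrite p1 expr0; lra.
have /andP[a0 a1] := up_seq01 k.
apply/andP; split.
  rewrite -{1}Vp sig_homo// (le_trans (Vmono p0 IH1 a1))// lerDl s0//.
rewrite -geom; have := sigD_le (V (up_seq k)); have := contr_up IH1 a1.
have := ler_wpM2l l0 (_ : up_seq k - p <= la ^+ k + s / (1 - la)).
by rewrite lerBlDl => /(_ IH2); lra.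
Qed.

Lemma down_seq_lim k : p - (la ^+ k + s / (1 - la)) <= down_seq k <= p.
Proof.
case/andP: p01 => p0 p1; have [l0 l1] := andP la01.
have h : 0 <= s / (1 - la) by rewrite divr_ge0// subr_ge0 ltW.
elim: k => [|k /andP[IH1 IH2]] /=; first by rewrite p0 expr0; lra.
have /andP[a0 a1] := down_seq01 k.
apply/andP; split; last first.
  rewrite -[X in _ <= X]Vp sig_homo// (le_trans _ (Vmono a0 IH2 p1))// lerBlDr lerDl s0//.
rewrite -geom; have := sigB_ge (V (down_seq k)); have := contr_down a0 IH2.
have := ler_wpM2l l0 (_ : p - down_seq k <= la ^+ k + s / (1 - la)).
by rewrite lerBlDr -lerBlDl => /(_ IH1); lra.
Qed.

Section nice_whp.
Context {J : finType}.
Variables (P : pred J) (c : J -> R) (B : J -> {set E}) (G : R -> R).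
Hypothesis Hn : nice P c B K n G.
Hypothesis Glip : forall x y : R, 0 <= x <= 1 -> 0 <= y <= 1 -> `|G x - G y| <= K * `|x - y|.
Variable k : nat.
(** The distance of the k-th density to p, carried through the K-Lipschitz function [G], plus the
    fluctuation s under independent edges. *)
Let eps := K * (la ^+ k + s / (1 - la)) + s.

Lemma nice_whp_up :
  mean T (fun y => (G p + eps < poly P c B y)%R%:R) <= tau + (2 * N) ^+ k * tau.
Proof.
apply: iter_dom_up => //; first exact: incr_ind_gt (poly_incr Hn).
move=> y; have := @bmean_conc _ _ _ _ _ _ _ _ _ Hn n0 K1 1 _ _ y
  (normr1 _) (up_seq01 k) eta01.
apply: le_trans; apply: bmean_le; first exact: up_seq01.
move=> z; rewrite !mul1r ler_nat -addrA.
case: ltP => //= h1; case: ltP => //= h2; exfalso.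
have /andP[l1 l2] := up_seq_lim k.
have := Glip (up_seq01 k) p01; rewrite [`|_ - p|]ger0_norm ?subr_ge0//.
move=> /(le_trans (ler_norm _)).
have := ler_wpM2l (le_trans ler01 K1) (_ : up_seq k - p <= la ^+ k + s / (1 - la)).
by rewrite lerBlDl => /(_ l2); move: h1 h2; rewrite /eps; lra.
Qed.

Lemma nice_whp_down :
  mean T (fun y => (poly P c B y < G p - eps)%R%:R) <= tau + (2 * N) ^+ k * tau.
Proof.
set t := G p - eps.
have cplE y : (poly P c B y < t)%R%:R = -1 * (t <= poly P c B y)%R%:R + 1 :> R.
  by case: ltP => _ /=; ring.
have -> : mean T (fun y => (poly P c B y < t)%R%:R) =
    1 - mean T (fun y => (t <= poly P c B y)%R%:R).
  rewrite -[X in X - _](mean_cst T) -meanB; apply: eq_mean => y.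
  by rewrite cplE; ring.
suff : 1 - tau <= mean T (fun y => (t <= poly P c B y)%R%:R) + (2 * N) ^+ k * tau.
  by lra.
apply: iter_dom_down => //; first exact: incr_ind_ge (poly_incr Hn).
move=> y; have := @bmean_conc _ _ _ _ _ _ _ _ _ Hn n0 K1 (-1) _ _ y
  (normrN1 _) (down_seq01 k) eta01.
set G1 := bmean _ _ _ y => h.
have : bmean (down_seq k) (enum E) (fun y => -1 *
    (-1 * G (down_seq k) + K / n + eta < -1 * poly P c B y)%R%:R + 1) y = 1 - G1.
  by rewrite bmean_affine -/G1; ring.
move=> e1; apply: (@le_trans _ _ (1 - G1)); first by rewrite lerD2l lerN2.
rewrite -e1; apply: bmean_le; first exact: down_seq01.
move=> z; case: ltP => /= h1; first by rewrite mulr1 addNr ler0n.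
rewrite mulr0 add0r ler1n lt0b; rewrite /t.
have /andP[l1 l2] := down_seq_lim k.
have := Glip p01 (down_seq01 k); rewrite [`|p - _|]ger0_norm ?subr_ge0//.
move=> /(le_trans (ler_norm _)).
have := ler_wpM2l (le_trans ler01 K1) (_ : p - down_seq k <= la ^+ k + s / (1 - la)).
by rewrite lerBlDr -lerBlDl => /(_ l1); move: h1; rewrite /eps; lra.
Qed.

End nice_whp.
End limit.
End iteration.

(** * The FKG inequality for functions increasing between typical configurations *)

Section patch.
Context {R : realType} {E : finType}.
Notation conf := {ffun E -> bool}.
Variable T : conf -> R.
Hypothesis supT : forall x y, T x + T y <= T (conf_or x y) + T (conf_and x y).
Variables U L : pred conf.
Hypothesis U_up : forall e y, U (upd e false y) -> U (upd e true y).
Hypothesis L_down : forall e y, L (upd e true y) -> L (upd e false y).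

Definition typical y := ~~ U y && ~~ L y.
Definition bad_prob := mean T (fun y => (~~ typical y)%:R).

(* Overwriting [u] by [M] on the increasing event [U] and by [-M] on the
   decreasing event [L] turns monotonicity between typical configurations into
   monotonicity everywhere, so that the FKG inequality applies. *)
Definition patch (u : conf -> R) (M : R) y : R :=
  if typical y then u y else M * ((U y)%:R - (L y)%:R).

Lemma patch_incr u M : (forall y, `|u y| <= M) ->
  (forall e y, typical (upd e false y) -> typical (upd e true y) -> 0 <= D e u y) ->
  incr (patch u M).
Proof.
move=> uM Iu e y; have := Iu e y; rewrite /D /patch /typical.
have := @U_up e y; have := @L_down e y.
have := uM (upd e true y); have := uM (upd e false y).
rewrite !ler_norml => /andP[h1 h2] /andP[h3 h4].
case: (U (upd e false y)); case: (U (upd e true y));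
case: (L (upd e false y)); case: (L (upd e true y)) => //= l1 l2 l3;
  by [move: (l1 isT) | move: (l2 isT) | move: (l3 isT isT) | lra].
Qed.

Lemma patch_bound u M y : (forall y, `|u y| <= M) -> `|patch u M y| <= M.
Proof.
move=> uM; have M0 := le_trans (normr_ge0 _) (uM y).
rewrite /patch; case: ifP => // _; rewrite normrM (ger0_norm M0) ler_piMr//.
by case: (U y); case: (L y); rewrite /= ?subrr ?subr0 ?sub0r ?normrN ?normr1 ?normr0.
Qed.

Lemma bad_prob_ge0 : 0 <= bad_prob.
Proof. by apply: mean_ge0 => y; rewrite ler0n. Qed.

Lemma mean_close (f g : conf -> R) (M : R) : 0 <= M ->
  (forall y, typical y -> f y = g y) -> (forall y, `|f y| <= M) ->
  (forall y, `|g y| <= M) -> `|mean T f - mean T g| <= 2 * M * bad_prob.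
Proof.
move=> M0 fg fM gM; rewrite -meanB (le_trans (norm_mean _ _))//.
rewrite /bad_prob -meanZ; apply: ler_mean => y.
case: (boolP (typical y)) => [/fg ->|_] /=.
  by rewrite subrr normr0 mulr0.
rewrite mulr1 (le_trans (ler_normB _ _))//.
by have := fM y; have := gM y; lra.
Qed.

(** FKG holds for the patched functions. Undoing the patches costs 2 M M' [bad_prob] in the mean of
    the product and 4 M M' [bad_prob] in the product of the means, whence the 6. *)
Lemma cov_good_ge u v (M M' : R) : (forall y, `|u y| <= M) -> (forall y, `|v y| <= M') ->
  (forall e y, typical (upd e false y) -> typical (upd e true y) -> 0 <= D e u y) ->
  (forall e y, typical (upd e false y) -> typical (upd e true y) -> 0 <= D e v y) ->
  - (6 * M * M' * bad_prob) <= cov T u v.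
Proof.
move=> uM vM Iu Iv.
pose z : conf := [ffun=> false].
have M0 := le_trans (normr_ge0 _) (uM z); have M'0 := le_trans (normr_ge0 _) (vM z).
have := fkg supT (patch_incr uM Iu) (patch_incr vM Iv); rewrite /cov.
set u' := patch u M; set v' := patch v M'.
have u'M y : `|u' y| <= M by exact: patch_bound.
have v'M y : `|v' y| <= M' by exact: patch_bound.
have guu y : typical y -> u' y = u y by rewrite /u' /patch => ->.
have gvv y : typical y -> v' y = v y by rewrite /v' /patch => ->.
have MM0 := mulr_ge0 M0 M'0.
have h1 : `|mean T (fun y => u' y * v' y) - mean T (fun y => u y * v y)| <=
    2 * (M * M') * bad_prob.
  apply: mean_close => // y; first by move=> gy; rewrite guu// gvv.
    by rewrite normrM ler_pM.
  by rewrite normrM ler_pM.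
have h2 := mean_close M0 guu u'M uM; have h3 := mean_close M'0 gvv v'M vM.
have m1 : `|mean T u| <= M.
  by apply: le_trans (norm_mean _ _) _; exact: mean_le.
have m2 : `|mean T v'| <= M'.
  by apply: le_trans (norm_mean _ _) _; exact: mean_le.
have h4 : `|mean T u' * mean T v' - mean T u * mean T v| <= 4 * (M * M') * bad_prob.
  have -> : mean T u' * mean T v' - mean T u * mean T v =
    (mean T u' - mean T u) * mean T v' + mean T u * (mean T v' - mean T v) by ring.
  apply: le_trans (ler_normD _ _) _; rewrite !normrM.
  have k1 := ler_pM (normr_ge0 _) (normr_ge0 _) h2 m2.
  have k2 := ler_pM (normr_ge0 _) (normr_ge0 _) m1 h3.
  by lra.
move: h1 h4; rewrite !ler_norml => /andP[a1 a2] /andP[a3 a4].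
by clear -a1 a2 a3 a4; lra.
Qed.

End patch.

(* The rate [rho] is n^(-1/4) in the subcritical region and n^(-1/2) in
   Dobrushin's uniqueness region. *)
Record moment_bounds (R : realType) (E I : finType) (b : I -> R) (A : I -> {set E})
    (p lam C rho : R) : Prop := MomentBounds {
  mb_var : var (ham b A) edges <= C * #|E|%:R;
  mb_res : var (ham b A) (fun y => Qsum (ham b A) y - lam * edges y) <=
    C * rho ^+ 2 * #|E|%:R;
  mb_q : forall e, mean (ham b A) (fun y => (q (ham b A) e y - p) ^+ 2) <= C * rho ^+ 2 }.

(** The rate [la] concerns distances to [p] only, on all of [0, 1]; this is weaker than a
    contraction between arbitrary points, and is all that the uniqueness of the fixed point
    provides. *)
Record fixpoint_data (R : realType) (K p la : R) (V V' : R -> R) : Prop := FixpointData {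
  fd_p : 0 < p < 1;
  fd_Vp : sig (V p) = p;
  fd_mono : forall x y : R, 0 <= x -> x <= y -> y <= 1 -> V x <= V y;
  fd_la : 0 <= la < 1;
  fd_up : forall x : R, p <= x -> x <= 1 -> sig (V x) - p <= la * (x - p);
  fd_down : forall x : R, 0 <= x -> x <= p -> p - sig (V x) <= la * (p - x);
  fd_lip : forall x y : R, 0 <= x <= 1 -> 0 <= y <= 1 -> `|V x - V y| <= K * `|x - y|;
  fd_lip' : forall x y : R, 0 <= x <= 1 -> 0 <= y <= 1 -> `|V' x - V' y| <= K * `|x - y|;
  fd_V' : 0 <= V' p;
  fd_lam : V' p * (p * (1 - p)) < 1 }.

(** * Variance bounds in the subcritical region *)

Section edges_facts.
Context {R : realType} {E : finType}.
Notation conf := {ffun E -> bool}.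
Variable T : conf -> R.

Lemma edges_true e (y : conf) :
  edges (upd e true y) = 1 + edges (upd e false y) :> R.
Proof. by have := D_edges (R := R) e y; rewrite /D; lra. Qed.

Lemma edges_ge0 (y : conf) : 0 <= edges y :> R.
Proof. by apply: sumr_ge0 => e _; rewrite ler0n. Qed.

Lemma edges_le (y : conf) : edges y <= #|E|%:R :> R.
Proof.
rewrite -[leRHS]mulr1 -sum_cst; apply: ler_sum => e _.
by rewrite lern1 leq_b1.
Qed.

Lemma Qsum_ge0 y : 0 <= Qsum T y.
Proof. by apply: sumr_ge0 => e _; exact: q_ge0. Qed.

Lemma Qsum_le y : Qsum T y <= #|E|%:R.
Proof.
rewrite -[leRHS]mulr1 -sum_cst; apply: ler_sum => e _; exact: q_le1.
Qed.

Lemma edges_subQ y : edges y - Qsum T y = \sum_e ((y e)%:R - q T e y).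
Proof. by rewrite sumrB. Qed.

Lemma mean_stein_sum f : mean T (fun y => (edges y - Qsum T y) * f y) =
  \sum_e mean T (fun y => q T e y * (1 - q T e y) * D e f y).
Proof.
under eq_mean do rewrite edges_subQ mulr_suml.
by rewrite mean_sum; apply: eq_bigr => e _; exact: mean_Yq_stein.
Qed.

Lemma mean_edges_Q : mean T edges = mean T (Qsum T).
Proof.
apply/eqP; rewrite -subr_eq0 -meanB; apply/eqP.
have := mean_stein_sum (fun=> 1).
under eq_mean do rewrite mulr1; move=> ->.
rewrite big1// => e _; rewrite -[RHS](mean_cst T); apply: eq_mean => y.
by rewrite /D subrr mulr0.
Qed.

(** Integration by parts with f = X, whose increments are 1, gives Var X - Cov(X, Q) as the sum of E
    q_e (1 - q_e). *)
Lemma var_edges_cov : var T edges <= cov T edges (Qsum T) + 4^-1 * #|E|%:R.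
Proof.
rewrite -lerBlDl.
have -> : var T edges - cov T edges (Qsum T) =
    mean T (fun y => (edges y - Qsum T y) * edges y).
  rewrite /var /cov mean_edges_Q.
  rewrite (_ : (fun y => (edges y - Qsum T y) * edges y) =
    (fun y => edges y * edges y - edges y * Qsum T y)); last first.
    by apply/funext => y; ring.
  by rewrite meanB; ring.
rewrite mean_stein_sum mulrC -sum_cst; apply: ler_sum => e _.
by apply: mean_le => y; rewrite D_edges mulr1; exact: sig_deriv_le.
Qed.

Lemma covBr f g h : cov T f (fun y => g y - h y) = cov T f g - cov T f h.
Proof.
rewrite /cov meanB; under eq_mean do rewrite mulrBr.
by rewrite meanB; ring.
Qed.

Lemma covZr (c : R) f g : cov T f (fun y => c * g y) = c * cov T f g.
Proof.
rewrite /cov meanZ; under eq_mean do rewrite mulrCA.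
by rewrite meanZ; ring.
Qed.

Lemma cov_sqr_diff (c : R) f g :
  cov T (fun y => c * f y - g y) (fun y => c * f y + g y) = c ^+ 2 * var T f - var T g.
Proof.
rewrite /var /cov.
rewrite (_ : (fun y => (c * f y - g y) * (c * f y + g y)) =
  (fun y => c ^+ 2 * (f y * f y) - g y * g y)); last by apply/funext => y; ring.
by rewrite !meanB meanD !meanZ; ring.
Qed.

End edges_facts.

Section good_set.
Context {R : realType} {E I : finType}.
Notation conf := {ffun E -> bool}.
Variables (b : I -> R) (A : I -> {set E}) (K n : R) (V V' : R -> R) (p la eta : R).
Hypothesis H : mean_field b A K n V V'.
Hypotheses (n0 : 0 < n) (K1 : 1 <= K) (E0 : (0 < #|E|)%N).
Hypothesis F : fixpoint_data K p la V V'.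
Hypothesis eta01 : 0 < eta <= 1.
Variable k : nat.
Notation T := (ham b A).
Notation N := (#|E|%:R : R).
Let tau := expR (- (eta ^+ 2 * n / (8 * K ^+ 2))).
Let del := tau + (2 * N) ^+ k * tau.
Let eps := K * (la ^+ k + (K / n + eta) / (1 - la)) + (K / n + eta).
Let lam := V' p * (p * (1 - p)).
Let kap := eps * (V' p + eps + 1).

Let p01 : 0 <= p <= 1. Proof. by case/andP: (fd_p F) => h1 h2; rewrite !ltW. Qed.

Let eps0 : 0 <= eps.
Proof.
have s0 : 0 <= K / n + eta.
  by rewrite addr_ge0 ?divr_ge0 ?(le_trans ler01 K1) ?(ltW n0)//; case/andP: eta01 => /ltW.
have [l0 l1] := andP (fd_la F).
by rewrite addr_ge0// mulr_ge0 ?(le_trans ler01 K1)// addr_ge0 ?exprn_ge0// divr_ge0// subr_ge0 ltW.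
Qed.

Let Uset : pred conf := fun y =>
  [exists e, (V p + eps < dT b A e y) || (V' p + eps < dS b A e y)].
Let Lset : pred conf := fun y =>
  [exists e, (dT b A e y < V p - eps) || (dS b A e y < V' p - eps)].

Let dT_le e e' y : dT b A e (upd e' false y) <= dT b A e (upd e' true y).
Proof. by rewrite -subr_ge0; exact: poly_incr (nice_dT H e) e' y. Qed.

Let dS_le e e' y : dS b A e (upd e' false y) <= dS b A e (upd e' true y).
Proof. by rewrite -subr_ge0; exact: poly_incr (nice_dS H e) e' y. Qed.

Let Uup e y : Uset (upd e false y) -> Uset (upd e true y).
Proof.
move=> /existsP[e' /orP[h|h]]; apply/existsP; exists e'.
  by rewrite (lt_le_trans h).
by rewrite (lt_le_trans h) ?orbT.
Qed.

Let Ldown e y : Lset (upd e true y) -> Lset (upd e false y).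
Proof.
move=> /existsP[e' /orP[h|h]]; apply/existsP; exists e'.
  by rewrite (le_lt_trans _ h).
by rewrite (le_lt_trans _ h) ?orbT.
Qed.

Notation good := (typical Uset Lset).

Let goodP y : good y -> forall e,
  [/\ V p - eps <= dT b A e y, dT b A e y <= V p + eps,
      V' p - eps <= dS b A e y & dS b A e y <= V' p + eps].
Proof.
move=> /andP[/existsPn u /existsPn l] e; have := u e; have := l e.
by rewrite !negb_or -!leNgt => /andP[? ?] /andP[? ?].
Qed.

Let whp_up (J : finType) (P : pred J) c B G (Hn : @nice R E J P c B K n G) :=
  nice_whp_up H n0 K1 E0 eta01 p01 (fd_Vp F) (fd_mono F) (fd_la F) (fd_up F) Hn.
Let whp_down (J : finType) (P : pred J) c B G (Hn : @nice R E J P c B K n G) :=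
  nice_whp_down H n0 K1 E0 eta01 p01 (fd_Vp F) (fd_mono F) (fd_la F) (fd_down F) Hn.

Let bad_le : bad_prob T Uset Lset <= 4 * N * del.
Proof.
rewrite /bad_prob.
apply: (@le_trans _ _ (mean T (fun y => \sum_e
  ((V p + eps < dT b A e y)%R%:R + (V' p + eps < dS b A e y)%R%:R +
   ((dT b A e y < V p - eps)%R%:R + (dS b A e y < V' p - eps)%R%:R))))).
  apply: ler_mean => y; case: (boolP (good y)) => /= gy.
    by apply: sumr_ge0 => e _; rewrite !addr_ge0 ?ler0n.
  rewrite /typical in gy.
  move: gy; rewrite negb_and !negbK => /orP[]/existsP[e h]; rewrite (bigD1 e)//= ler_wpDr//.
  - by apply: sumr_ge0 => e' _; rewrite !addr_ge0 ?ler0n.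
  - by rewrite -!natrD ler1n; case/orP: h => ->; rewrite ?addn1 ?add1n ?addnS ?addSn.
  - by apply: sumr_ge0 => e' _; rewrite !addr_ge0 ?ler0n.
  - by rewrite -!natrD ler1n; case/orP: h => ->; rewrite ?addn1 ?add1n ?addnS ?addSn.
rewrite mean_sum -mulrA mulrCA -sum_cst; apply: ler_sum => e _; rewrite !meanD.
have h1 := whp_up (nice_dT H e) (fd_lip F) k.
have h2 := whp_up (nice_dS H e) (fd_lip' F) k.
have h3 := whp_down (nice_dT H e) (fd_lip F) k.
have h4 := whp_down (nice_dS H e) (fd_lip' F) k.
rewrite -/tau -/del in h1 h2 h3 h4.
by move: h1 h2 h3 h4; rewrite -/eps; rewrite /dT /dS; lra.
Qed.

(** Each q_e' moves by the increment of [dT e'] times sig' at an intermediate point. Between typical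
    configurations sig' is within eps of p (1 - p), and the increments sum to [dS e], itself within
    eps of V'(p). *)
Let DQ_good e y : good (upd e false y) -> good (upd e true y) ->
  `|D e (Qsum T) y - lam| <= kap.
Proof.
move=> g0 g1; have G0 := goodP g0; have G1 := goodP g1.
have V0 := fd_V' F; have /andP[p0 p1] := p01.
have dSb : V' p - eps <= dS b A e y <= V' p + eps.
  have := G0 e; rewrite (_ : dS b A e (upd e false y) = dS b A e y); last first.
    by rewrite -!sum_D_dT; apply: eq_bigr => e' _; rewrite D_upd.
  by case=> _ _ -> ->.
have key : `|D e (Qsum T) y - p * (1 - p) * dS b A e y| <= eps * dS b A e y.
  rewrite -sum_D_dT !mulr_sumr /D /Qsum -sumrB -sumrB.
  apply: le_trans (ler_norm_sum _ _ _) _; apply: ler_sum => e' _.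
  rewrite !dT_q; have hle := dT_le e' e y.
  have [z /andP[z0 z1] ->] := sig_mvt hle.
  rewrite -mulrBl normrM [`|_ - dT _ _ _ _|]ger0_norm ?subr_ge0//.
  rewrite ler_wpM2r ?subr_ge0// -{1 2}(fd_Vp F).
  apply: le_trans (sig_deriv_lip _ _) _; apply: le_trans (sig_lip _ _) _.
  have [a1 a2 _ _] := G0 e'; have [a3 a4 _ _] := G1 e'.
  by rewrite ler_norml; apply/andP; split; lra.
have /andP[s1 s2] := dSb; have /andP[e0' e1'] := eta01; have e0 := eps0.
have pp : 0 <= p * (1 - p) <= 1.
  by apply/andP; split; [rewrite mulr_ge0// subr_ge0|nra].
case/andP: pp => pp0 pp1.
have k1 := ler_wpM2l e0 s2.
have k2 : `|p * (1 - p) * dS b A e y - lam| <= eps.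
  have -> : p * (1 - p) * dS b A e y - lam = p * (1 - p) * (dS b A e y - V' p).
    by rewrite /lam; ring.
  rewrite normrM (ger0_norm pp0) (le_trans (ler_piMl _ pp1))// ler_norml.
  by apply/andP; split; lra.
have -> : D e (Qsum T) y - lam = (D e (Qsum T) y - p * (1 - p) * dS b A e y) +
  (p * (1 - p) * dS b A e y - lam) by ring.
by rewrite (le_trans (ler_normD _ _))// /kap; lra.
Qed.

Let lam0 : 0 <= lam.
Proof.
have /andP[p0 p1] := p01.
by rewrite mulr_ge0 ?(fd_V' F)// mulr_ge0// subr_ge0.
Qed.

Let kap0 : 0 <= kap.
Proof. by have := fd_V' F; have := eps0 => e0 v0; rewrite mulr_ge0//; lra. Qed.

Let del0 : 0 <= del.
Proof. by rewrite addr_ge0 ?expR_ge0// mulr_ge0 ?expR_ge0// exprn_ge0// mulr_ge0// ler0n. Qed.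

Let N1 : 1 <= N. Proof. by rewrite ler1n. Qed.

(** Between typical configurations (lam + kap) X - Q is increasing, so FKG bounds Cov(X, Q) by (lam
    + kap) Var X up to the exceptional error, and [var_edges_cov] turns this into a bound on Var X
    as soon as lam + kap < 1. *)
Lemma var_edges_good :
  (1 - lam - kap) * var T edges <= 4^-1 * N + 24 * (2 + kap) * N ^+ 3 * del.
Proof.
have l1 : lam < 1 := fd_lam F.
have l0 := lam0; have k0 := kap0; have d0 := del0; have n1 := N1.
have : - (6 * N * ((2 + kap) * N) * bad_prob T Uset Lset) <=
    cov T edges (fun y => (lam + kap) * edges y - Qsum T y).
  apply: (cov_good_ge (ham_supmod H) Uup Ldown).
  - by move=> y; rewrite ger0_norm ?edges_ge0// edges_le.
  - move=> y; have e1 := edges_ge0 (R := R) y; have e2 := edges_le (R := R) y.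
    have q1 := Qsum_ge0 T y; have q2 := Qsum_le T y.
    by rewrite ler_norml; apply/andP; split; nra.
  - by move=> e y _ _; rewrite D_edges.
  - move=> e y g0 g1; have := DQ_good g0 g1; rewrite ler_norml => /andP[_].
    by rewrite /D edges_true; lra.
rewrite covBr covZr => h; have := var_edges_cov T; rewrite /var in h *.
have := bad_le; have := bad_prob_ge0 T Uset Lset => b0 b1.
have cN : 0 <= 6 * N * ((2 + kap) * N) by rewrite !mulr_ge0//; lra.
have := ler_wpM2l cN b1; rewrite /var; lra.
Qed.

Lemma var_res_good : var T (fun y => Qsum T y - lam * edges y) <=
  kap ^+ 2 * var T edges + 24 * (2 + kap) ^+ 2 * N ^+ 3 * del.
Proof.
have l1 : lam < 1 := fd_lam F.
have l0 := lam0; have k0 := kap0; have d0 := del0; have n1 := N1.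
set r := fun y => _.
have rb y : `|r y| <= 2 * N.
  have e1 := edges_ge0 (R := R) y; have e2 := edges_le (R := R) y.
  have q1 := Qsum_ge0 T y; have q2 := Qsum_le T y.
  by rewrite /r ler_norml; apply/andP; split; nra.
have Dr e y : good (upd e false y) -> good (upd e true y) -> `|D e r y| <= kap.
  move=> g0 g1; have := DQ_good g0 g1; have := D_edges (R := R) e y.
  have -> : D e r y = D e (Qsum T) y - lam * D e edges y by rewrite /D /r; ring.
  by move=> ->; rewrite mulr1.
have : - (6 * ((2 + kap) * N) * ((2 + kap) * N) * bad_prob T Uset Lset) <=
    cov T (fun y => kap * edges y - r y) (fun y => kap * edges y + r y).
  apply: (cov_good_ge (ham_supmod H) Uup Ldown).
  - move=> y; have e1 := edges_ge0 (R := R) y; have e2 := edges_le (R := R) y.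
    have := rb y; rewrite !ler_norml => /andP[r1 r2].
    by apply/andP; split; nra.
  - move=> y; have e1 := edges_ge0 (R := R) y; have e2 := edges_le (R := R) y.
    have := rb y; rewrite !ler_norml => /andP[r1 r2].
    by apply/andP; split; nra.
  - move=> e y g0 g1; have := Dr e y g0 g1; rewrite ler_norml => /andP[_].
    by rewrite /D edges_true; lra.
  - move=> e y g0 g1; have := Dr e y g0 g1; rewrite ler_norml => /andP[h _]; move: h.
    by rewrite /D edges_true; lra.
rewrite cov_sqr_diff => h.
have := bad_le; have := bad_prob_ge0 T Uset Lset => b0 b1.
have cN : 0 <= 6 * ((2 + kap) * N) * ((2 + kap) * N) by rewrite !mulr_ge0//; lra.
have := ler_wpM2l cN b1; rewrite !expr2; lra.
Qed.

Lemma q_good e : mean T (fun y => (q T e y - p) ^+ 2) <= eps ^+ 2 + 2 * del.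
Proof.
have h1 := whp_up (nice_dT H e) (fd_lip F) k.
have h3 := whp_down (nice_dT H e) (fd_lip F) k.
rewrite -/tau -/del -/eps in h1 h3.
apply: (@le_trans _ _ (mean T (fun y => eps ^+ 2 +
  ((V p + eps < dT b A e y)%R%:R + (dT b A e y < V p - eps)%R%:R)))); last first.
  by rewrite !meanD mean_cst; rewrite /dT; lra.
apply: ler_mean => y; rewrite dT_q -{1}(fd_Vp F).
have sq1 : (sig (dT b A e y) - sig (V p)) ^+ 2 <= 1.
  have a1 := sig_ge0 (dT b A e y); have a2 := sig_le1 (dT b A e y).
  have a3 := sig_ge0 (V p); have a4 := sig_le1 (V p).
  rewrite -[leRHS](expr1n _ 2) -[leLHS]real_normK ?num_real//.
  by rewrite ler_sqr ?nnegrE// ler_norml; lra.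
case: ltP => /= h; first by have := sqr_ge0 eps; have := ler0n R (dT b A e y < V p - eps)%R; lra.
case: ltP => /= h'; first by have := sqr_ge0 eps; lra.
rewrite !addr0 -real_normK ?num_real// ler_sqr ?nnegrE ?eps0//.
by apply: le_trans (sig_lip _ _) _; rewrite ler_norml; lra.
Qed.

End good_set.

(* Here [expR (4 * l)] is the number n of vertices: order log n rounds make
   [la ^+ k] negligible, while the accumulated error, of order
   N^k exp(- c sqrt n), stays small. *)
Lemma rounds_exist (R : realType) (K la : R) : 1 <= K -> 0 <= la < 1 ->
  exists2 C : R, 1 <= C & forall l N : R, 0 <= l -> 1 <= N -> N <= expR (8 * l) ->
  exists2 k, la ^+ k <= expR (- l) &
    expR (40 * l) * (expR (- (expR (- l) ^+ 2 * expR (4 * l) / (8 * K ^+ 2))) *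
      (1 + (2 * N) ^+ k)) <= C.
Proof.
move=> K1 /andP[la0 la1]; have K0 : 0 < K := lt_le_trans ltr01 K1.
(* Raising the rate to 1/2 keeps its logarithm meaningful when la = 0. *)
pose la' := Num.max la 2^-1.
have lla : la <= la' by rewrite le_max lexx.
have la'0 : 0 < la' by rewrite lt_max invr_gt0 ltr0n orbT.
have la'1 : la' < 1 by rewrite gt_max la1 invf_lt1// ltr1n.
pose u := - ln la'.
have u0 : 0 < u by rewrite oppr_gt0 ln_lt0// la'0.
have la'E : la' = expR (- u) by rewrite opprK lnK// posrE.
(* The total exponent is at most 2 + 48 l + a l + 8 a l^2 - t^2 / (8 K^2) with t = exp l. As l <= t
   and l^2 <= 4 t, its positive part is at most 2 + B t, and the maximum of B t - t^2 / (8 K^2) is 2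
   K^2 B^2. *)
pose a := u^-1; pose B := 33 * a + 49.
have a0 : 0 < a by rewrite invr_gt0.
exists (expR (2 + 2 * K ^+ 2 * B ^+ 2)).
  by rewrite -[leLHS]expR0 ler_expR addr_ge0// mulr_ge0 ?sqr_ge0// mulr_ge0 ?sqr_ge0.
move=> l N l0 N1 NE; pose k := (Num.truncn (a * l)).+1.
have kl : a * l <= k%:R by apply: ltW; exact: Num.Theory.truncnS_gt.
have ku : k%:R <= a * l + 1.
  rewrite -natr1 lerD2r; have := Num.Theory.truncn_itv (_ : 0 <= a * l).
  by rewrite mulr_ge0// ?(ltW a0)// => /(_ isT)/andP[].
exists k.
  apply: (@le_trans _ _ (la' ^+ k)); first by rewrite lerXn2r ?nnegrE// ltW.
  rewrite la'E -expRM_natl ler_expR mulrN lerN2.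
  by move: kl; rewrite /a ler_pdivrMl// mulrC.
set t := expR l.
have t1 : 1 <= t by rewrite -[leLHS]expR0 ler_expR.
have lt : l <= t by have := expR_ge1Dx l; rewrite -/t; lra.
have l2t : l ^+ 2 <= 4 * t.
  have : expR (l / 2) ^+ 2 = t by rewrite -expRM_natl /t; congr expR; field.
  by move=> <-; have := expR_ge1Dx (l / 2); rewrite !expr2; nra.
have -> : expR (- l) ^+ 2 * expR (4 * l) = t ^+ 2.
  by rewrite -!expRM_natl -expRD; congr expR; ring.
have two : 2 <= expR (1 : R) by have := @expR_ge1Dx R 1; lra.
have pw : 1 + (2 * N) ^+ k <= expR (1 + k%:R * (1 + 8 * l)).
  have N20 : 0 <= 2 * N by lra.
  have b1 : 2 * N <= expR (1 + 8 * l).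
    rewrite expRD; apply: ler_pM => //; lra.
  rewrite expRD expRM_natl.
  apply: (@le_trans _ _ (2 * (2 * N) ^+ k)).
    by rewrite [leRHS]mulr_natl [leRHS]mulr2n lerD2r exprn_ege1//; lra.
  by apply: ler_pM => //; rewrite ?exprn_ge0// lerXn2r ?nnegrE// expR_ge0.
apply: (@le_trans _ _ (expR (40 * l) * (expR (- (t ^+ 2 / (8 * K ^+ 2))) *
    expR (1 + k%:R * (1 + 8 * l))))).
  by rewrite ler_pM2l ?expR_gt0// ler_pM2l ?expR_gt0.
rewrite -!expRD ler_expR.
have kk : k%:R * (1 + 8 * l) <= (a * l + 1) * (1 + 8 * l).
  by rewrite ler_wpM2r// addr_ge0// mulr_ge0.
have sq : B * t <= t ^+ 2 / (8 * K ^+ 2) + 2 * K ^+ 2 * B ^+ 2.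
  rewrite -subr_ge0 (_ : _ - _ = (t / K - 4 * K * B) ^+ 2 / 8).
    by rewrite divr_ge0 ?sqr_ge0.
  by field; rewrite gt_eqF.
move: sq; rewrite {1}/B => sq.
have al2 := ler_wpM2l (ltW a0) l2t; have al := ler_wpM2l (ltW a0) lt.
rewrite expr2 in al2; move: sq kk al2 al.
move: (2 * K ^+ 2 * B ^+ 2) (t ^+ 2 / (8 * K ^+ 2)) (k%:R * (1 + 8 * l)) => x y z.
by clear -t1 lt; lra.
Qed.

(** With l = (ln n) / 4 every power of n becomes an exponential of a multiple of l. The rate exp(-
    l) = n^(-1/4) is also taken as the deviation [eta] of the concentration bounds. *)
Theorem subcritical_moment_bounds (R : realType) (K p la : R) (V V' : R -> R) :
  1 <= K -> fixpoint_data K p la V V' ->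
  exists2 C : R, 0 < C & forall (E I : finType) (b : I -> R) (A : I -> {set E}) (l : R),
    0 <= l -> mean_field b A K (expR (4 * l)) V V' ->
    (0 < #|E|)%N -> #|E|%:R <= expR (8 * l) ->
    moment_bounds b A p (V' p * (p * (1 - p))) C (expR (- l)).
Proof.
move=> K1 F; have [l0 l1] := andP (fd_la F).
have [Cn Cn1 HC] := rounds_exist K1 (fd_la F).
have Cn0 := le_trans ler01 Cn1.
set lam := V' p * _; have lam1 : lam < 1 := fd_lam F.
have v0 := fd_V' F; have /andP[p0 p1] := fd_p F.
have lam0 : 0 <= lam.
  by rewrite mulr_ge0// mulr_ge0 ?(ltW p0)// subr_ge0 ltW.
have K0 := lt_le_trans ltr01 K1.
pose C0 := K * (1 + (K + 1) / (1 - la)) + (K + 1).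
pose C1 := C0 * (V' p + C0 + 1).
have C00 : 0 < C0.
  by rewrite addr_gt0// ?mulr_gt0 ?addr_gt0// ?divr_gt0 ?subr_gt0 ?addr_gt0.
have C10 : 0 < C1 by rewrite mulr_gt0//; lra.
(* If kap > (1 - lam) / 2, then rho >= c1, so N <= c1^(-8) and the trivial bound Var X <= N^2 is
   enough. The last term of [C2] accounts for these finitely many sizes. *)
pose c1 := (1 - lam) / (2 * C1).
have c10 : 0 < c1 by apply: divr_gt0; rewrite ?subr_gt0// pmulr_rgt0.
pose C2 := (4^-1 + 72 * Cn) * (2 / (1 - lam)) + c1 ^- 8.
have C20 : 0 < C2.
  rewrite addr_gt0 ?invr_gt0 ?exprn_gt0//.
  by rewrite mulr_gt0 ?divr_gt0 ?subr_gt0//; lra.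
pose C3 := C1 ^+ 2 * C2 + 24 * (2 + C1) ^+ 2 * Cn.
have C30 : 0 < C3.
  have h1 : 0 < C1 ^+ 2 * C2 by rewrite mulr_gt0 ?exprn_gt0.
  have h2 : 0 < 24 * (2 + C1) ^+ 2 * Cn.
    by rewrite mulr_gt0 ?mulr_gt0 ?exprn_gt0//; lra.
  exact: addr_gt0.
pose C4 := C0 ^+ 2 + 2 * Cn.
have C40 : 0 < C4 by have := exprn_gt0 2 C00; rewrite /C4; lra.
exists (C2 + C3 + C4); first by lra.
move=> E I b A l ll H E0 NE; set rho := expR (- l).
have rho0 : 0 < rho by exact: expR_gt0.
have rho1 : rho <= 1 by rewrite /rho -[leRHS]expR0 ler_expR; lra.
have N1 : 1 <= #|E|%:R :> R by rewrite ler1n.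
have [k kl kC] := HC _ _ ll N1 NE.
have rho01 : 0 < rho <= 1 by rewrite rho0.
set N := #|E|%:R in N1 NE kC *.
have n0 : 0 < expR (4 * l) by exact: expR_gt0.
have B1 := var_edges_good H n0 K1 E0 F rho01 k.
have B2 := var_res_good H n0 K1 E0 F rho01 k.
have B3 := q_good H n0 K1 E0 F rho01 k.
rewrite -/lam -/N in B1 B2 B3.
set eps := K * (la ^+ k + _) + _ in B1 B2 B3.
set kap := eps * _ in B1 B2.
set tau := expR (- _) in B1 B2 B3 kC.
have delE : tau + (2 * N) ^+ k * tau = tau * (1 + (2 * N) ^+ k) by ring.
rewrite delE in B1 B2 B3; set del := tau * _ in B1 B2 B3 kC delE.
have del0 : 0 <= del.
  by rewrite mulr_ge0 ?expR_ge0// addr_ge0// exprn_ge0// mulr_ge0 ?ler0n.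
have powE m : expR (m%:R * l) * rho ^+ m = 1.
  by rewrite /rho -expRM_natl -expRD mulrN subrr expR0.
have delC : del <= Cn * rho ^+ 40.
  have := ler_wpM2r (ltW (exprn_gt0 40 rho0)) kC.
  by rewrite -mulrA [del * _]mulrC mulrA powE mul1r.
have NR : N * rho ^+ 8 <= 1.
  have := ler_wpM2r (ltW (exprn_gt0 8 rho0)) NE.
  by rewrite powE.
have rpow i j : (i <= j)%N -> rho ^+ j <= rho ^+ i.
  by move=> ij; rewrite ler_wiXn2l// ?ltW.
have N2del : N ^+ 2 * del <= Cn * rho ^+ 2.
  apply: (@le_trans _ _ (N ^+ 2 * (Cn * rho ^+ 40))).
    by rewrite ler_wpM2l// sqr_ge0.
  have -> : N ^+ 2 * (Cn * rho ^+ 40) = (N * rho ^+ 8) ^+ 2 * (Cn * rho ^+ 24) by ring.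
  apply: (@le_trans _ _ (1 * (Cn * rho ^+ 24))).
    rewrite ler_wpM2r ?mulr_ge0 ?exprn_ge0 ?(ltW rho0)//.
    by rewrite exprn_ile1// mulr_ge0 ?ler0n// exprn_ge0// ltW.
  by rewrite mul1r ler_wpM2l ?rpow.
have invn : K / expR (4 * l) + rho <= (K + 1) * rho.
  have : (expR (4 * l))^-1 <= rho.
    by rewrite -expRN ler_expR; clear -ll; lra.
  by move/(ler_wpM2l (ltW K0)) => h; clear -h; lra.
have s0 : 0 <= K / expR (4 * l) + rho by rewrite addr_ge0 ?divr_ge0 ?ltW.
have epsC : eps <= C0 * rho.
  rewrite /eps /C0.
  have i0 : 0 <= (1 - la)^-1 by rewrite invr_ge0 subr_ge0 ltW.
  have h1 := ler_wpM2r i0 invn.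
  have h2 := ler_wpM2l (ltW K0) h1.
  have h3 := ler_wpM2l (ltW K0) kl.
  by rewrite -/rho in h3; clear -invn h2 h3; lra.
have eps0 : 0 <= eps.
  rewrite addr_ge0// mulr_ge0 ?(ltW K0)// addr_ge0 ?exprn_ge0//.
  by rewrite divr_ge0// subr_ge0 ltW.
have kapC : kap <= C1 * rho.
  rewrite /kap /C1 mulrAC; apply: ler_pM => //; first by clear -eps0 v0; lra.
  have h : C0 * rho <= C0 by rewrite ler_piMr// ltW.
  by clear -h epsC; lra.
have kap0 : 0 <= kap by rewrite mulr_ge0//; clear -eps0 v0; lra.
clear delE powE kC kl HC invn s0 NE n0 F K1 H.
clearbody kap eps del tau rho.
have NC (c : R) : 0 <= c -> 0 <= c * N by move=> c0; rewrite mulr_ge0 ?ler0n.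
have varX0 : var (ham b A) edges <= C2 * N.
  have [kl1|kl1] := leP kap ((1 - lam) / 2).
    have kle1 : kap <= 1 by clear -kl1 lam0; lra.
    have m0 : 0 <= N ^+ 3 * del by rewrite mulr_ge0// exprn_ge0// ler0n.
    have m1 : N ^+ 3 * del <= Cn * N.
      rewrite exprS -mulrA mulrC ler_wpM2r ?ler0n// (le_trans N2del)//.
      by rewrite ler_piMr ?exprn_ile1// ltW.
    have m2 : 24 * (2 + kap) * N ^+ 3 * del <= 72 * Cn * N.
      have h : 24 * (2 + kap) <= 72 by clear -kle1; lra.
      by have := ler_wpM2r m0 h; rewrite mulrA => h'; clear -h' m1; lra.
    have m3 := var_ge0 (ham b A) edges.
    have m4 : (1 - lam) / 2 * var (ham b A) edges <= (4^-1 + 72 * Cn) * N.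
      have h : (1 - lam) / 2 <= 1 - lam - kap by clear -kl1; lra.
      by have h' := ler_wpM2r m3 h; clear -h' m2 B1; lra.
    have m5 : 0 < 2 / (1 - lam) by rewrite divr_gt0// subr_gt0.
    have := ler_wpM2r (ltW m5) m4.
    have -> : (1 - lam) / 2 * var (ham b A) edges * (2 / (1 - lam)) = var (ham b A) edges.
      by field; rewrite subr_eq0 gt_eqF.
    have : 0 <= c1 ^- 8 * N by rewrite NC// invr_ge0 exprn_ge0// ltW.
    by rewrite /C2 => h1 h2; clear -h1 h2; lra.
  have rc : c1 <= rho.
    by rewrite /c1 ler_pdivrMr ?(mulr_gt0 _ C10)//; clear -kl1 kapC; lra.
  have N8 : N <= c1 ^- 8.
    rewrite -[leRHS]mul1r ler_pdivlMr ?exprn_gt0// (le_trans _ NR)//.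
    by rewrite ler_wpM2l ?ler0n// lerXn2r ?nnegrE ?(ltW c10) ?(ltW rho0).
  have e2 : var (ham b A) edges <= N * N.
    apply: (@le_trans _ _ (mean (ham b A) (fun y => edges y * edges y))).
      by rewrite /var /cov lerBlDr lerDl -expr2 sqr_ge0.
    by apply: mean_le => y; apply: ler_pM; rewrite ?edges_ge0 ?edges_le.
  apply: (le_trans e2); apply: ler_wpM2r; rewrite ?ler0n//.
  rewrite (le_trans N8)// lerDr mulr_ge0//; first by clear -Cn0; lra.
  by rewrite divr_ge0// subr_ge0 ltW.
split.
- by apply: (le_trans varX0); rewrite ler_wpM2r ?ler0n// -addrA lerDl addr_ge0// ltW.
- apply: (le_trans B2).
  have h1 : kap ^+ 2 <= C1 ^+ 2 * rho ^+ 2.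
    by rewrite -exprMn lerXn2r ?nnegrE// mulr_ge0 ?ltW.
  have h2 : kap ^+ 2 * var (ham b A) edges <= C1 ^+ 2 * rho ^+ 2 * (C2 * N).
    by apply: ler_pM; rewrite ?sqr_ge0// var_ge0.
  have h3 : N ^+ 3 * del <= N * (Cn * rho ^+ 2).
    by rewrite exprS -mulrA ler_wpM2l ?ler0n.
  have kC1 : kap <= C1 by rewrite (le_trans kapC)// ler_piMr// ltW.
  have h4 : (2 + kap) ^+ 2 <= (2 + C1) ^+ 2.
    by rewrite lerXn2r ?nnegrE ?addr_ge0 ?lerD2l// ltW.
  have h5 : (2 + kap) ^+ 2 * (N ^+ 3 * del) <= (2 + C1) ^+ 2 * (N * (Cn * rho ^+ 2)).
    by apply: ler_pM; rewrite ?sqr_ge0// mulr_ge0// exprn_ge0// ler0n.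
  apply: (@le_trans _ _ (C3 * rho ^+ 2 * N)).
    by rewrite /C3; clear -h2 h5; lra.
  by rewrite ler_wpM2r ?ler0n// ler_wpM2r ?sqr_ge0// addrAC lerDr addr_ge0// ltW.
- move=> e; apply: (le_trans (B3 e)).
  have h1 : eps ^+ 2 <= C0 ^+ 2 * rho ^+ 2.
    by rewrite -exprMn lerXn2r ?nnegrE// mulr_ge0 ?ltW.
  have h2 : del <= Cn * rho ^+ 2.
    by rewrite (le_trans delC)// ler_wpM2l ?rpow.
  apply: (@le_trans _ _ (C4 * rho ^+ 2)); first by rewrite /C4; clear -h1 h2; lra.
  by rewrite ler_wpM2r ?sqr_ge0// lerDr addr_ge0// ltW.
Qed.

(** * Moment bounds in Dobrushin's region *)

Lemma sum_CS (R : realType) (J : finType) (c w : J -> R) : (forall j, 0 <= c j) ->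
  (\sum_j c j * w j) ^+ 2 <= (\sum_j c j) * (\sum_j c j * w j ^+ 2).
Proof.
move=> c0; apply: quad_form_ge0_CS.
- by apply: sumr_ge0.
- by apply: sumr_ge0 => j _; rewrite mulr_ge0 ?sqr_ge0.
move=> a b; rewrite (_ : _ + _ = \sum_j c j * (a - b * w j) ^+ 2).
  by apply: sumr_ge0 => j _; rewrite mulr_ge0 ?sqr_ge0.
rewrite !mulr_sumr -sumrB -big_split; apply: eq_bigr => j _ /=; ring.
Qed.

Section weak_dependence.
Context {R : realType} {E I : finType}.
Notation conf := {ffun E -> bool}.
Variables (b : I -> R) (A : I -> {set E}) (K rho : R) (V V' : R -> R) (p la kappa : R).
Hypothesis H : mean_field b A K (rho ^- 2) V V'.
Hypotheses (rho01 : 0 < rho <= 1) (K1 : 1 <= K) (E0 : (0 < #|E|)%N).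
Hypothesis F : fixpoint_data K p la V V'.
Hypothesis kappa1 : kappa < 1.
Hypothesis dS_small : forall e y, dS b A e y <= 4 * kappa.
Notation T := (ham b A).
Notation N := (#|E|%:R : R).
Let Cp := (4 * (1 - kappa))^-1.
(** The bound that the Poincare inequality gives on the standard deviation of a nice polynomial. *)
Let om := K * Num.sqrt Cp * rho.

Let Cp0 : 0 <= Cp. Proof. by rewrite invr_ge0 mulr_ge0// subr_ge0 ltW. Qed.
Let K0 : 0 <= K. Proof. exact: le_trans ler01 K1. Qed.
Let rho0 : 0 <= rho. Proof. by case/andP: rho01 => /ltW. Qed.
Let rho1 : rho <= 1. Proof. by case/andP: rho01. Qed.
Let om0 : 0 <= om. Proof. by rewrite !mulr_ge0 ?sqrtr_ge0. Qed.

Let om2 : Cp * (K ^+ 2 * rho ^+ 2) = om ^+ 2.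
Proof. by rewrite /om !exprMn sqr_sqrtr//; ring. Qed.

(** The bound sig' <= 1/4 is uniform, so this holds at every configuration and not only at typical
    ones. *)
Lemma D_Qsum_le e y : D e (Qsum T) y <= kappa.
Proof.
apply: (@le_trans _ _ (4^-1 * dS b A e y)); last first.
  by have := dS_small e y; lra.
rewrite -sum_D_dT mulr_sumr /D /Qsum -sumrB; apply: ler_sum => e' _.
rewrite !dT_q.
have hle : dT b A e' (upd e false y) <= dT b A e' (upd e true y).
  by rewrite -subr_ge0; exact: poly_incr (nice_dT H e') e y.
have [z _ ->] := sig_mvt hle.
by rewrite ler_wpM2r ?subr_ge0// sig_deriv_le.
Qed.

Let poinc := poincare (q_ham_incr H) E0 kappa1 D_Qsum_le.

Lemma var_edges_le : var T edges <= Cp * N.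
Proof.
apply: le_trans (poinc _) _; rewrite ler_wpM2l//.
rewrite -[leRHS]mulr1 -sum_cst; apply: ler_sum => e _; apply: mean_le => y.
by rewrite D_edges expr1n.
Qed.

Lemma var_nice_le (J : finType) (P : pred J) (c : J -> R) B G :
  nice P c B K (rho ^- 2) G -> var T (poly P c B) <= om ^+ 2.
Proof.
move=> Hn; apply: le_trans (poinc _) _; rewrite -om2 ler_wpM2l//.
have := sum_infl_sqr Hn; rewrite invrK; apply: le_trans; apply: ler_sum => e _.
apply: mean_le => y; rewrite -real_normK ?num_real//.
rewrite ler_sqr ?nnegrE ?(infl_ge0 Hn)//; exact: (D_poly_norm Hn).
Qed.

Lemma mean_q_lip e (m : R) : mean T (fun y => (q T e y - sig m) ^+ 2) <=
  mean T (fun y => (dT b A e y - m) ^+ 2).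
Proof.
apply: ler_mean => y; rewrite dT_q -real_normK ?num_real//.
by rewrite -[leRHS]real_normK ?num_real// ler_sqr ?nnegrE// sig_lip.
Qed.

Lemma mean_norm_le f (w : R) : 0 <= w -> mean T (fun y => f y ^+ 2) <= w ^+ 2 ->
  `|mean T f| <= w.
Proof.
move=> w0 h; rewrite -ler_sqr ?nnegrE// real_normK ?num_real//.
exact: le_trans (mean_sqr _ _) h.
Qed.

Lemma q_sig_close e : `|mean T (q T e) - sig (mean T (dT b A e))| <= om.
Proof.
rewrite -[sig _](mean_cst T) -meanB; apply: mean_norm_le => //.
apply: le_trans (mean_q_lip _ _) _; rewrite -varE; exact: var_nice_le (nice_dT H e).
Qed.

(** The variance is the least mean square distance to a constant, so the 1-Lipschitz map [sig] does
    not increase it. *)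
Lemma q_var_le e : var T (q T e) <= om ^+ 2.
Proof.
apply: le_trans (var_nice_le (nice_dT H e)).
rewrite [leRHS]varE; apply: le_trans (mean_q_lip _ _).
set m := sig _; rewrite (_ : mean T _ = var T (q T e) + (mean T (q T e) - m) ^+ 2).
  by rewrite lerDl sqr_ge0.
rewrite /var /cov; under eq_mean do rewrite sqrrB -mulr_natl mulrC -mulrA.
rewrite (_ : (fun y => _) = (fun y => q T e y * q T e y - (2 * m) * q T e y + m ^+ 2)).
  by rewrite meanD meanB meanZ mean_cst; ring.
by apply/funext => y; ring.
Qed.

Lemma mean_Ye e : mean T (fun y => (y e)%:R) = mean T (q T e).
Proof.
apply/eqP; rewrite -subr_eq0 -meanB; apply/eqP.
have := mean_Yq_stein T e (fun=> 1).
under eq_mean do rewrite mulr1; move=> ->.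
by rewrite -[RHS](mean_cst T); apply: eq_mean => y; rewrite /D subrr mulr0.
Qed.

Let mE e := mean T (fun y => (y e)%:R).

(** Conditioning on the other edges replaces the indicator of [e] by q_e, whose standard deviation
    is at most [om]; the remaining monomial is bounded by 1. Iterated, this nearly factorizes the
    means of monomials. *)
Lemma mean_mon_cons (B : {set E}) e : e \in B ->
  `|mean T (mon B) - mE e * mean T (mon (B :\ e)%SET)| <= om.
Proof.
move=> eB; set B' := (B :\ e)%SET.
have eB' : e \notin B' by rewrite !inE eqxx.
have -> : mean T (mon B) = mean T (fun y => q T e y * mon B' y).
  rewrite (_ : mon B = fun y => (y e)%:R * mon B' (upd e true y)); last first.
    by apply/funext => y; rewrite (mon_in _ eB) mon_upd_notin.
  by rewrite mean_Yq; apply: eq_mean => y; rewrite mon_upd_notin.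
rewrite /mE mean_Ye -meanZ -meanB; apply: mean_norm_le => //.
apply: le_trans (q_var_le e); rewrite varE; apply: ler_mean => y.
rewrite -mulrBl exprMn ler_piMr ?sqr_ge0// exprn_ile1 ?mon_ge0 ?mon_le1//.
Qed.

Lemma mean_Ye01 e : 0 <= mE e <= 1.
Proof.
by apply/andP; split; [apply: mean_ge0 => y|apply: mean_le => y];
  rewrite ?ler0n// lern1 leq_b1.
Qed.

Lemma mean_mon01 (B : {set E}) : 0 <= mean T (mon B) <= 1.
Proof.
by apply/andP; split; [apply: mean_ge0 => y|apply: mean_le => y];
  rewrite ?mon_ge0 ?mon_le1.
Qed.

Lemma mean_mon_ub (B : {set E}) (M : R) : M <= 1 -> (forall e, mE e <= M) ->
  mean T (mon B) <= M ^+ #|B| + #|B|%:R * om.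
Proof.
move=> M1 hM; have M0 : 0 <= M.
  by have /card_gt0P[e _] := E0; apply: le_trans (hM e); have /andP[] := mean_Ye01 e.
move Ek : #|B| => k; elim: k B Ek => [|k IH] B Ek.
  have /eqP := Ek; rewrite cards_eq0 => /eqP ->.
  by rewrite mul0r addr0 expr0; apply: mean_le => y; exact: mon_le1.
have /card_gt0P[e eB] : (0 < #|B|)%N by rewrite Ek.
have Ek' : #|(B :\ e)%SET| = k by rewrite cardD1_in// Ek subn1.
have := mean_mon_cons eB; rewrite ler_norml => /andP[_ h].
have h2 := ler_pM (_ : 0 <= mE e) (_ : 0 <= mean T (mon (B :\ e)%SET)) (hM e) (IH _ Ek').
have {}h2 := h2 (proj1 (andP (mean_Ye01 e))) (proj1 (andP (mean_mon01 _))).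
have h3 := mulr_ge0 (ler0n R k) om0.
have h4 := ler_wpM2r h3 M1.
by rewrite exprS -natr1; lra.
Qed.

Lemma mean_mon_lb (B : {set E}) (M : R) : 0 <= M -> (forall e, M <= mE e) ->
  M ^+ #|B| - #|B|%:R * om <= mean T (mon B).
Proof.
move=> M0 hM; have M1 : M <= 1.
  by have /card_gt0P[e _] := E0; apply: le_trans (hM e) _; have /andP[] := mean_Ye01 e.
move Ek : #|B| => k; elim: k B Ek => [|k IH] B Ek.
  have /eqP := Ek; rewrite cards_eq0 => /eqP ->.
  by rewrite mul0r subr0 expr0; apply: mean_ge => y; rewrite mon0.
have /card_gt0P[e eB] : (0 < #|B|)%N by rewrite Ek.
have Ek' : #|(B :\ e)%SET| = k by rewrite cardD1_in// Ek subn1.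
have := mean_mon_cons eB; rewrite ler_norml => /andP[h _].
have h2 := ler_wpM2r (proj1 (andP (mean_mon01 (B :\ e)%SET))) (hM e).
have h2' := ler_wpM2l M0 (IH _ Ek').
have h3 := mulr_ge0 (ler0n R k) om0.
have h4 := ler_wpM2r h3 M1.
by rewrite exprS -natr1; lra.
Qed.

Section nice_mean.
Context {J : finType}.
Variables (P : pred J) (c : J -> R) (B : J -> {set E}) (G : R -> R).
Hypothesis Hn : nice P c B K (rho ^- 2) G.

Let mean_poly : mean T (poly P c B) = \sum_(j | P j) c j * mean T (mon (B j)).
Proof. by rewrite /poly mean_sum; apply: eq_bigr => j _; rewrite meanZ. Qed.

Let Sw : \sum_(j | P j) c j * (#|B j|%:R * om) <= K * om.
Proof.
under eq_bigr do rewrite mulrA; rewrite -mulr_suml ler_wpM2r// -sum_infl.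
exact: (nice_sum Hn).
Qed.

Lemma nice_mean_ub (M : R) : M <= 1 -> (forall e, mE e <= M) ->
  mean T (poly P c B) <= G M + (K * rho ^+ 2 + K * om).
Proof.
move=> M1 hM; have M0 : 0 <= M.
  by have /card_gt0P[e _] := E0; apply: le_trans (hM e); have /andP[] := mean_Ye01 e.
have := nice_mf Hn (_ : 0 <= M <= 1); rewrite M0 M1 invrK => /(_ isT).
move=> /(le_trans (ler_norm _)) h; rewrite mean_poly.
apply: (@le_trans _ _ (\sum_(j | P j) c j * (M ^+ #|B j| + #|B j|%:R * om))).
  apply: ler_sum => j Pj; case: (posnP #|B j|) => B0; last first.
    by rewrite ler_wpM2l ?(nice_ge0 Hn)// mean_mon_ub.
  by have /eqP := B0; rewrite cards_eq0 => /eqP ->;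
    rewrite cards0 expr0 mul0r addr0 (eq_mean T (@mon0 _ _)) mean_cst.
under eq_bigr do rewrite mulrDr.
by rewrite big_split /=; have := Sw; lra.
Qed.

Lemma nice_mean_lb (M : R) : 0 <= M -> (forall e, M <= mE e) ->
  G M - (K * rho ^+ 2 + K * om) <= mean T (poly P c B).
Proof.
move=> M0 hM; have M1 : M <= 1.
  by have /card_gt0P[e _] := E0; apply: le_trans (hM e) _; have /andP[] := mean_Ye01 e.
have := nice_mf Hn (_ : 0 <= M <= 1); rewrite M0 M1 invrK => /(_ isT).
rewrite ler_norml => /andP[h _]; rewrite mean_poly.
apply: (@le_trans _ _ (\sum_(j | P j) c j * (M ^+ #|B j| - #|B j|%:R * om))); last first.
  apply: ler_sum => j Pj; case: (posnP #|B j|) => B0; last first.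
    by rewrite ler_wpM2l ?(nice_ge0 Hn)// mean_mon_lb.
  by have /eqP := B0; rewrite cards_eq0 => /eqP ->;
    rewrite cards0 expr0 mul0r subr0 (eq_mean T (@mon0 _ _)) mean_cst.
under [leRHS]eq_bigr do rewrite mulrBr.
by rewrite sumrB /=; have := Sw; lra.
Qed.

End nice_mean.

Let s := K * rho ^+ 2 + (K + 1) * om.
Let s0 : 0 <= s.
Proof. by rewrite /s !addr_ge0// mulr_ge0 ?sqr_ge0//; have := K0; lra. Qed.

Let sl0 : 0 <= s / (1 - la).
Proof. by rewrite divr_ge0 ?s0// subr_ge0 ltW//; case/andP: (fd_la F). Qed.

Let sigD (x y : R) : 0 <= y -> sig (x + y) <= sig x + y.
Proof.
move=> y0; have := sig_lip (x + y) x; rewrite (_ : x + y - x = y); last by ring.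
by move=> /(le_trans (ler_norm _)); rewrite ger0_norm//; lra.
Qed.

(** A maximum principle: if the largest edge density M exceeds p, then M <= sig (V M) + s at that
    edge, and the contraction towards p yields (1 - la) (M - p) <= s. *)
Lemma mean_Ye_ub e : mE e <= p + s / (1 - la).
Proof.
have [e1 he1] : exists e1, forall e, mE e <= mE e1.
  by exists [arg max_(e1 > e) mE e1]%O; case: arg_maxP => // e1 _ he1 e'; exact: he1.
apply: (le_trans (he1 e)).
have [h|h] := leP (mE e1) p; first by have := sl0; lra.
have /andP[m0 m1] := mean_Ye01 e1.
have h1 := nice_mean_ub (nice_dT H e1) m1 he1.
have := q_sig_close e1; rewrite ler_norml -mean_Ye => /andP[_ h2].
have h3 := sig_homo h1.
have h4 := sigD (V (mE e1)) (_ : 0 <= K * rho ^+ 2 + K * om).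
have {}h4 := h4 (addr_ge0 (mulr_ge0 K0 (sqr_ge0 _)) (mulr_ge0 K0 om0)).
have h5 := fd_up F (ltW h) m1.
have h6 : mE e1 - p <= la * (mE e1 - p) + s by rewrite /s; rewrite /mE in h1 h2 h3 h4 h5 *; rewrite /dT in h2; lra.
have la1 : 0 < 1 - la by rewrite subr_gt0; case/andP: (fd_la F).
by rewrite -lerBlDl ler_pdivlMr//; lra.
Qed.

Lemma mean_Ye_lb e : p - s / (1 - la) <= mE e.
Proof.
have [e1 he1] : exists e1, forall e, mE e1 <= mE e.
  by exists [arg min_(e1 < e) mE e1]%O; case: arg_minP => // e1 _ he1 e'; exact: he1.
apply: (le_trans _ (he1 e)).
have [h|h] := leP p (mE e1); first by have := sl0; lra.
have /andP[m0 m1] := mean_Ye01 e1.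
have h1 := nice_mean_lb (nice_dT H e1) m0 he1.
have := q_sig_close e1; rewrite ler_norml -mean_Ye => /andP[h2 _].
have h3 := sig_homo h1.
have h4 := sigD (V (mE e1) - (K * rho ^+ 2 + K * om)) (_ : 0 <= K * rho ^+ 2 + K * om).
have {}h4 := h4 (addr_ge0 (mulr_ge0 K0 (sqr_ge0 _)) (mulr_ge0 K0 om0)).
rewrite subrK in h4.
have h5 := fd_down F m0 (ltW h).
have h6 : p - mE e1 <= la * (p - mE e1) + s by rewrite /s; rewrite /mE in h1 h2 h3 h4 h5 *; rewrite /dT in h2; lra.
have la1 : 0 < 1 - la by rewrite subr_gt0; case/andP: (fd_la F).
by rewrite lerBlDr -lerBlDl ler_pdivlMr//; lra.
Qed.

(** A bound on the bias, that is on the distance of the mean of a nice polynomial to its value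
    [G p]; [ms] is then variance plus squared bias. *)
Let beta := K * (s / (1 - la)) + s.
Let beta0 : 0 <= beta. Proof. by rewrite addr_ge0 ?s0// mulr_ge0 ?sl0. Qed.
Let ms := om ^+ 2 + beta ^+ 2.

Lemma nice_msq (J : finType) (P : pred J) (c : J -> R) B G :
  nice P c B K (rho ^- 2) G ->
  (forall x y : R, 0 <= x <= 1 -> 0 <= y <= 1 -> `|G x - G y| <= K * `|x - y|) ->
  mean T (fun y => (poly P c B y - G p) ^+ 2) <= ms.
Proof.
move=> Hn Glip; have /andP[p0 p1] := fd_p F.
have p01 : 0 <= p <= 1 by rewrite !ltW.
set g := poly P c B.
have -> : mean T (fun y => (g y - G p) ^+ 2) = var T g + (mean T g - G p) ^+ 2.
  rewrite (_ : (fun y => _) = (fun y => g y * g y - (2 * G p) * g y + G p ^+ 2)).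
    by rewrite meanD meanB meanZ mean_cst /var /cov; ring.
  by apply/funext => y; ring.
rewrite lerD ?(var_nice_le Hn)//.
rewrite -real_normK ?num_real// ler_sqr ?nnegrE//.
have hs : K * rho ^+ 2 + K * om <= s by rewrite /s; have := om0; lra.
(* The bound on the densities is truncated to [0, 1], where [G] is known to be Lipschitz. *)
pose Mu := Num.min 1 (p + s / (1 - la)).
have Mu01 : 0 <= Mu <= 1.
  by rewrite le_min ler01 ge_min lexx /= andbT; have := sl0; lra.
have Mup : `|Mu - p| <= s / (1 - la).
  have : p <= Mu by rewrite le_min (ltW p1); have := sl0; lra.
  have : Mu <= p + s / (1 - la) by rewrite ge_min lexx orbT.
  by rewrite ler_norml; lra.
have u1 : mean T g <= G Mu + (K * rho ^+ 2 + K * om).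
  apply: (nice_mean_ub Hn); first by case/andP: Mu01.
  by move=> e; rewrite le_min mean_Ye_ub andbT; case/andP: (mean_Ye01 e).
pose Ml := Num.max 0 (p - s / (1 - la)).
have Ml01 : 0 <= Ml <= 1.
  by rewrite le_max lexx ge_max ler01 /=; have := sl0; lra.
have Mlp : `|Ml - p| <= s / (1 - la).
  have : Ml <= p by rewrite ge_max (ltW p0); have := sl0; lra.
  have : p - s / (1 - la) <= Ml by rewrite le_max lexx orbT.
  by rewrite ler_norml; lra.
have l1 : G Ml - (K * rho ^+ 2 + K * om) <= mean T g.
  apply: (nice_mean_lb Hn); first by case/andP: Ml01.
  by move=> e; rewrite ge_max mean_Ye_lb andbT; case/andP: (mean_Ye01 e).
have := Glip _ _ Mu01 p01; have := Glip _ _ Ml01 p01.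
have := ler_wpM2l K0 Mup; have := ler_wpM2l K0 Mlp.
move=> a1 a2 /le_trans - /(_ _ a1); rewrite ler_norml => /andP[a3 _].
move=> /le_trans - /(_ _ a2); rewrite ler_norml => /andP[_ a4].
by rewrite ler_norml /beta; lra.
Qed.

(** Poincare for Q - lam X. Its increment at [e] is controlled by the deviations of the [dT e'] from
    V p weighted by influences, the squared influences coming from the intermediate points, and the
    deviation of [dS e] from V' p; all are O(rho) in mean square norm. *)
Lemma res_dobrushin : var T (fun y => Qsum T y - (V' p * (p * (1 - p))) * edges y) <=
  Cp * (3 * ((K ^+ 2 + 1) * ms + (K ^+ 2 * rho ^+ 2) ^+ 2)) * N.
Proof.
have /andP[p0 p1] := fd_p F; set lam := V' p * _.
apply: le_trans (poinc _) _; rewrite -mulrA ler_wpM2l// mulrC -sum_cst.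
apply: ler_sum => e _.
pose c e' := infl (fun i => e \in A i) b (fun i => A i :\ e)%SET e'.
have c0 e' : 0 <= c e' := infl_ge0 (nice_dT H e) e'.
pose w y e' := dT b A e' y - V p.
have pp : 0 <= p * (1 - p) <= 1.
  by apply/andP; split; [rewrite mulr_ge0 ?subr_ge0 ?ltW|nra].
case/andP: pp => pp0 pp1.
have key y : `|D e (fun y => Qsum T y - lam * edges y) y| <=
    \sum_e' c e' * `|w y e'| + \sum_e' c e' ^+ 2 + `|dS b A e y - V' p|.
  have -> : D e (fun y => Qsum T y - lam * edges y) y =
      (D e (Qsum T) y - p * (1 - p) * dS b A e y) + p * (1 - p) * (dS b A e y - V' p).
    rewrite /D edges_true /lam; ring.
  apply: (le_trans (ler_normD _ _)); apply: lerD; last first.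
    by rewrite normrM (ger0_norm pp0) ler_piMl.
  rewrite -sum_D_dT mulr_sumr /D /Qsum -!sumrB -big_split /=.
  apply: le_trans (ler_norm_sum _ _ _) _; apply: ler_sum => e' _.
  have /andP[d0 d1] := D_poly_bound (nice_dT H e') e y.
  rewrite infl_dT_sym -/(c e') in d1.
  rewrite -[poly _ _ _]/(dT b A e') in d0 d1.
  rewrite !dT_q; have hle := d0; rewrite /D subr_ge0 in hle.
  have [z /andP[z0 z1] ->] := sig_mvt hle.
  rewrite -mulrBl normrM [`|dT _ _ _ _ - _|]ger0_norm ?subr_ge0//.
  rewrite expr2 -mulrDr mulrC; apply: ler_pM => //.
  rewrite -{1 2}(fd_Vp F); apply: le_trans (sig_deriv_lip _ _) _.
  apply: le_trans (sig_lip _ _) _.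
  have zw : `|z - dT b A e' y| <= c e'.
    apply: le_trans d1; rewrite /D -{1}(upd_id e y).
    by case: (y e); rewrite ler_norml; apply/andP; split; lra.
  have -> : z - V p = (dT b A e' y - V p) + (z - dT b A e' y) by ring.
  by apply: le_trans (ler_normD _ _) _; rewrite lerD2l.
apply: (@le_trans _ _ (mean T (fun y => 3 * (K * \sum_e' c e' * w y e' ^+ 2 +
   (K ^+ 2 * rho ^+ 2) ^+ 2 + (dS b A e y - V' p) ^+ 2)))).
  apply: ler_mean => y; have := key y.
  set a1 := \sum_e' _; set a2 := \sum_e' _; set a3 := `|dS _ _ _ _ - _| => h.
  have q1 : a1 ^+ 2 <= K * \sum_e' c e' * w y e' ^+ 2.
    apply: le_trans (sum_CS _ c0) _; under [X in _ * X]eq_bigr do rewrite real_normK ?num_real//.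
    rewrite ler_wpM2r ?(nice_sum (nice_dT H e))//.
    by apply: sumr_ge0 => e' _; rewrite mulr_ge0 ?sqr_ge0.
  have q2 : a2 ^+ 2 <= (K ^+ 2 * rho ^+ 2) ^+ 2.
    have := sum_infl_sqr (nice_dT H e); rewrite invrK => a2K.
    have a20 : 0 <= a2 by apply: sumr_ge0 => e' _; exact: sqr_ge0.
    by rewrite ler_sqr ?nnegrE// (le_trans a20 a2K).
  have q3 : a3 ^+ 2 = (dS b A e y - V' p) ^+ 2 by rewrite real_normK ?num_real.
  rewrite -q3; apply: (@le_trans _ _ (3 * (a1 ^+ 2 + a2 ^+ 2 + a3 ^+ 2))); last by lra.
  apply: (@le_trans _ _ ((a1 + a2 + a3) ^+ 2)).
    by rewrite -real_normK ?num_real// ler_sqr ?nnegrE// (le_trans _ h).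
  have := sqr_ge0 (a1 - a2); have := sqr_ge0 (a1 - a3); have := sqr_ge0 (a2 - a3).
  by rewrite !expr2; lra.
rewrite meanZ ler_pM2l// !meanD mean_cst meanZ mean_sum.
have m1 : \sum_e' mean T (fun y => c e' * w y e' ^+ 2) <= K * ms.
  apply: (@le_trans _ _ (\sum_e' c e' * ms)).
    apply: ler_sum => e' _; rewrite meanZ ler_wpM2l//.
    exact: nice_msq (nice_dT H e') (fd_lip F).
  rewrite -mulr_suml ler_wpM2r ?(nice_sum (nice_dT H e))//.
  by rewrite addr_ge0 ?sqr_ge0.
have m2 := nice_msq (nice_dS H e) (fd_lip' F).
rewrite -[poly _ _ _]/(dS b A e) in m2.
by have := ler_wpM2l K0 m1; lra.
Qed.

Lemma q_dobrushin e : mean T (fun y => (q T e y - p) ^+ 2) <= ms.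
Proof.
rewrite -{1}(fd_Vp F); apply: le_trans (mean_q_lip _ _) _.
exact: nice_msq (nice_dT H e) (fd_lip F).
Qed.

Lemma ms_le : ms <= ((K * Num.sqrt Cp) ^+ 2 +
  ((K / (1 - la) + 1) * (K + (K + 1) * (K * Num.sqrt Cp))) ^+ 2) * rho ^+ 2.
Proof.
have la1 : 0 < 1 - la by rewrite subr_gt0; case/andP: (fd_la F).
have i0 : 0 <= K / (1 - la) by rewrite divr_ge0// ltW.
have sC : s <= (K + (K + 1) * (K * Num.sqrt Cp)) * rho.
  have : rho ^+ 2 <= rho by rewrite expr2 ler_piMr.
  by move=> /(ler_wpM2l K0); rewrite /s /om; lra.
have bC : beta <= (K / (1 - la) + 1) * (K + (K + 1) * (K * Num.sqrt Cp)) * rho.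
  rewrite -mulrA (_ : beta = (K / (1 - la) + 1) * s); last by rewrite /beta; ring.
  by rewrite ler_wpM2l// addr_ge0.
rewrite mulrDl -!exprMn lerD2l ler_sqr ?nnegrE//.
exact: le_trans bC.
Qed.

End weak_dependence.

Theorem dobrushin_moment_bounds (R : realType) (K p la kappa : R) (V V' : R -> R) :
  1 <= K -> fixpoint_data K p la V V' -> kappa < 1 ->
  exists2 C : R, 0 < C & forall (E I : finType) (b : I -> R) (A : I -> {set E}) (rho : R),
    0 < rho <= 1 -> mean_field b A K (rho ^- 2) V V' -> (0 < #|E|)%N ->
    (forall e y, dS b A e y <= 4 * kappa) ->
    moment_bounds b A p (V' p * (p * (1 - p))) C rho.
Proof.
move=> K1 F k1; pose Cp := (4 * (1 - kappa))^-1.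
have Cp0 : 0 <= Cp by rewrite invr_ge0 mulr_ge0// subr_ge0 ltW.
pose Cm := (K * Num.sqrt Cp) ^+ 2 +
  ((K / (1 - la) + 1) * (K + (K + 1) * (K * Num.sqrt Cp))) ^+ 2.
have Cm0 : 0 <= Cm by rewrite addr_ge0 ?sqr_ge0.
pose C3 := Cp * (3 * ((K ^+ 2 + 1) * Cm + K ^+ 4)).
have K0 := le_trans ler01 K1.
have C30 : 0 <= C3.
  rewrite mulr_ge0// mulr_ge0// addr_ge0 ?exprn_ge0//.
  by rewrite mulr_ge0// addr_ge0 ?sqr_ge0.
exists (Cp + Cm + C3 + 1); first by lra.
move=> E I b A rho rho01 H E0 hS.
have N0 : 0 <= #|E|%:R :> R by exact: ler0n.
have r2 : 0 <= rho ^+ 2 by exact: sqr_ge0.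
have msC := ms_le kappa rho01 K1 F; rewrite -/Cp -/Cm in msC.
split.
- apply: le_trans (var_edges_le H E0 k1 hS) _; rewrite -/Cp ler_wpM2r//; lra.
- apply: le_trans (res_dobrushin H rho01 K1 E0 F k1 hS) _.
  rewrite -/Cp; set m := _ ^+ 2 + _ ^+ 2 in msC *.
  rewrite ler_wpM2r//; apply: (@le_trans _ _ (C3 * rho ^+ 2)); last first.
    by rewrite ler_wpM2r//; lra.
  rewrite /C3 -[leRHS]mulrA ler_wpM2l// -[leRHS]mulrA ler_pM2l//.
  have h1 : (K ^+ 2 + 1) * m <= (K ^+ 2 + 1) * (Cm * rho ^+ 2).
    by rewrite ler_wpM2l// addr_ge0 ?sqr_ge0.
  have h2 : (K ^+ 2 * rho ^+ 2) ^+ 2 <= K ^+ 4 * rho ^+ 2.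
    rewrite exprMn -exprM ler_wpM2l ?exprn_ge0//.
    have /andP[r0 r1] := rho01.
    by rewrite [leLHS]expr2 ler_piMr// exprn_ile1// ltW.
  by lra.
- move=> e; apply: le_trans (q_dobrushin H rho01 K1 E0 F k1 hS e) _.
  by apply: le_trans msC _; rewrite ler_wpM2r//; lra.
Qed.

(** * Stein's method for the normalized number of edges *)

Section stein.
Context {R : realType} {E : finType}.
Notation conf := {ffun E -> bool}.
Variables (T : conf -> R) (p lam C rho : R).
Hypothesis E0 : (0 < #|E|)%N.
Hypotheses (p01 : 0 < p < 1) (lam1 : lam < 1) (C0 : 0 < C) (rho01 : 0 < rho <= 1).
Hypothesis lam0 : 0 <= lam.
Hypothesis var_le : var T edges <= C * #|E|%:R.
Hypothesis res_le : var T (fun y => Qsum T y - lam * edges y) <= C * rho ^+ 2 * #|E|%:R.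
Hypothesis q_le : forall e, mean T (fun y => (q T e y - p) ^+ 2) <= C * rho ^+ 2.
Notation N := (#|E|%:R : R).

Definition stein_sd : R := Num.sqrt (N * p * (1 - p) / (1 - lam)).
Definition stein_W (y : conf) : R := (edges y - mean T edges) / stein_sd.

Notation sd := stein_sd.
Notation W := stein_W.
Let v := p * (1 - p).
Let v0 : 0 < v. Proof. by case/andP: p01 => ? ?; rewrite mulr_gt0// subr_gt0. Qed.
Let l0 : 0 < 1 - lam. Proof. by rewrite subr_gt0. Qed.
Let N1 : 1 <= N. Proof. by rewrite ler1n. Qed.
Let N0 : 0 < N. Proof. exact: lt_le_trans ltr01 N1. Qed.
Let c6 := Num.sqrt ((1 - lam) / v).
Let c60 : 0 < c6. Proof. by rewrite sqrtr_gt0 divr_gt0. Qed.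

Lemma stein_sd_sqr : sd ^+ 2 = N * v / (1 - lam).
Proof. by rewrite sqr_sqrtr ?mulrA// divr_ge0 ?(ltW l0)// -mulrA mulr_ge0 ?(ltW v0)// ltW. Qed.

Lemma stein_sd_gt0 : 0 < sd.
Proof. by rewrite sqrtr_gt0 divr_gt0// -mulrA mulr_gt0. Qed.

Let sd0 := stein_sd_gt0.
Let del := sd^-1.
Let del0 : 0 < del. Proof. by rewrite invr_gt0. Qed.

Let Ndel : N * del ^+ 2 = c6 ^+ 2.
Proof.
rewrite /del exprVn stein_sd_sqr sqr_sqrtr ?divr_ge0 ?ltW//.
by field; rewrite !gt_eqF.
Qed.

Let del_c6 : del <= c6.
Proof.
rewrite -ler_sqr ?nnegrE ?(ltW del0) ?(ltW c60)// -Ndel.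
by rewrite ler_peMl// sqr_ge0.
Qed.

Let sqrtN_sd : Num.sqrt N = c6 * sd.
Proof.
have -> : N = (c6 * sd) ^+ 2.
  by rewrite exprMn -Ndel /del exprVn mulfVK// gt_eqF// exprn_gt0.
by rewrite sqrtr_sqr ger0_norm// mulr_ge0// ltW.
Qed.

Lemma mean_CS_le f g (a b : R) : 0 <= a -> 0 <= b ->
  mean T (fun y => f y ^+ 2) <= a ^+ 2 -> mean T (fun y => g y ^+ 2) <= b ^+ 2 ->
  `|mean T (fun y => f y * g y)| <= a * b.
Proof.
move=> a0 b0 ha hb; rewrite -ler_sqr ?nnegrE ?mulr_ge0// real_normK ?num_real//.
apply: le_trans (mean_CS _ _ _) _; rewrite exprMn; apply: ler_pM => //;
  by apply: mean_ge0 => y; exact: sqr_ge0.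
Qed.

Lemma stein_W_upd e y : W (upd e true y) = W (upd e false y) + del.
Proof. by rewrite /W edges_true /del; field; rewrite gt_eqF. Qed.

Lemma stein_W_between e y : W (upd e false y) <= W y <= W (upd e true y).
Proof.
rewrite stein_W_upd -{2 3}(upd_id e y).
by case: (y e); rewrite ?stein_W_upd lexx ?andbT lerDl ltW.
Qed.

Let C5 := C * (1 - lam) / v.
Let C50 : 0 <= C5. Proof. by rewrite divr_ge0 ?(ltW v0)// mulr_ge0 ?(ltW C0) ?(ltW l0). Qed.

Lemma mean_W_sqr : mean T (fun y => W y ^+ 2) <= C5.
Proof.
under eq_mean do rewrite /W exprMn mulrC.
rewrite meanZ -varE exprVn stein_sd_sqr.
rewrite ler_pdivrMl; last by rewrite divr_gt0// mulr_gt0.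
by apply: le_trans var_le _; rewrite /C5 le_eqVlt; apply/orP; left; apply/eqP;
  field; rewrite !gt_eqF.
Qed.

Let r y := Qsum T y - lam * edges y.

Let decomp y : (1 - lam) * sd * W y = (edges y - Qsum T y) + (r y - mean T r).
Proof.
have -> : mean T r = (1 - lam) * mean T edges.
  by rewrite meanB meanZ -mean_edges_Q; ring.
by rewrite /W /r; field; rewrite gt_eqF.
Qed.

Lemma mean_XQ_norm : mean T (fun y => `|edges y - Qsum T y|) <= 2 * Num.sqrt C * c6 * sd.
Proof.
have -> : 2 * Num.sqrt C * c6 * sd = 2 * Num.sqrt C * Num.sqrt N * 1.
  by rewrite sqrtN_sd; ring.
rewrite -[leLHS]ger0_norm; last by apply: mean_ge0.
under eq_mean do rewrite -[`|_|]mulr1.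
apply: mean_CS_le; rewrite ?mulr_ge0 ?sqrtr_ge0//; last first.
  by apply: mean_le => y; rewrite expr1n.
under eq_mean do rewrite real_normK ?num_real//.
rewrite !exprMn !sqr_sqrtr ?(ltW C0) ?(ltW N0)//.
apply: (@le_trans _ _ (mean T (fun y => 2 * (edges y - mean T edges) ^+ 2 +
    2 * (r y - mean T r) ^+ 2))).
  apply: ler_mean => y.
  have -> : edges y - Qsum T y = (1 - lam) * (edges y - mean T edges) - (r y - mean T r).
    have := decomp y; rewrite /W (mulrC _ sd^-1) mulrA mulfK ?gt_eqF//; lra.
  set a := edges y - _; set b := r y - _.
  have h1 := sqr_ge0 ((1 - lam) * a + b).
  have h2 : ((1 - lam) * a) ^+ 2 <= a ^+ 2.
    rewrite exprMn ler_piMl ?sqr_ge0// exprn_ile1 ?(ltW l0)//.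
    by have := lam0; lra.
  by rewrite !expr2 in h1 h2 *; lra.
rewrite meanD !meanZ -!varE.
have : C * rho ^+ 2 * N <= C * N.
  rewrite ler_wpM2r ?(ltW N0)// ler_piMr ?(ltW C0)// exprn_ile1//.
    by case/andP: rho01 => /ltW.
  by case/andP: rho01.
by have := var_le; have := res_le; rewrite -/r; lra.
Qed.

Section equation.
Variables (f h : R -> R) (m B Ch : R) (hv : E -> conf -> R).
Hypothesis fE : forall w : R, is_derive w 1 f (w * f w + h w - m).
Hypothesis fB : forall w : R, `|f w| <= B.
Hypothesis hB : forall w : R, `|h w - m| <= B * (1 + `|w|).
Hypothesis hvP : forall e y x, W (upd e false y) <= x -> x <= W (upd e true y) ->
  `|h x - h (W y)| <= hv e y.
Hypothesis hvC : \sum_e mean T (fun y => q T e y * (1 - q T e y) * hv e y) <= Ch * sd.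
Let df w := w * f w + h w - m.
Let B0 : 0 <= B. Proof. exact: le_trans (normr_ge0 _) (fB 0). Qed.

Let df_bound w : `|df w| <= B * (1 + 2 * `|w|).
Proof.
have -> : df w = w * f w + (h w - m) by rewrite /df; ring.
apply: (le_trans (ler_normD _ _)); rewrite normrM.
by have := hB w; have := ler_wpM2l (normr_ge0 w) (fB w); lra.
Qed.

Let xi_bound e y x : W (upd e false y) <= x -> x <= W (upd e true y) ->
  `|x - W y| <= del.
Proof.
have /andP[a b] := stein_W_between e y; have := stein_W_upd e y => c x1 x2.
by rewrite ler_norml; lra.
Qed.

Let f_bound e y x : W (upd e false y) <= x -> x <= W (upd e true y) ->
  `|f x - f (W y)| <= del * (B * (1 + 2 * (`|W y| + del))).
Proof.
move=> x1 x2; have /andP[a b] := stein_W_between e y.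
have key (s t : R) : s <= t -> W (upd e false y) <= s -> t <= W (upd e true y) ->
    `|f t - f s| <= del * (B * (1 + 2 * (`|W y| + del))).
  move=> st s1 t1; have [z /andP[z1 z2] ->] := is_derive_mvt fE st.
  rewrite normrM mulrC; apply: ler_pM => //.
    rewrite ger0_norm ?subr_ge0//; have := stein_W_upd e y; lra.
  apply: (le_trans (df_bound z)); rewrite ler_wpM2l//.
  have := @xi_bound e y z (le_trans s1 z1) (le_trans z2 t1).
  have : `|z| <= `|W y| + `|z - W y|.
    by rewrite (le_trans _ (ler_normD _ _))// addrC subrK.
  by lra.
have [xW|xW] := leP x (W y); first by rewrite distrC key.
by rewrite key// ltW.
Qed.

(** The increment of f is [del] times f' at an intermediate point x, and the Stein equation
    expresses f'(x) - f'(W y) through f and h. No second derivative of f occurs, so h need not be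
    differentiable. *)
Let Dh e y : `|f (W (upd e true y)) - f (W (upd e false y)) - del * df (W y)| <=
  del * (B * del * (3 + 2 * del) * (1 + W y ^+ 2) + hv e y).
Proof.
have W01 : W (upd e false y) <= W (upd e true y) by rewrite stein_W_upd lerDl ltW.
have [x /andP[x1 x2] ->] := is_derive_mvt fE W01.
rewrite [W (upd e true y)]stein_W_upd [_ + del - _]addrAC subrr add0r.
rewrite mulrC -mulrBr normrM (gtr0_norm del0) ler_pM2l//.
rewrite -/(df x) (_ : df x - df (W y) =
  (x - W y) * f x + W y * (f x - f (W y)) + (h x - h (W y))); last first.
  by rewrite /df; ring.
apply: (le_trans (ler_normD _ _)); apply: lerD; last exact: hvP x1 x2.
apply: (le_trans (ler_normD _ _)).
rewrite (normrM (x - W y)) (normrM (W y)).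
have h1 := ler_pM (normr_ge0 _) (normr_ge0 _) (xi_bound x1 x2) (fB x).
have h2 := ler_wpM2l (normr_ge0 (W y)) (f_bound x1 x2).
have w2 : `|W y| ^+ 2 = W y ^+ 2 by rewrite real_normK ?num_real.
have gen (w d : R) : 0 <= w -> 0 <= d ->
    1 + (1 + 2 * d) * w + 2 * w ^+ 2 <= (3 + 2 * d) * (1 + w ^+ 2).
  move=> w0 d0; have k1 := sqr_ge0 (w - 1); have k2 := mulr_ge0 d0 k1.
  have k3 := sqr_ge0 w; have k4 := mulr_ge0 d0 k3.
  by rewrite !expr2 in k1 k2 k3 k4 *; lra.
rewrite -w2; apply: (@le_trans _ _ (B * del *
    (1 + (1 + 2 * del) * `|W y| + 2 * `|W y| ^+ 2))).
  apply: (le_trans (lerD h1 h2)); rewrite le_eqVlt; apply/orP; left; apply/eqP.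
  by ring.
rewrite -[leRHS]mulrA ler_wpM2l ?gen// ?(ltW del0)//.
by rewrite mulr_ge0// ltW.
Qed.

Let Sq y := \sum_e q T e y * (1 - q T e y).

Let step1 : `|mean T (fun y => (edges y - Qsum T y) * f (W y)) -
    del * mean T (fun y => df (W y) * Sq y)| <=
  del * (4^-1 * N * (B * del * (3 + 2 * del)) * (1 + C5) + Ch * sd).
Proof.
rewrite (mean_stein_sum T (f \o W)).
have -> : del * mean T (fun y => df (W y) * Sq y) =
    \sum_e mean T (fun y => q T e y * (1 - q T e y) * (del * df (W y))).
  rewrite -mean_sum -meanZ; apply: eq_mean => y.
  by rewrite /Sq -mulr_suml; ring.
rewrite -sumrB; apply: (le_trans (ler_norm_sum _ _ _)).
set c := B * del * (3 + 2 * del).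
have c0 : 0 <= c.
  by rewrite mulr_ge0 ?mulr_ge0 ?(ltW del0)//; have := del0; lra.
apply: (@le_trans _ _ (\sum_e (del * (4^-1 * c * (1 + C5)) +
   del * mean T (fun y => q T e y * (1 - q T e y) * hv e y)))).
  apply: ler_sum => e _; rewrite -meanB.
  apply: (le_trans (norm_mean _ _)).
  apply: (@le_trans _ _ (mean T (fun y => del * (4^-1 * c * (1 + W y ^+ 2)) +
     del * (q T e y * (1 - q T e y) * hv e y)))).
    apply: ler_mean => y; rewrite -mulrBr normrM.
    have q0 : 0 <= q T e y * (1 - q T e y) := sig_deriv_ge0 _.
    have q4 : q T e y * (1 - q T e y) <= 4^-1 := sig_deriv_le _.
    rewrite ger0_norm//; apply: (le_trans (ler_wpM2l q0 (Dh e y))).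
    rewrite -/c mulrCA -mulrDr ler_pM2l// mulrDr lerD2r -mulrA.
    rewrite ler_wpM2r// mulr_ge0//; have := sqr_ge0 (W y); lra.
  rewrite meanD !meanZ meanD mean_cst lerD2r ler_pM2l// ler_wpM2l//.
    by rewrite mulr_ge0// invr_ge0.
  by rewrite lerD2l mean_W_sqr.
rewrite big_split /= sum_cst -mulr_sumr.
have := ler_wpM2l (ltW del0) hvC; lra.
Qed.

Let Aq y := Sq y / (N * v).

(** As x (1 - x) is 1-Lipschitz on [0, 1], [q_le] bounds the mean square distance of the normalized
    sum of q_e (1 - q_e) to 1. *)
Let step2 : `|mean T (fun y => df (W y) * (1 - Aq y))| <=
  (B * (2 + 4 * C5 + 2)) * (Num.sqrt C * rho / v).
Proof.
apply: mean_CS_le.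
- by rewrite mulr_ge0// addr_ge0// addr_ge0// mulr_ge0.
- by rewrite divr_ge0 ?(ltW v0)// mulr_ge0 ?sqrtr_ge0//; case/andP: rho01 => /ltW.
- apply: (@le_trans _ _ (mean T (fun y => B ^+ 2 * (2 + 8 * W y ^+ 2)))).
    apply: ler_mean => y; rewrite -real_normK ?num_real//.
    apply: (@le_trans _ _ ((B * (1 + 2 * `|W y|)) ^+ 2)).
      by rewrite ler_sqr ?nnegrE ?df_bound// mulr_ge0// addr_ge0// mulr_ge0.
    rewrite exprMn ler_wpM2l ?sqr_ge0//.
    rewrite -[W y ^+ 2]real_normK ?num_real//.
    by have := sqr_ge0 (1 - 2 * `|W y|); rewrite !expr2; lra.
  rewrite meanZ meanD mean_cst meanZ exprMn ler_wpM2l ?sqr_ge0//.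
  have := mean_W_sqr; have := C50; rewrite !expr2; nra.
- rewrite exprMn exprVn exprMn sqr_sqrtr ?(ltW C0)//.
  have AqE y : 1 - Aq y = (N * v)^-1 * \sum_e (v - q T e y * (1 - q T e y)).
    have Nv : N * v != 0 by rewrite gt_eqF// pmulr_rgt0.
    rewrite sumrB sum_cst mulrBr mulVf//.
    by rewrite /Aq mulrC.
  apply: (@le_trans _ _ (mean T (fun y => (N * v ^+ 2)^-1 *
      \sum_e (q T e y - p) ^+ 2))).
    apply: ler_mean => y; rewrite AqE exprMn.
    have hS : (\sum_e (v - q T e y * (1 - q T e y))) ^+ 2 <= N * \sum_e (q T e y - p) ^+ 2.
      apply: (@le_trans _ _ (N * \sum_e (v - q T e y * (1 - q T e y)) ^+ 2)).
        have := @sum_CS _ E (fun=> 1) (fun e => v - q T e y * (1 - q T e y)) (fun=> ler01).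
        under eq_bigr do rewrite mul1r.
        rewrite sum_cst mulr1; under [X in _ <= _ * X]eq_bigr do rewrite mul1r.
        by [].
      rewrite ler_pM2l//; apply: ler_sum => e _.
      have q0 := q_ge0 T e y; have q1 := q_le1 T e y; have /andP[p0 p1] := p01.
      rewrite -real_normK ?num_real// -[leRHS]real_normK ?num_real//.
      rewrite ler_sqr ?nnegrE// distrC.
      have -> : q T e y * (1 - q T e y) - v = (q T e y - p) * (1 - q T e y - p).
        by rewrite /v; ring.
      by rewrite normrM ler_piMr// ler_norml; lra.
    apply: (le_trans (ler_wpM2l (sqr_ge0 _) hS)).
    rewrite le_eqVlt; apply/orP; left; apply/eqP.
    by field; rewrite !gt_eqF.
  rewrite meanZ mean_sum ler_pdivrMl; last by rewrite mulr_gt0 ?exprn_gt0.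
  have -> : N * v ^+ 2 * (C * rho ^+ 2 * v ^- 2) = \sum_(e : E) C * rho ^+ 2.
    by rewrite sum_cst; field; rewrite gt_eqF.
  by apply: ler_sum => e _; exact: q_le.
Qed.

Definition stein_const : R :=
  B * (4 + 4 * C5) * (Num.sqrt C / v) + B * Num.sqrt C * c6 / (1 - lam) +
  (4^-1 * c6 ^+ 2 * B * (3 + 2 * c6) * (1 + C5) + Ch) / (1 - lam).

(** Three errors add up: linearizing the increments of f ([step1]), replacing the sum of q_e (1 -
    q_e) by N p (1 - p) ([step2]), and the residual Q - lam X. The oscillation of h across one edge
    enters only through [hv], averaged against q_e (1 - q_e), so that Lipschitz and steep monotone
    functions share the argument. *)
Lemma stein_bound : 0 <= Ch -> `|mean T (h \o W) - m| <= stein_const * (rho + del).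
Proof.
move=> Ch0.
have /andP[r0 r1] := rho01.
have e1 : mean T (h \o W) - m = mean T (fun y => df (W y)) - mean T (fun y => W y * f (W y)).
  rewrite -[X in _ - X](mean_cst T) -!meanB; apply: eq_mean => y.
  by rewrite /df /=; ring.
have e2 : mean T (fun y => df (W y)) = mean T (fun y => df (W y) * (1 - Aq y)) +
    ((1 - lam) * sd)^-1 * (del * mean T (fun y => df (W y) * Sq y)).
  rewrite -!meanZ -meanD; apply: eq_mean => y.
  rewrite /Aq; have -> : N * v = sd ^+ 2 * (1 - lam).
    by rewrite stein_sd_sqr; field; rewrite gt_eqF.
  by rewrite /del; field; rewrite !gt_eqF.
have e3 : mean T (fun y => W y * f (W y)) = ((1 - lam) * sd)^-1 *
    (mean T (fun y => (edges y - Qsum T y) * f (W y)) +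
     mean T (fun y => (r y - mean T r) * f (W y))).
  rewrite -meanD -meanZ; apply: eq_mean => y.
  by rewrite -mulrDl -decomp; field; rewrite !gt_eqF.
have e4 : `|mean T (fun y => (r y - mean T r) * f (W y))| <=
    (Num.sqrt C * rho * Num.sqrt N) * B.
  apply: mean_CS_le => //.
  - by rewrite !mulr_ge0 ?sqrtr_ge0// ltW.
  - by rewrite -varE !exprMn !sqr_sqrtr ?(ltW C0) ?(ltW N0).
  - apply: mean_le => z; rewrite -real_normK ?num_real//.
    by rewrite ler_sqr ?nnegrE.
have ls0 : 0 < (1 - lam) * sd by rewrite mulr_gt0.
have e5 : mean T (h \o W) - m = mean T (fun y => df (W y) * (1 - Aq y)) -
   ((1 - lam) * sd)^-1 * (mean T (fun y => (edges y - Qsum T y) * f (W y)) -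
     del * mean T (fun y => df (W y) * Sq y)) -
   ((1 - lam) * sd)^-1 * mean T (fun y => (r y - mean T r) * f (W y)).
  by rewrite e1 e2 e3; ring.
rewrite e5; apply: (le_trans (ler_normB _ _)).
apply: (@le_trans _ _ (B * (2 + 4 * C5 + 2) * (Num.sqrt C * rho / v) +
  ((1 - lam) * sd)^-1 * (del * (4^-1 * N * (B * del * (3 + 2 * del)) * (1 + C5) + Ch * sd)) +
  ((1 - lam) * sd)^-1 * (Num.sqrt C * rho * Num.sqrt N * B))).
  apply: lerD; last first.
    by rewrite normrM gtr0_norm ?invr_gt0// ler_pM2l ?invr_gt0.
  apply: (le_trans (ler_normB _ _)); apply: lerD; first exact: step2.
  by rewrite normrM gtr0_norm ?invr_gt0// ler_pM2l ?invr_gt0//; exact: step1.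
have t3 : ((1 - lam) * sd)^-1 * (Num.sqrt C * rho * Num.sqrt N * B) =
    B * Num.sqrt C * c6 / (1 - lam) * rho.
  by rewrite sqrtN_sd; field; rewrite !gt_eqF.
have t2 : ((1 - lam) * sd)^-1 * (del * (4^-1 * N * (B * del * (3 + 2 * del)) * (1 + C5) + Ch * sd)) =
    ((4^-1 * c6 ^+ 2 * B * (3 + 2 * del) * (1 + C5) + Ch) / (1 - lam)) * del.
  rewrite -Ndel /del; field; rewrite !gt_eqF//.
have c4 : 0 <= 4^-1 * c6 ^+ 2 * B by rewrite mulr_ge0// mulr_ge0 ?sqr_ge0// invr_ge0.
have t2' : 4^-1 * c6 ^+ 2 * B * (3 + 2 * del) * (1 + C5) <=
    4^-1 * c6 ^+ 2 * B * (3 + 2 * c6) * (1 + C5).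
  apply: ler_wpM2r; first by apply: addr_ge0.
  by apply: ler_wpM2l => //; have := del_c6; lra.
rewrite t2 t3.
have il0 : 0 <= (1 - lam)^-1 by rewrite invr_ge0 ltW.
set a1 := B * (4 + 4 * C5) * (Num.sqrt C / v).
have a10 : 0 <= a1.
  rewrite mulr_ge0 ?divr_ge0 ?sqrtr_ge0 ?(ltW v0)// mulr_ge0//.
  by have := C50; lra.
set a2 := B * Num.sqrt C * c6 / (1 - lam).
have a20 : 0 <= a2 by rewrite !mulr_ge0 ?sqrtr_ge0.
set a3 := (4^-1 * c6 ^+ 2 * B * (3 + 2 * c6) * (1 + C5) + Ch) / (1 - lam).
have a30 : 0 <= a3.
  have c7 : 0 <= 3 + 2 * c6 by have := c60; lra.
  have c8 : 0 <= 1 + C5 by have := C50; lra.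
  by apply: mulr_ge0 => //; apply: addr_ge0 => //; apply: mulr_ge0 => //; apply: mulr_ge0.
have b3 : (4^-1 * c6 ^+ 2 * B * (3 + 2 * del) * (1 + C5) + Ch) / (1 - lam) * del <= a3 * del.
  by rewrite ler_pM2r// ler_wpM2r// lerD2r.
rewrite /stein_const -/a1 -/a2 -/a3.
have := mulr_ge0 a10 (ltW del0); have := mulr_ge0 a20 (ltW del0).
have := mulr_ge0 a30 (ltW r0).
have -> : B * (2 + 4 * C5 + 2) * (Num.sqrt C * rho / v) = a1 * rho by rewrite /a1; ring.
by lra.
Qed.

End equation.

Lemma stein_bound_lip f h (m B : R) :
  (forall w : R, is_derive w 1 f (w * f w + h w - m)) ->
  (forall w : R, `|f w| <= B) -> (forall w : R, `|h w - m| <= B * (1 + `|w|)) ->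
  (forall x y : R, `|h x - h y| <= `|x - y|) ->
  `|mean T (h \o W) - m| <= stein_const B (4^-1 * c6 ^+ 2) * (rho + sd^-1).
Proof.
move=> fE fB hB hl.
apply: (@stein_bound f h m B (4^-1 * c6 ^+ 2) (fun _ _ => del)) => //.
- move=> e y x x1 x2; apply: (le_trans (hl _ _)).
  have /andP[a b] := stein_W_between e y; have := stein_W_upd e y => c.
  by rewrite ler_norml; lra.
- apply: (@le_trans _ _ (\sum_(e : E) 4^-1 * del)).
    apply: ler_sum => e _; apply: mean_le => y.
    by rewrite ler_pM2r//; exact: sig_deriv_le.
  rewrite sum_cst -Ndel /del le_eqVlt; apply/orP; left; apply/eqP.
  by field; rewrite gt_eqF.
- by rewrite mulr_ge0 ?invr_ge0// sqr_ge0.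
Qed.

(** A steep h can drop by nearly 1 across one edge, so its increments are small only on average:
    weighted by q_e (1 - q_e) they sum to - E (X - Q) h(W), at most E |X - Q| = O(sd). *)
Lemma stein_bound_mono f h (m B : R) :
  (forall w : R, is_derive w 1 f (w * f w + h w - m)) ->
  (forall w : R, `|f w| <= B) -> (forall w : R, `|h w - m| <= B * (1 + `|w|)) ->
  (forall x y : R, x <= y -> h y <= h x) -> (forall x, 0 <= h x <= 1) ->
  `|mean T (h \o W) - m| <= stein_const B (2 * Num.sqrt C * c6) * (rho + sd^-1).
Proof.
move=> fE fB hB hm h01.
apply: (@stein_bound f h m B _ (fun e y => h (W (upd e false y)) - h (W (upd e true y)))) => //.
- move=> e y x x1 x2.
  have /andP[a b] := stein_W_between e y.
  have := hm _ _ x1; have := hm _ _ x2; have := hm _ _ a; have := hm _ _ b.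
  by rewrite ler_norml; lra.
- have -> : \sum_e mean T (fun y => q T e y * (1 - q T e y) *
      (h (W (upd e false y)) - h (W (upd e true y)))) =
      - mean T (fun y => (edges y - Qsum T y) * h (W y)).
    rewrite (mean_stein_sum T (h \o W)) -sumrN; apply: eq_bigr => e _.
    by rewrite -meanN; apply: eq_mean => y; rewrite /D /=; ring.
  apply: le_trans mean_XQ_norm; rewrite -meanN; apply: ler_mean => y.
  apply: (le_trans (ler_norm _)); rewrite normrN normrM ler_piMr//.
  by have := h01 (W y); rewrite ler_norml; lra.
- by rewrite !mulr_ge0 ?sqrtr_ge0.
Qed.

End stein.

(** * Counting the copies of a graph in the complete graph *)

Lemma card_pairs n : #|{: pairs n}| = 'C(n, 2).
Proof.
rewrite card_sig -sum1_card -(pair_big_dep predT (fun i j : 'I_n => i < j)%N (fun _ _ => 1%N))/=.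
rewrite (exchange_big_dep predT)//= -bin2_sum big_mkord; apply: eq_bigr => j _.
by rewrite -(big_ord_widen n (fun=> 1%N)) ?(ltnW (ltn_ord j))// sum1_card card_ord.
Qed.

(** The i-th factor (n - 2 - i) / n is at least 1 - (i + 2) / n, and the defects of a product of
    numbers in [0, 1] at most add up. *)
Lemma ffact_ratio_bounds (R : realType) n d (x := n%:R : R) : (2 <= n)%N ->
  1 - (d.+1 ^ 2)%:R / x <= ((n - 2) ^_ d)%:R / x ^+ d <= 1.
Proof.
rewrite /x => n2; have n0 : 0 < n%:R :> R by rewrite ltr0n; apply: leq_trans n2.
have r0 i : 0 <= ((n - 2) ^_ i)%:R / n%:R ^+ i :> R by rewrite divr_ge0 ?exprn_ge0.
elim: d => [|d /andP[IH1 IH2]].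
  by rewrite ffactn0 expr0 divr1 lexx gerBl divr_ge0.
have E : ((n - 2) ^_ d.+1)%:R / n%:R ^+ d.+1 =
    ((n - 2) ^_ d)%:R / n%:R ^+ d * ((n - 2 - d)%:R / n%:R) :> R.
  by rewrite ffactnSr natrM exprSr invfM mulrACA.
have ub : (n - 2 - d)%:R / n%:R <= 1 :> R.
  by rewrite ler_pdivrMr// mul1r ler_nat -subnDA leq_subr.
have lb : 1 - d.+2%:R / n%:R <= (n - 2 - d)%:R / n%:R :> R.
  rewrite -[X in X - _](divff (lt0r_neq0 n0)) -mulrBl ler_pM2r ?invr_gt0// lerBlDr -natrD ler_nat.
  by rewrite -subnDA; lia.
have q0 : 0 <= (n - 2 - d)%:R / n%:R :> R by rewrite divr_ge0.
rewrite E; apply/andP; split; last by rewrite mulr_ile1.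
have [t0 td] : 0 <= n%:R^-1 :> R /\ ((d.+2 ^ 2)%:R = (d.+1 ^ 2)%:R + d.+2%:R + d.+1%:R :> R).
  by rewrite invr_ge0 ler0n -!natrD; split=> //; congr _%:R; lia.
have := r0 d; move: IH1 IH2 lb ub q0; rewrite td.
rewrite (mulrDl (_ + _) d.+1%:R) (mulrDl _ d.+2%:R).
have : 0 <= d.+1%:R / n%:R :> R by rewrite divr_ge0.
set r := _ / n%:R ^+ d; set s := (n - 2 - d)%:R / n%:R; set a := (d.+1 ^ 2)%:R / n%:R.
set b := d.+2%:R / n%:R; set c := d.+1%:R / n%:R => hc h1 h2 h3 h4 h5 h6.
have : 0 <= (1 - r) * (1 - s) by rewrite mulr_ge0 ?subr_ge0.
by clearbody r s a b c; nra.
Qed.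

Section copies.
Variables (G : sgraph) (n : nat).
Implicit Types (f : {ffun G -> 'I_n}) (e : pairs n) (y : config n).

(** The edges of the image of [G]. As [sedge] is symmetric, each of them is met in its increasing
    orientation. *)
Definition copy f : {set pairs n} :=
  [set e : pairs n | [exists u, exists v,
     [&& sedge u v, f u == (val e).1 & f v == (val e).2]]]%SET.

Lemma copyP f e : reflect (exists u v, [/\ sedge u v, f u = (val e).1 & f v = (val e).2])
  (e \in copy f).
Proof.
rewrite inE; apply: (iffP existsP) => [[u /existsP[v /and3P[? /eqP ? /eqP ?]]]|[u [v [uv fu fv]]]].
  by exists u, v.
by exists u; apply/existsP; exists v; rewrite uv fu fv !eqxx.
Qed.

Lemma pair_neq e : (val e).1 != (val e).2.
Proof. by case: e => -[a b] /= ab; rewrite neq_ltn ab. Qed.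

Lemma copy_sub_hom f y : injective f ->
  [forall u, forall v, sedge u v ==> config_adj y (f u) (f v)] =
  [forall e in copy f, y e].
Proof.
move=> fI; apply/idP/idP => [h|/forall_inP h].
  apply/forall_inP => e /copyP[u [v [uv fu fv]]].
  have /existsP[e' /andP[ye']] := implyP (forallP (forallP h u) v) uv.
  rewrite fu fv -surjective_pairing => /orP[/eqP/val_inj <-//|/eqP e'E].
  have := valP e'; rewrite e'E /= => h1; have := valP e => /= h2.
  by have := ltn_trans h1 h2; rewrite ltnn.
apply/forallP => u; apply/forallP => v; apply/implyP => uv.
have fuv : f u != f v.
  by apply: contraTneq uv => /fI ->; rewrite sedge_irr.
have [fl|fl|/val_inj/eqP] := ltngtP (f u) (f v); last by rewrite (negbTE fuv).
  pose e : pairs n := Sub (f u, f v) fl.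
  apply/existsP; exists e; rewrite eqxx h//.
  by apply/copyP; exists u, v.
pose e : pairs n := Sub (f v, f u) fl.
apply/existsP; exists e; rewrite eqxx orbT h//.
by apply/copyP; exists v, u; rewrite sedge_sym.
Qed.

Lemma card_copy f : injective f -> #|copy f| = nedges G.
Proof.
move=> fI; pose g e : {set G} := [set u | (f u == (val e).1) || (f u == (val e).2)]%SET.
have gE e u v : f u = (val e).1 -> f v = (val e).2 -> g e = [set u; v]%SET.
  by move=> fu fv; apply/finset.setP => w; rewrite !inE -fu -fv !(inj_eq fI).
rewrite /nedges -(card_in_imset (f := g) (D := copy f)); last first.
  move=> e e' /copyP[u [v [uv fu fv]]] /copyP[u' [v' [uv' fu' fv']]].
  rewrite (gE e u v)// (gE e' u' v')// => E.
  have : u \in [set u'; v']%SET by rewrite -E !inE eqxx.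
  have : v \in [set u'; v']%SET by rewrite -E !inE eqxx orbT.
  have ve := valP e; have ve' := valP e'.
  rewrite !inE => /orP[/eqP vE|/eqP vE] /orP[/eqP uE|/eqP uE].
  - by move: uv; rewrite uE vE sedge_irr.
  - by move: ve ve'; rewrite /= -fu -fv -fu' -fv' uE vE => h1 h2; have := ltn_trans h1 h2; rewrite ltnn.
  - by apply: val_inj; rewrite (surjective_pairing (val e)) (surjective_pairing (val e')) -fu -fv -fu' -fv' uE vE.
  - by move: uv; rewrite uE vE sedge_irr.
apply: eq_card => B; apply/imsetP/idP => [[e /copyP[u [v [uv fu fv]]] ->]|].
  by rewrite inE; apply/existsP; exists u; apply/existsP; exists v; rewrite uv (gE e u v)//=.
rewrite inE => /existsP[u /existsP[v /andP[uv /eqP ->]]].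
have fuv : f u != f v.
  by apply: contraTneq uv => /fI ->; rewrite sedge_irr.
have [fl|fl|/val_inj/eqP] := ltngtP (f u) (f v); last by rewrite (negbTE fuv).
  pose e : pairs n := Sub (f u, f v) fl.
  by exists e; [apply/copyP; exists u, v|rewrite (gE e u v)].
pose e : pairs n := Sub (f v, f u) fl.
exists e; first by apply/copyP; exists v, u; rewrite sedge_sym.
by rewrite (gE e v u)// finset.setUC.
Qed.

Definition ncopies e := #|[set f : {ffun G -> 'I_n} | injectiveb f & e \in copy f]%SET|.

(* Permuting the ['I_n] vertices shows that all pairs are equally often covered. *)
Lemma ncopies_le e e' : (ncopies e <= ncopies e')%N.
Proof.
have [a b ab] : exists2 ab : 'I_n * 'I_n, ab = val e & ab.1 != ab.2 by exists (val e) => //; exact: pair_neq.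
pose a' := (val e').1; pose b' := (val e').2; have ab' : a' != b' := pair_neq e'.
pose s1 := tperm a.1 a'; pose s := (s1 * tperm (s1 a.2) b')%g.
have sa : s a.1 = a'.
  rewrite permM /s1 tpermL tpermD//; last by rewrite eq_sym.
  by rewrite -{2}(tpermL a.1 a') (inj_eq perm_inj) eq_sym.
have sb : s a.2 = b' by rewrite permM tpermL.
pose phi f : {ffun G -> 'I_n} := [ffun u => s (f u)].
have phiI : injective phi.
  by move=> f g /ffunP fg; apply/ffunP => u; have := fg u; rewrite !ffunE => /perm_inj.
rewrite /ncopies -(card_imset _ phiI); apply: subset_leq_card.
apply/fintype.subsetP => _ /imsetP[f + ->]; rewrite inE => /andP[/injectiveP fI /copyP[u [v [uv fu fv]]]].
rewrite inE; apply/andP; split.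
  by apply/injectiveP => w x; rewrite !ffunE => /perm_inj/fI.
by apply/copyP; exists u, v; split => //; rewrite ffunE ?fu ?fv -b.
Qed.

Lemma ncopies_eq e : (ncopies e * #|{: pairs n}| = nedges G * n ^_ #|G|)%N.
Proof.
transitivity (\sum_(e' : pairs n) ncopies e')%N.
  rewrite mulnC -sum_nat_const; apply: eq_bigr => e' _.
  by apply/eqP; rewrite eqn_leq !ncopies_le.
transitivity (\sum_(f : {ffun G -> 'I_n} | injectiveb f) #|copy f|)%N.
  under eq_bigr do rewrite /ncopies -sum1_card.
  rewrite (exchange_big_dep (fun f : {ffun G -> 'I_n} => injectiveb f))/=.
    by apply: eq_bigr => f fI; rewrite -sum1_card; apply: eq_bigl => e'; rewrite inE fI.
  by move=> e' f _; rewrite inE => /andP[].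
rewrite (eq_bigr (fun=> nedges G)); last by move=> f /injectiveP; exact: card_copy.
rewrite sum_nat_const mulnC; congr (_ * _)%N.
by rewrite -[in RHS](card_ord n) -card_inj_ffuns cardsE.
Qed.

Lemma card_agree (S : {set G}) (g : G -> 'I_n) :
  #|[set f : {ffun G -> 'I_n} | [forall u in S, f u == g u]]%SET| = (n ^ (#|G| - #|S|))%N.
Proof.
pose F u : {pred 'I_n} := if u \in S then pred1 (g u) else predT.
transitivity #|family F|.
  apply: eq_card => f; rewrite inE; apply/forall_inP/familyP => [h u|h u uS].
    by rewrite /F; case: ifP => // uS; rewrite inE h.
  by have := h u; rewrite /F uS inE.
rewrite card_family foldrE big_image/=.
rewrite (eq_bigr (fun u => if u \in ~: S then n else 1%N)%SET); last first.
  by move=> u _; rewrite /F inE; case: ifP => _; rewrite ?card1 ?card_ord.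
by rewrite -big_mkcond prod_nat_const finset.cardsCs finset.setCK.
Qed.

(** There are at most |G|^3 choices for the preimages of the three points, and the other |G| - 3
    vertices are free. The factor n on the left restores the exponent |G| - 2 used in the
    Hamiltonian. *)
Lemma hit3_bound (x1 x2 x3 : 'I_n) : x1 != x2 -> x1 != x3 -> x2 != x3 ->
  (#|[set f : {ffun G -> 'I_n} | [&& injectiveb f, x1 \in codom f,
       x2 \in codom f & x3 \in codom f]]%SET| * n <= #|G| ^ 3 * n ^ (#|G| - 2))%N.
Proof.
move=> x12 x13 x23.
pose S (t : G * G * G) := [set t.1.1; t.1.2; t.2]%SET.
pose g (t : G * G * G) u := if u == t.1.1 then x1 else if u == t.1.2 then x2 else x3.
pose good (t : G * G * G) := [set f : {ffun G -> 'I_n} | [forall u in S t, f u == g t u]]%SET.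
pose P (t : G * G * G) := [&& t.1.1 != t.1.2, t.1.1 != t.2 & t.1.2 != t.2].
apply: (@leq_trans (#|\bigcup_(t | P t) good t|%SET * n)).
  rewrite leq_mul2r; apply/orP; right; apply: subset_leq_card.
  apply/fintype.subsetP => f; rewrite inE => /and4P[/injectiveP fI /codomP[u1 E1] /codomP[u2 E2] /codomP[u3 E3]].
  have n12 : u1 != u2 by apply: contraNneq x12 => uu; rewrite E1 E2 uu.
  have n13 : u1 != u3 by apply: contraNneq x13 => uu; rewrite E1 E3 uu.
  have n23 : u2 != u3 by apply: contraNneq x23 => uu; rewrite E2 E3 uu.
  apply/finset.bigcupP; exists (u1, u2, u3); first by rewrite /P /= n12 n13 n23.
  rewrite inE; apply/forall_inP => u; rewrite !inE /= /g /= => /orP[/orP[]|] /eqP ->.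
  - by rewrite eqxx -E1.
  - by rewrite [u2 == u1]eq_sym (negbTE n12) eqxx -E2.
  - by rewrite [u3 == u1]eq_sym (negbTE n13) [u3 == u2]eq_sym (negbTE n23) -E3.
apply: (@leq_trans (\sum_(t | P t) n ^ (#|G| - 2))%N).
  have le1 : (#|\bigcup_(t | P t) good t|%SET <= \sum_(t | P t) #|good t|)%N.
    elim/big_ind2: _ => [|A a B b hA hB|//]; first by rewrite cards0.
    by apply: leq_trans (leq_add hA hB); rewrite cardsU leq_subr.
  apply: leq_trans (leq_mul le1 (leqnn n)) _; rewrite big_distrl/=.
  apply: leq_sum => -[[u1 u2] u3] /and3P[/= n12 n13 n23].
  have c3 : #|S (u1, u2, u3)| = 3%N.
    by rewrite /S /= finset.setUC cardsU1 cards2 !inE negb_or ![u3 == _]eq_sym n13 n23 n12.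
  have le3 : (3 <= #|G|)%N by rewrite -c3 max_card.
  by rewrite card_agree c3 -expnSr -subSn// subSS.
rewrite sum_nat_const leq_mul2r; apply/orP; right.
by apply: leq_trans (max_card _) _; rewrite !card_prod !expnS expn0 muln1 mulnA.
Qed.

(** Two distinct pairs span at least three vertices. This is the source of the O(1/n) influence of
    one edge on another. *)
Lemma copy_pair_bound e e' : e != e' ->
  (#|[set f : {ffun G -> 'I_n} | [&& injectiveb f, e \in copy f & e' \in copy f]]%SET| * n
     <= #|G| ^ 3 * n ^ (#|G| - 2))%N.
Proof.
move=> ee'.
have [w [w1 w2 wc]] : exists w, [/\ w != (val e).1, w != (val e).2 &
    forall f, e' \in copy f -> w \in codom f].
  have c1 f : e' \in copy f -> ((val e').1 \in codom f) && ((val e').2 \in codom f).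
    by move=> /copyP[u [v [_ <- <-]]]; rewrite !codom_f.
  have [h1|] := boolP ((val e').1 \in [:: (val e).1; (val e).2]); last first.
    by rewrite !inE negb_or => /andP[? ?]; exists (val e').1; split => // f /c1/andP[].
  have [h2|] := boolP ((val e').2 \in [:: (val e).1; (val e).2]); last first.
    by rewrite !inE negb_or => /andP[? ?]; exists (val e').2; split => // f /c1/andP[].
  exfalso; move: ee' => /negP; apply; apply/eqP/val_inj.
  rewrite (surjective_pairing (val e)) (surjective_pairing (val e')).
  move: h1 h2; have := valP e; have := valP e'; rewrite !inE /= => v1 v2.
  move=> /orP[/eqP a|/eqP a] /orP[/eqP b|/eqP b].
  - by move: v1; rewrite a b ltnn.
  - by rewrite a b.
  - by move: v1 v2; rewrite a b => p1 p2; have := ltn_trans p1 p2; rewrite ltnn.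
  - by move: v1; rewrite a b ltnn.
have := @hit3_bound (val e).1 (val e).2 w (pair_neq e); rewrite ![_ == w]eq_sym => /(_ w1 w2).
apply: leq_trans; rewrite leq_mul2r; apply/orP; right; apply: subset_leq_card.
apply/fintype.subsetP => f; rewrite inE => /and3P[fI /copyP[u [v [_ <- <-]]] /wc fw].
by rewrite inE fI fw !codom_f.
Qed.

End copies.

Lemma single_edge_card (G : sgraph) : single_edge G -> nverts G = 2%N /\ nedges G = 1%N.
Proof.
move=> [u [v [uv E]]].
have neq : u != v by apply: contraTneq uv => ->; rewrite sedge_irr.
split; first by rewrite /nverts -cardsT E cards2 neq.
rewrite /nedges (_ : edge_set G = [set [set u; v]]%SET) ?cards1//.
apply/finset.setP => B; rewrite !inE; apply/existsP/eqP => [[u' /existsP[v' /andP[uv' /eqP ->]]]|->].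
  have neq' : u' != v' by apply: contraTneq uv' => ->; rewrite sedge_irr.
  have : u' \in [set u; v]%SET by rewrite -E inE.
  have : v' \in [set u; v]%SET by rewrite -E inE.
  rewrite !inE => /orP[/eqP vE|/eqP vE] /orP[/eqP uE|/eqP uE]; move: neq'; rewrite uE vE ?eqxx//.
  by rewrite finset.setUC.
by exists u; apply/existsP; exists v; rewrite uv eqxx.
Qed.

Lemma nverts_ge2 (G : sgraph) : (0 < nedges G)%N -> (2 <= nverts G)%N.
Proof.
rewrite /nedges => /card_gt0P[B]; rewrite inE => /existsP[u /existsP[v /andP[uv _]]].
have neq : u != v by apply: contraTneq uv => ->; rewrite sedge_irr.
by have := max_card (mem [set u; v]%SET); rewrite cards2 neq.
Qed.

(** * The ERGM as a mean-field system *)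

Section copy_system.
Context {R : realType} {k : nat} (H : 'I_k.+1 -> sgraph) (beta : 'I_k.+1 -> R).
Hypothesis H1 : single_edge (H ord0).
Hypothesis Hj : forall j, j != ord0 -> no_isolated (H j) /\ (2 <= nedges (H j))%N.
Hypothesis beta_gt0 : forall j, j != ord0 -> 0 < beta j.

Notation m j := (nedges (H j)).
Notation v j := (nverts (H j)).

Lemma system_nedges_gt0 j : (0 < m j)%N.
Proof.
have [->|/Hj[_ /ltnW]//] := eqVneq j ord0.
by rewrite (single_edge_card H1).2.
Qed.

Lemma system_nverts_ge2 j : (2 <= v j)%N. Proof. by rewrite nverts_ge2// system_nedges_gt0. Qed.

Lemma beta_ge0 j : (1 < m j)%N -> 0 <= beta j.
Proof.
move=> mj; apply/ltW/beta_gt0; apply: contraTneq mj => ->.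
by rewrite (single_edge_card H1).2.
Qed.

Variable n : nat.
Hypothesis n2 : (2 <= n)%N.

Definition maps j : finType := {ffun H j -> 'I_n}.
Definition copy_index : finType := {j : 'I_k.+1 & maps j}.
Notation I := copy_index.

(* The Hamiltonian is a polynomial in the edge indicators with one monomial for
   each map [H j -> 'I_n], the non-injective ones having weight 0. *)
Definition copy_weight (i : I) : R :=
  if injectiveb (tagged i) then beta (tag i) / n%:R ^+ (v (tag i) - 2) else 0.

Definition copy_edges (i : I) : {set pairs n} := copy (tagged i).

Notation b := copy_weight.
Notation A := copy_edges.

Lemma sum_copies (P : forall j, maps j -> bool) (F : I -> R) :
  (\sum_(i : I | P (tag i) (tagged i)) b i * F i =
  \sum_j beta j / n%:R ^+ (v j - 2) * \sum_(f : maps j | injectiveb f && P j f) F (Tagged maps f)).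
Proof.
transitivity (\sum_(i : I | predT (tag i) && P (tag i) (tagged i))
    b (Tagged maps (tagged i)) * F (Tagged maps (tagged i))).
  by apply: eq_bigr => -[j f].
rewrite -(sig_big_dep predT P (fun j f => b (Tagged maps f) * F (Tagged maps f))) /=.
  apply: eq_bigr => j _; rewrite mulr_sumr big_andbC [RHS]big_mkcondr; apply: eq_bigr => f _.
  by rewrite /b /=; case: injectiveb; rewrite ?mul0r.
Qed.

Lemma weight_ham (y : config n) : ergm_weight H beta y = expR (ham b A y).
Proof.
rewrite /ergm_weight /ham /poly; congr expR.
rewrite (sum_copies (fun _ _ => true)); apply: eq_bigr => j _; congr (_ * _).
rewrite /hom_count -sum1_card natr_sum big_mkcond [RHS]big_mkcond/=; apply: eq_bigr => f _.
rewrite inE andbT; case: (boolP (injectiveb f)) => //= /injectiveP fI.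
by rewrite copy_sub_hom// mon_bool; case: ifP.
Qed.

Definition fall_ratio j : R := ((n - 2) ^_ (v j - 2))%:R / n%:R ^+ (v j - 2).

Lemma sum_copies_edge (F : nat -> R) e :
  \sum_(i : I | e \in A i) b i * F #|A i| =
  \sum_j beta j * (2 * (m j)%:R) * fall_ratio j * F (m j).
Proof.
rewrite (sum_copies (fun j (f : maps j) => e \in copy f)); apply: eq_bigr => j _.
rewrite (eq_bigr (fun=> F (m j))); last first.
  by move=> f /andP[/injectiveP fI _]; rewrite /A /= card_copy.
rewrite sumr_const -[F _ *+ _]mulr_natl.
(* The count is m_j n^_(v_j) divided by the number of pairs; multiplying by n (n - 1) keeps the
   computation in the natural numbers. *)
have -> : #|[pred f : {ffun H j -> 'I_n} | injectiveb f && (e \in copy f)]| = (2 * m j * (n - 2) ^_ (v j - 2))%N.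
  have := ncopies_eq (H j) e; rewrite card_pairs /ncopies cardsE => E.
  have n0 : (0 < n * n.-1)%N by rewrite muln_gt0; case: n n2 => [|[]].
  apply/eqP; rewrite -(eqn_pmul2r n0); apply/eqP.
  have vE : n ^_ #|H j| = (n * n.-1 * (n - 2) ^_ (v j - 2))%N.
    rewrite -[#|H j|]/(v j) -[in LHS](subnK (system_nverts_ge2 j)) addn2 !ffactnS mulnA.
    by rewrite -[n.-2]subn2.
  have bE : (n * n.-1 = 'C(n, 2) * 2)%N by have := bin_ffact n 2; rewrite !ffactnS ffactn0 muln1 /= => <-.
  by rewrite {1}bE mulnA E vE; lia.
rewrite /fall_ratio !natrM; set x := n%:R ^+ _; set y := (_ ^_ _)%:R.
by ring.
Qed.

Lemma fall_ratio_bounds j : 1 - (v j ^ 2)%:R / n%:R <= fall_ratio j <= 1.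
Proof.
have /andP[h1 ->] := @ffact_ratio_bounds R n (v j - 2) n2; rewrite andbT.
apply: le_trans h1; rewrite lerD2l lerN2 ler_pM2r ?invr_gt0 ?ltr0n ?(leq_trans _ n2)//.
by rewrite ler_nat leq_sqr; have := system_nverts_ge2 j; lia.
Qed.

Lemma fall_ratio_ge0 j : 0 <= fall_ratio j.
Proof. by rewrite divr_ge0 ?exprn_ge0. Qed.

Definition field z : R := 2 * Phi H beta z.
(* When [nedges (H j) = 1] the truncated exponent is harmless, as it comes with
   the factor [0]. *)
Definition field' z : R :=
  \sum_j beta j * (2 * (m j)%:R) * ((m j - 1)%:R * z ^+ (m j - 2)).

(** One constant for all uses: v^3 comes from the pair counts, m^3 from the second moment of the
    number of edges and from the Lipschitz constant of the field, the 2 from the two orientations of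
    an edge. *)
Definition field_const : R := 1 + \sum_j `|beta j| * (2 * (m j ^ 3 * v j ^ 3)%:R).

Lemma fieldE z : field z = \sum_j beta j * (2 * (m j)%:R) * z ^+ (m j - 1).
Proof.
by rewrite /field /Phi mulr_sumr; apply: eq_bigr => j _; rewrite !mulrA (mulrC 2).
Qed.

Lemma field_const_ge1 : 1 <= field_const.
Proof. by rewrite lerDl sumr_ge0// => j _; rewrite mulr_ge0. Qed.

Lemma le_field_const (c : 'I_k.+1 -> R) :
  (forall j, c j <= `|beta j| * (2 * (m j ^ 3 * v j ^ 3)%:R)) ->
  \sum_j c j <= field_const.
Proof. by move=> h; rewrite ler_wpDl// ler_sum. Qed.

Lemma sum_copies_edge_approx (F : nat -> R) e :
  (forall j, 0 <= F (m j) <= (m j)%:R) ->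
  `|\sum_(i : I | e \in A i) b i * F #|A i| -
    \sum_j beta j * (2 * (m j)%:R) * F (m j)| <= field_const / n%:R.
Proof.
move=> F01; have n0 : 0 < n%:R :> R by rewrite ltr0n (leq_trans _ n2).
rewrite sum_copies_edge -sumrB; apply: le_trans (ler_norm_sum _ _ _) _.
rewrite ler_pdivlMr// mulr_suml; apply: le_field_const => j.
have -> : beta j * (2 * (m j)%:R) * fall_ratio j * F (m j) - beta j * (2 * (m j)%:R) * F (m j)
  = beta j * ((2 * (m j)%:R) * (fall_ratio j - 1) * F (m j)) by ring.
rewrite normrM -(mulrA `|beta j|) ler_wpM2l// normrM (ger0_norm (andP (F01 j)).1) normrM.
rewrite [`|2 * _|]ger0_norm ?mulr_ge0//.
have /andP[f1 f2] := fall_ratio_bounds j; have /andP[g1 g2] := F01 j.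
rewrite distrC [`|1 - _|]ger0_norm ?subr_ge0//.
have key : (1 - fall_ratio j) * n%:R <= (v j ^ 2)%:R by rewrite -ler_pdivlMr// lerBlDl -lerBlDr.
have -> : 2 * (m j)%:R * (1 - fall_ratio j) * F (m j) * n%:R =
  2 * ((m j)%:R * F (m j) * ((1 - fall_ratio j) * n%:R)) by ring.
rewrite ler_wpM2l// natrM ler_pM ?mulr_ge0 ?subr_ge0//.
  apply: (@le_trans _ _ ((m j)%:R * (m j)%:R)); first by rewrite ler_wpM2l.
  by rewrite -natrM ler_nat mulnn leq_pexp2l ?system_nedges_gt0.
by apply: le_trans key _; rewrite ler_nat leq_pexp2l// (leq_trans _ (system_nverts_ge2 j)).
Qed.

Lemma copies_mean_field : mean_field b A field_const n%:R field field'.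
Proof.
have n0 : 0 < n%:R :> R by rewrite ltr0n (leq_trans _ n2).
have zX (z : R) d : 0 <= z <= 1 -> 0 <= z ^+ d <= 1.
  by move=> /andP[z0 z1]; rewrite exprn_ge0// exprn_ile1.
split.
- move=> i; rewrite /b /A; case: ifP => // /injectiveP fI.
  by rewrite card_copy// => /beta_ge0 b0; rewrite divr_ge0// exprn_ge0.
- move=> e e' ee'.
  rewrite (sum_copies (fun j (f : maps j) => (e \in copy f) && (e' \in copy f))).
  rewrite ler_pdivlMr// mulr_suml; apply: le_field_const => j.
  rewrite (eq_bigr (fun=> (m j)%:R)); last by move=> f /andP[/injectiveP fI _]; rewrite /A /= card_copy.
  rewrite sumr_const -[_%:R *+ _]mulr_natl.
  set c := #|_|; have cle : (c * n <= v j ^ 3 * n ^ (v j - 2))%N.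
    by have := copy_pair_bound (H j) ee'; rewrite cardsE.
  have x0 : 0 < n%:R ^+ (v j - 2) :> R by rewrite exprn_gt0.
  have cle' : c%:R * n%:R / n%:R ^+ (v j - 2) <= (v j ^ 3)%:R :> R.
    by rewrite ler_pdivrMr// -natrX -!natrM ler_nat.
  have -> : beta j / n%:R ^+ (v j - 2) * (c%:R * (m j)%:R) * n%:R =
    beta j * ((m j)%:R * (c%:R * n%:R / n%:R ^+ (v j - 2))) by ring.
  apply: (@le_trans _ _ (`|beta j| * ((m j)%:R * (c%:R * n%:R / n%:R ^+ (v j - 2))))).
    by rewrite ler_wpM2r ?ler_norm// !mulr_ge0// invr_ge0 ltW.
  rewrite ler_wpM2l//; apply: (@le_trans _ _ ((m j)%:R * (v j ^ 3)%:R)); first by rewrite ler_wpM2l.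
  rewrite -natrM -[leRHS]natrM ler_nat mulnA leq_mul2r; apply/orP; right.
  by apply: (@leq_trans (m j ^ 3)); rewrite ?leq_pmull// -{1}(expn1 (m j)) leq_pexp2l ?system_nedges_gt0.
- move=> e; rewrite (sum_copies_edge (fun a => (a.-1 * a)%:R)); apply: le_field_const => j.
  have /andP[_ f2] := fall_ratio_bounds j; have f0 := fall_ratio_ge0 j.
  have -> : beta j * (2 * (m j)%:R) * fall_ratio j * ((m j).-1 * m j)%:R =
    beta j * (2 * ((m j)%:R * ((m j).-1 * m j)%:R * fall_ratio j)) by ring.
  apply: (@le_trans _ _ (`|beta j| * (2 * ((m j)%:R * ((m j).-1 * m j)%:R * fall_ratio j)))).
    by rewrite ler_wpM2r ?ler_norm// !mulr_ge0.
  rewrite !ler_wpM2l//; apply: (@le_trans _ _ ((m j)%:R * ((m j).-1 * m j)%:R)).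
    by rewrite ler_piMr.
  rewrite -natrM ler_nat; apply: (@leq_trans (m j ^ 3)).
    by rewrite !expnS expn0 muln1 leq_mul2l leq_mul2r leq_pred !orbT.
  by rewrite leq_pmulr// expn_gt0 (leq_trans _ (system_nverts_ge2 j)).
- move=> e z z01; rewrite fieldE.
  apply: (sum_copies_edge_approx (F := fun a => z ^+ (a - 1))) => j.
  have /andP[-> h] := zX z (m j - 1)%N z01; apply: le_trans h _.
  by rewrite ler1n system_nedges_gt0.
- move=> e z z01; under eq_bigr do rewrite -mulrA.
  apply: (sum_copies_edge_approx (F := fun a => (a - 1)%:R * z ^+ (a - 2))) => j.
  have /andP[h0 h] := zX z (m j - 2)%N z01; rewrite mulr_ge0//=.
  apply: (@le_trans _ _ (m j - 1)%:R); first by rewrite ler_piMr.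
  by rewrite ler_nat leq_subr.
Qed.

(** Monomials and [fall_ratio] are at most 1, so there is no O(1/n) error and Dobrushin's condition
    applies for every n. *)
Lemma copies_dS e y : dS b A e y <= field' 1.
Proof.
rewrite /dS /poly -(pair_big_dep (fun i => e \in A i) (fun i e' => e' \in A i :\ e)%SET
  (fun i e' => b i * mon (A i :\ e' :\ e)%SET y)) /=.
apply: (@le_trans _ _ (\sum_(i | e \in A i) b i * (#|A i| - 1)%:R)).
  apply: ler_sum => i ei.
  (* A copy with a single edge contributes nothing, whatever the sign of its weight. *)
  have [A1|A1] := leqP #|A i| 1.
    have A0 : (#|A i| - 1)%N = 0%N by apply/eqP; rewrite subn_eq0.
    have := cardD1_in ei; rewrite A0 => /cards0_eq Ae.
    rewrite mulr0 big_pred0; first exact: lexx.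
    by move=> e'; rewrite Ae finset.in_set0.
  have b0 := mf_ge0 copies_mean_field A1.
  rewrite -mulr_sumr ler_wpM2l// -(cardD1_in ei) -sum1_card natr_sum.
  by apply: ler_sum => e' _; exact: mon_le1.
rewrite (sum_copies_edge (fun a => (a - 1)%:R)) /field'; apply: ler_sum => j _.
rewrite expr1n mulr1.
have [mj|mj] := leqP (m j) 1.
  by rewrite (_ : m j - 1 = 0)%N ?mulr0//; apply/eqP; rewrite subn_eq0.
have /andP[_ f2] := fall_ratio_bounds j.
by rewrite ler_wpM2r// ler_piMr// !mulr_ge0// beta_ge0.
Qed.

End copy_system.

(** * Gaussian tails and the Stein equation *)

Section normal.
Context {R : realType}.
Notation mu := (@lebesgue_measure R).
Implicit Types (t w x : R).

Definition npdf : R -> R := normal_pdf 0 1.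
Let c0 : R := normal_peak 1.

Let c00 : 0 < c0. Proof. exact: normal_peak_gt0. Qed.

Lemma npdfE x : npdf x = c0 * expR (- (x ^+ 2 / 2)).
Proof.
rewrite /npdf normal_pdfE// /normal_fun subr0 expr1n.
by congr (_ * expR _); rewrite mulNr -[in LHS]natr1; congr (- (_ / _)).
Qed.

Lemma npdf_gt0 x : 0 < npdf x.
Proof. by rewrite npdfE mulr_gt0// expR_gt0. Qed.

Lemma npdfN x : npdf (- x) = npdf x.
Proof. by rewrite !npdfE sqrrN. Qed.

Lemma npdf_le_peak x : npdf x <= normal_peak 1.
Proof. exact: normal_pdf_ub. Qed.

Lemma npdf_anti x y : 0 <= x -> x <= y -> npdf y <= npdf x.
Proof.
move=> x0 xy; rewrite !npdfE ler_pM2l// ler_expR lerN2 ler_pM2r// lerXn2r ?nnegrE//.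
exact: le_trans xy.
Qed.

Lemma is_derive_npdf x : is_derive x 1 npdf (- (x * npdf x)).
Proof.
rewrite (_ : npdf = fun x => c0 * expR (- (x ^+ 2 / 2))); last first.
  by apply/funext => z; rewrite npdfE.
have h1 : is_derive x 1 (fun x => - (x ^+ 2 / 2)) (- x).
  have h := is_deriveM (is_derive_id x 1) (is_derive_id x 1).
  have := is_deriveN (is_deriveZ (2^-1) h).
  rewrite (_ : (- (2^-1 *: _)) = (fun x => - (x ^+ 2 / 2))); last first.
    by apply/funext => z; rewrite expr2; congr (- _); exact: mulrC.
  by move=> {}h; apply: is_derive_eq h _; rewrite /GRing.scale /=; field.
have h2 := is_deriveZ c0 (is_derive1_comp (is_derive_expR _) h1).
rewrite (_ : (fun x => _) = (c0 *: (expR \o (fun x => - (x ^+ 2 / 2))) : R -> R)); last by [].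
by apply: is_derive_eq h2 _; rewrite /GRing.scale /=; ring.
Qed.

Lemma continuous_npdf : continuous npdf.
Proof. by apply: continuous_normal_pdf. Qed.

Lemma npdf_cvgy : npdf x @[x --> +oo] --> (0 : R).
Proof.
apply/cvgrPdist_le => e e0; near=> x.
rewrite sub0r normrN gtr0_norm ?npdf_gt0// npdfE.
have x2 : 2 <= x by near: x; apply: nbhs_pinfty_ge; exact: num_real.
have xe : c0 / e <= x by near: x; apply: nbhs_pinfty_ge; exact: num_real.
have h : x <= x ^+ 2 / 2 by rewrite expr2; nra.
rewrite expRN ler_pdivrMr ?expR_gt0//.
have h2 := expR_ge1Dx (x ^+ 2 / 2).
rewrite ler_pdivrMr// in xe.
apply: (le_trans xe); rewrite mulrC ler_pM2l//; lra.
Unshelve. all: by end_near. Qed.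

Lemma integral_tail_id w : 0 <= w ->
  (\int[mu]_(t in `[w, +oo[) (t * npdf t)%:E = (npdf w)%:E)%E.
Proof.
move=> w0.
have dN x : is_derive x 1 (- npdf) (x * npdf x).
  by have := is_deriveN (is_derive_npdf x); rewrite opprK.
rewrite (@ge0_continuous_FTC2y _ (fun t => t * npdf t) (- npdf) w 0).
- by rewrite -EFinB sub0r; congr EFin; exact: opprK.
- by move=> x wx; rewrite mulr_ge0// ?(le_trans w0 wx)// ltW// npdf_gt0.
- apply: continuous_subspaceT => x; apply: cvgM; first exact: cvg_id.
  exact: continuous_npdf.
- rewrite -oppr0; apply: cvgN; exact: npdf_cvgy.
- by move=> x _; have [] := dN x.
- apply: cvg_at_right_filter; apply: cvgN; exact: continuous_npdf.
- move=> x _; rewrite derive1E; by have [_ ->] := dN x.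
Qed.

Definition tail_const : R := 2 + (npdf 1)^-1.

Lemma tail_const_gt0 : 0 < tail_const.
Proof. by rewrite addr_gt0// invr_gt0 npdf_gt0. Qed.

Let mnpdf (D : set R) : measurable_fun D npdf.
Proof. by apply: measurable_funTS; apply: continuous_measurable_fun; exact: continuous_npdf. Qed.

(** For w >= 1 the density is below t times the density, whose tail integral is exactly [npdf w].
    For w < 1 the whole mass 1 is at most [npdf w] divided by [npdf 1]. *)
Lemma integral_tail w : 0 <= w ->
  (\int[mu]_(t in `[w, +oo[) ((1 + `|t|) * npdf t)%:E <= (tail_const * npdf w)%:E)%E.
Proof.
move=> w0.
have -> : (\int[mu]_(t in `[w, +oo[) ((1 + `|t|) * npdf t)%:E =
    \int[mu]_(t in `[w, +oo[) ((npdf t)%:E + (t * npdf t)%:E))%E.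
  apply: eq_integral => t; rewrite inE /= in_itv /= andbT => wt.
  by rewrite -EFinD ger0_norm ?(le_trans w0 wt)//; congr EFin; ring.
have t0 t : `[w, +oo[%classic t -> 0 <= t.
  by rewrite /= in_itv /= andbT; exact: le_trans.
have mid : measurable_fun (`[w, +oo[%classic : set R) (fun t => t * npdf t).
  by apply: measurable_funM.
rewrite ge0_integralD//=; last 4 first.
- by move=> t _; rewrite lee_fin ltW// npdf_gt0.
- by apply/measurable_EFinP; exact: mnpdf.
- move=> t; rewrite in_itv /= andbT => /(le_trans w0) h;  by rewrite lee_fin mulr_ge0// ltW// npdf_gt0.
- exact/measurable_EFinP.
rewrite integral_tail_id//.
have tot : (\int[mu]_(t in `[w, +oo[) (npdf t)%:E <= 1)%E.
  rewrite -(@integral_normal_pdf R 0 1); apply: ge0_subset_integral => //=.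
    by apply/measurable_EFinP; exact: mnpdf.
  by move=> t _; rewrite lee_fin ltW// npdf_gt0.
have [w1|w1] := leP 1 w.
  apply: (@le_trans _ _ (\int[mu]_(t in `[w, +oo[) (t * npdf t)%:E + (npdf w)%:E)%E).
    apply: leeD => //; apply: ge0_le_integral => //=.
    - by move=> t _; rewrite lee_fin ltW// npdf_gt0.
    - by apply/measurable_EFinP; exact: mnpdf.
    - exact/measurable_EFinP.
    - move=> t; rewrite in_itv /= andbT => wt; rewrite lee_fin ler_peMl ?(ltW (npdf_gt0 _))//.
      exact: le_trans wt.
  rewrite integral_tail_id// -EFinD lee_fin.
  rewrite -[npdf w in leLHS]mul1r -mulrDl ler_pM2r ?npdf_gt0// /tail_const.
  by have : 0 < (npdf 1)^-1 by [rewrite invr_gt0 npdf_gt0]; lra.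
apply: (@le_trans _ _ (1 + (npdf w)%:E)%E); first exact: leeD.
rewrite -EFinD lee_fin /tail_const.
have h : 1 <= (npdf 1)^-1 * npdf w.
  by rewrite ler_pdivlMl ?npdf_gt0// mulr1 npdf_anti// ltW.
by have := npdf_gt0 w; lra.
Qed.

Lemma integral_tailN w : w <= 0 ->
  (\int[mu]_(t in `]-oo, w]) ((1 + `|t|) * npdf t)%:E <= (tail_const * npdf w)%:E)%E.
Proof.
move=> w0; rewrite -[w]opprK ge0_integration_by_substitutionNy.
- have -> : (\int[mu]_(t in `[(- w)%R, +oo[) (((fun t => (1 + `|t|) * npdf t) \o -%R)%FUN t)%:E =
      \int[mu]_(t in `[(- w)%R, +oo[) ((1 + `|t|) * npdf t)%:E)%E.
    by apply: eq_integral => t _; rewrite /= normrN npdfN.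
  by rewrite opprK -[npdf w]npdfN; apply: integral_tail; rewrite oppr_ge0.
- apply: continuous_subspaceT => x; apply: cvgM; last exact: continuous_npdf.
  apply: cvgD; [exact: cvg_cst|apply: cvg_norm; exact: cvg_id].
- by move=> x _; rewrite mulr_ge0 ?addr_ge0// ltW// npdf_gt0.
Qed.

Lemma integrable_npdf_abs : mu.-integrable setT (fun t => ((1 + `|t|) * npdf t)%:E).
Proof.
have mf : measurable_fun [set: R] (fun t => (1 + `|t|) * npdf t).
  apply: measurable_funM; last exact: mnpdf.
  by apply: measurable_funD => //; exact: measurableT_comp.
apply/integrableP; split; first exact/measurable_EFinP.
under eq_integral do rewrite gee0_abs ?lee_fin ?mulr_ge0 ?addr_ge0 ?(ltW (npdf_gt0 _))//.
rewrite -(setUv (`]-oo, (0:R)]%classic : set R)) ge0_integral_setU//=; last 4 first.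
- by apply: measurableC.
- by rewrite setUv; exact/measurable_EFinP.
- by move=> t _; rewrite lee_fin mulr_ge0 ?addr_ge0// ltW// npdf_gt0.
- by apply/disj_setPS => t [].
apply: lte_add_pinfty.
  by apply: (le_lt_trans (integral_tailN (lexx _))); rewrite ltry.
have := le_lt_trans (integral_tail (lexx (0:R))) (ltry _).
apply: le_lt_trans; apply: ge0_subset_integral => //=.
- by apply: measurableC.
- by apply/measurable_EFinP; exact: measurable_funTS mf.
- by move=> t _; rewrite lee_fin mulr_ge0 ?addr_ge0// ltW// npdf_gt0.
- by move=> t /=; rewrite !in_itv /= andbT => /negP; rewrite -ltNge => /ltW.
Qed.

Section stein_solution.
Variables (h : R -> R) (m B : R).
Hypothesis ch : continuous h.
Hypothesis hB : forall w, `|h w - m| <= B * (1 + `|w|).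
Hypothesis hm : (\int[mu]_t ((h t - m) * npdf t) = 0)%R.

Let g t := (h t - m) * npdf t.

Let B0 : 0 <= B.
Proof. by have := le_trans (normr_ge0 _) (hB 0); rewrite normr0 addr0 mulr1. Qed.

Let cg : continuous g.
Proof.
move=> x; apply: cvgM; last exact: continuous_npdf.
apply: cvgB; [exact: ch|exact: cvg_cst].
Qed.

Let g_le t : `|g t| <= B * ((1 + `|t|) * npdf t).
Proof.
by rewrite normrM (gtr0_norm (npdf_gt0 _)) mulrA ler_pM2r ?npdf_gt0.
Qed.

Let igT : mu.-integrable setT (EFin \o g).
Proof.
have iB : mu.-integrable setT (fun t => B%:E * ((1 + `|t|) * npdf t)%:E)%E.
  by apply: integrableZl => //; exact: integrable_npdf_abs.
apply: le_integrable iB => //.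
- by apply/measurable_EFinP; exact: continuous_measurable_fun.
- move=> t _ /=; rewrite ?lee_fin [leRHS]ger0_norm ?g_le//.
  by rewrite mulr_ge0// mulr_ge0 ?addr_ge0// ltW// npdf_gt0.
Qed.

Let ig (D : set R) : measurable D -> mu.-integrable D (EFin \o g).
Proof. by move=> mD; exact: integrableS igT. Qed.

Let F w := (\int[mu]_(t in `]-oo, w]) g t)%R.

Let F_tail (D : set R) (C : R) : measurable D ->
  (\int[mu]_(t in D) ((1 + `|t|) * npdf t)%:E <= C%:E)%E ->
  `|(\int[mu]_(t in D) g t)%R| <= B * C.
Proof.
move=> mD hD; rewrite -lee_fin EFin_normr_Rintegral//; last exact: ig.
have mg := measurable_int mu (ig mD).
have mk : measurable_fun D (fun t => (1 + `|t|) * npdf t).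
  apply: measurable_funM; last exact: mnpdf.
  by apply: measurable_funD => //; exact: measurableT_comp.
apply: (@le_trans _ _ (\int[mu]_(t in D) `|(g t)%:E|)%E).
  exact: le_abse_integral.
apply: (@le_trans _ _ (\int[mu]_(t in D) (B%:E * ((1 + `|t|) * npdf t)%:E))%E).
  apply: ge0_le_integral => //=.
  - apply/measurable_EFinP; apply: measurableT_comp => //; apply: measurable_funTS; exact: continuous_measurable_fun.
  - by apply: emeasurable_funM => //; exact/measurable_EFinP.
  - by move=> t _; rewrite lee_fin g_le.
rewrite ge0_integralZl//=.
- by rewrite EFinM lee_wpmul2l.
- exact/measurable_EFinP.
- by move=> t _; rewrite lee_fin mulr_ge0 ?addr_ge0// ltW// npdf_gt0.
Qed.

(** As [hm] makes the total integral vanish, F is up to sign the integral over either side of w; the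
    side away from 0 is a tail comparable to [npdf w]. *)
Let F_bound w : `|F w| <= B * (tail_const * npdf w).
Proof.
have [w0|w0] := leP w 0; first by apply: F_tail => //; exact: integral_tailN.
have -> : F w = - (\int[mu]_(t in `]w, +oo[) g t)%R.
  apply/eqP; rewrite -addr_eq0 -Rintegral_setU//.
  - rewrite (_ : _ `|` _ = setT) ?hm//.
    apply/seteqP; split => // t _ /=; rewrite !in_itv /= andbT.
    by case: (leP t w) => _; [left|right].
  - by apply: ig; exact: measurableU.
  - apply/disj_setPS => t [] /=; rewrite !in_itv /= andbT => a b.
    by have := lt_le_trans b a; rewrite ltxx.
rewrite normrN; apply: F_tail => //.
apply: le_trans (integral_tail (ltW w0)); apply: ge0_subset_integral => //=.
- by apply: measurable_int; apply: integrableS integrable_npdf_abs.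
- by move=> t _; rewrite lee_fin mulr_ge0 ?addr_ge0// ltW// npdf_gt0.
- by apply: subset_itvr; rewrite bnd_simp.
Qed.

(** Variation of constants: f npdf has derivative (h - m) npdf, so f is its primitive from -oo
    divided by the density. *)
Lemma stein_solution : exists2 f : R -> R,
  (forall w, is_derive w 1 f (w * f w + h w - m)) & (forall w, `|f w| <= tail_const * B).
Proof.
exists (fun w => F w * (npdf w)^-1); last first.
  move=> w; rewrite normrM normfV (gtr0_norm (npdf_gt0 w)) ler_pdivrMr ?npdf_gt0//.
  by have := F_bound w; lra.
move=> w.
have dF : is_derive w 1 F (g w).
  have w1 : w < w + 1 by rewrite ltrDl.
  have [||d1 d2] := @continuous_FTC1 R g -oo%O w (w + 1) w1 (ig (measurable_itv _)).
  - exact: ltNyr.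
  - exact: cg.
  by split; [exact: d1|rewrite -derive1E].
have n0 : npdf w != 0 by rewrite gt_eqF// npdf_gt0.
have := is_deriveM dF (is_deriveV n0 (is_derive_npdf w)).
move=> H; apply: is_derive_eq H _.
by rewrite /GRing.scale /= /g; field.
Qed.

End stein_solution.

End normal.

(** * Wasserstein test functions are 1-Lipschitz *)

Section absolute_continuity.
Context {R : realType}.
Notation mu := (@lebesgue_measure R).
Implicit Types (psi : R -> R).

Lemma is_derive_linear_approx psi (s l eps : R) : 0 < eps -> is_derive s 1 psi l ->
  exists2 r : R, 0 < r & forall z, `|z - s| < r ->
    `|psi z - psi s - l * (z - s)| <= eps * `|z - s|.
Proof.
move=> e0 [/cvg_ex[l' hl] dE].
have {dE} ll : l' = l by rewrite -dE; apply/esym/cvg_lim.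
have : (fun h : R => h^-1 *: (psi (h + s) - psi s)) @ 0^' --> l.
  move: hl; rewrite ll (_ : (fun h => _) = (fun h : R => h^-1 *: (psi (h + s) - psi s)))//.
  by apply/funext => h; rewrite /= [h *: 1]mulr1.
move=> /cvgrPdist_lt /(_ _ e0) [r /= r0 hr].
exists r => // z zr; have [->|zs] := eqVneq z s.
  by rewrite !subrr mulr0 subr0 normr0 mulr0.
have zs0 : z - s != 0 by rewrite subr_eq0.
have := hr (z - s); rewrite /= sub0r normrN => /(_ zr zs0).
rewrite subrK => h.
have -> : psi z - psi s - l * (z - s) = - ((l - (z - s)^-1 *: (psi z - psi s)) * (z - s)).
  by rewrite /GRing.scale /=; field.
by rewrite normrN normrM ler_wpM2r// ltW.
Qed.

Lemma derivable_local_lip psi (s eps : R) : 0 < eps -> derivable psi s 1 ->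
  `|derive1 psi s| <= 1 ->
  exists2 r : R, 0 < r & forall z, `|z - s| < r ->
    `|psi z - psi s| <= (1 + eps) * `|z - s|.
Proof.
rewrite derive1E => e0 /derivableP ds D1.
have [r r0 hr] := is_derive_linear_approx e0 ds; exists r => // z /hr h.
rewrite -[psi z - psi s](subrK ('D_1 psi s * (z - s))) mulrDl mul1r addrC.
by apply: le_trans (ler_normD _ _) _; rewrite lerD// normrM ler_piMl.
Qed.

(* The Lipschitz bound is propagated from [a] to [b] by continuous induction; the
   exceptional points lie in an open [U] of small measure, where absolute
   continuity takes over. *)
Section chain.
Variables (psi : R -> R) (a b eps : R) (U : set R).
Hypotheses (ab : a <= b) (e0 : 0 < eps) (oU : open U).
Hypothesis psiU : forall x, ~ U x -> derivable psi x 1 /\ `|derive1 psi x| <= 1.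

Let mU : measurable U. Proof. exact: open_measurable. Qed.

(** The invariant of the continuous induction: the excess over the Lipschitz bound is a variation
    over disjoint intervals whose length is paid for by the measure of [U]. Half-open intervals make
    this measure additive. *)
Let P c := exists m (x y : 'I_m -> R),
  [/\ forall i, [/\ a <= x i, x i <= y i & y i <= c],
      trivIset [set: 'I_m] (fun i => `]x i, y i[%classic),
      ((\sum_i (y i - x i))%:E <= mu (U `&` `[a, c[%classic))%E &
      `|psi c - psi a| <= (1 + eps) * (c - a) + \sum_i `|psi (y i) - psi (x i)|].

Let P_refl : P a.
Proof.
exists 0%N, (fun=> 0), (fun=> 0); split; [by case| by move=> [] | |].
  by rewrite big_ord0.
by rewrite big_ord0 !subrr normr0 mulr0 addr0.
Qed.

Let P_ext c d : a <= c -> c <= d -> P c ->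
  `|psi d - psi c| <= (1 + eps) * (d - c) \/ `]c, d[ `<=` U -> P d.
Proof.
move=> ac cd [m [x [y [h1 h2 h3 h4]]]] [hA|hB].
  exists m, x, y; split => //.
  - by move=> i; have [? ? yc] := h1 i; split => //; exact: le_trans cd.
  - apply: (le_trans h3); apply: le_measure; rewrite ?inE.
    + exact: measurableI.
    + exact: measurableI.
    + by apply: setIS; apply: subset_itvl; rewrite bnd_simp.
  - have := ler_normD (psi d - psi c) (psi c - psi a).
    by rewrite subrKA => /le_trans; apply; lra.
pose x' (i : 'I_m.+1) := if unlift ord_max i is Some j then x j else c.
pose y' (i : 'I_m.+1) := if unlift ord_max i is Some j then y j else d.
have sumE (F : R -> R -> R) : \sum_i F (x' i) (y' i) =
    \sum_i F (x i) (y i) + F c d.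
  rewrite big_ord_recr /=; congr (_ + _); last first.
    by rewrite /x' /y' unlift_none.
  apply: eq_bigr => i _; rewrite /x' /y'.
  have -> : widen_ord (leqnSn m) i = lift ord_max i.
    by apply/val_inj; rewrite /= /bump leqNgt ltn_ord.
  by rewrite liftK.
exists m.+1, x', y'; split.
- move=> i; rewrite /x' /y'; case: unliftP => [j _|_]; last by [].
  by have [? ? yc] := h1 j; split => //; exact: le_trans cd.
- move=> i j _ _ [t []]; rewrite /x' /y' /=.
  case: unliftP => [i1 ->|->]; case: unliftP => [j1 ->|->] //; rewrite !in_itv /=.
  + move=> ti tj; congr lift; apply: h2 => //; exists t; split; by rewrite /= in_itv.
  + move=> /andP[_ t1] /andP[t2 _]; have [_ _ yc] := h1 i1.
    by have := lt_le_trans t1 yc; rewrite ltNge (ltW t2).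
  + move=> /andP[t2 _] /andP[_ t1]; have [_ _ yc] := h1 j1.
    by have := lt_le_trans t1 yc; rewrite ltNge (ltW t2).
- rewrite (sumE (fun u v => v - u)) EFinD.
  have -> : U `&` `[a, d[ = (U `&` `[a, c[) `|` (U `&` `[c, d[).
    rewrite -setIUr; congr (_ `&` _); apply/seteqP; split => t /=; rewrite !in_itv /=.
      by move=> /andP[-> ->]; case: (ltP t c) => _; [left|right].
    move=> [/andP[-> /lt_le_trans -> //]|/andP[ct ->]].
    by rewrite (le_trans ac ct).
  rewrite measureU//; last 3 first.
  - exact: measurableI.
  - exact: measurableI.
  - apply/seteqP; split => // t [] [_ /=] + [_ /=]; rewrite !in_itv /=.
    by move=> /andP[_ t1] /andP[t2 _]; have := lt_le_trans t1 t2; rewrite ltxx.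
  apply: leeD => //.
  have -> : ((d - c)%:E = mu `]c, d[)%E.
    rewrite lebesgue_measure_itv /= lte_fin; move: cd; rewrite le_eqVlt.
    by move=> /orP[/eqP ->|->]; rewrite ?ltxx ?subrr ?EFinB.
  apply: le_measure; rewrite ?inE//; first exact: measurableI.
  move=> t ct; split; first exact: hB.
  by move: ct; rewrite /= !in_itv /= => /andP[/ltW -> ->].
- rewrite (sumE (fun u v => `|psi v - psi u|)).
  have := ler_normD (psi d - psi c) (psi c - psi a).
  rewrite subrKA => /le_trans; apply.
  have : 0 <= (1 + eps) * (d - c) by rewrite mulr_ge0 ?subr_ge0// addr_ge0// ltW.
  by lra.
Qed.

Let local s : exists2 r : R, 0 < r & forall c d, s - r < c -> c <= s -> s <= d ->
  d < s + r -> `|psi d - psi c| <= (1 + eps) * (d - c) \/ `]c, d[ `<=` U.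
Proof.
have [Us|nUs] := pselect (U s).
  have [r /= r0 hr] := oU Us.
  exists r => // c d sc cs sd ds; right => t /=; rewrite in_itv /= => /andP[t1 t2].
  by apply: hr; rewrite /= ltr_norml; lra.
have [ds D1] := psiU nUs.
have [r r0 hr] := derivable_local_lip e0 ds D1.
exists r => // c d sc cs sd dsr; left.
have h1 : `|psi d - psi s| <= (1 + eps) * (d - s).
  have := hr d; rewrite ger0_norm ?subr_ge0// => ->//; lra.
have h2 : `|psi s - psi c| <= (1 + eps) * (s - c).
  have := hr c; rewrite distrC [`|psi c - _|]distrC ger0_norm ?subr_ge0// => ->//; lra.
have := ler_normD (psi d - psi s) (psi s - psi c).
by rewrite subrKA => /le_trans; apply; lra.
Qed.

Lemma chain_end : P b.
Proof.
pose S := [set c | [/\ a <= c, c <= b & P c]].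
have Sa : S a by split.
have hS : has_sup S by split; [exists a|exists b => c []].
pose s := sup S.
have sb : s <= b by apply: ge_sup; [exists a|move=> c []].
have as_ : a <= s by apply: sup_upper_bound.
have [r r0 hr] := local s.
have [c [ac cb Pc] sc] := sup_adherent r0 hS.
have cs : c <= s by apply: sup_upper_bound.
pose d := Num.min b (s + r / 2).
have sd : s <= d by rewrite le_min sb lerDl divr_ge0// ltW.
have dr : d < s + r by rewrite gt_min; apply/orP; right; rewrite ltrD2l; lra.
have Pd : P d by apply: (P_ext ac (le_trans cs sd) Pc); exact: hr.
have db : d <= b by rewrite ge_min lexx.
have ds : d <= s by apply: sup_upper_bound => //; split => //; exact: le_trans sd.
have : d = b.
  move: ds; rewrite /d ge_min => /orP[bs|].
    by apply/eqP; rewrite eq_le db (le_trans bs).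
  by rewrite gerDl; lra.
by move=> <-.
Qed.

End chain.

Lemma abs_continuous_lip psi : abs_continuous psi ->
  {ae mu, forall x, derivable psi x 1 /\ `|derive1 psi x| <= 1} ->
  forall x y, `|psi x - psi y| <= `|x - y|.
Proof.
move=> ac [N [mN muN hN]].
suff H a b : a <= b -> `|psi b - psi a| <= b - a.
  move=> x y; have [xy|xy] := leP x y.
    by rewrite distrC (distrC x) (ger0_norm (_ : 0 <= y - x)) ?subr_ge0// H.
  by rewrite (ger0_norm (_ : 0 <= x - y)) ?subr_ge0 ?H// ltW.
move=> ab; rewrite -[leRHS]addr0; apply/ler_addgt0Pr => e e_gt0; rewrite addr0.
(* Then (1 + eps) (b - a) + eps is at most b - a + e. *)
pose eps := e / (b - a + 2).
have ba2 : 0 < b - a + 2 by lra.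
have eps0 : 0 < eps by rewrite divr_gt0.
have [delta d0 hd] := ac a b eps eps0.
have fN : (mu N < +oo)%E by rewrite muN ltry.
have [U [oU NU muU]] := lebesgue_regularity_outer mN fN d0.
have muUd : (mu U < delta%:E)%E.
  have mU := open_measurable oU.
  have -> : U = (U `\` N) `|` N.
    by rewrite setUC setDUK.
  apply: (@le_lt_trans _ _ (mu (U `\` N) + mu N)%E).
    by apply: measureU2 => //; exact: measurableD.
  by rewrite muN adde0.
have hU x : ~ U x -> derivable psi x 1 /\ `|derive1 psi x| <= 1.
  by move=> nUx; apply: contrapT => h; apply: nUx; apply: NU; apply: hN.
have [m [x [y [h1 h2 h3 h4]]]] := chain_end ab eps0 oU hU.
have := hd m x y h1 h2; rewrite -lte_fin => H.
have {}H : \sum_i `|psi (y i) - psi (x i)| < eps.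
  apply: H; apply: (le_lt_trans h3); apply: (le_lt_trans _ muUd).
  apply: le_measure; rewrite ?inE; [|exact: open_measurable|exact: subIsetl].
  by apply: measurableI => //; exact: open_measurable.
apply: (le_trans h4).
have : eps * (b - a + 2) = e by rewrite /eps divfK// gt_eqF.
by lra.
Qed.

Lemma wass_test_lip psi : wass_test psi -> forall x y, `|psi x - psi y| <= `|x - y|.
Proof.
move=> [ac dpsi L1]; apply: abs_continuous_lip => //.
move: L1; rewrite unlock.
have -> : (0 < mu [set: R])%E.
  by rewrite -set_itvNyy lebesgue_measure_itv /= ltry.
move=> /ess_supP h.
have FF := ae_filter_ringOfSetsType mu.
apply: (@filterS2 _ _ FF _ _ _ _ dpsi h) => x d1 /=.
by rewrite lee_fin.
Qed.

End absolute_continuity.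

(** * Integrals against the normal law and against the law of the edge count *)

Section normal_integral.
Context {R : realType}.
Notation mu := (@lebesgue_measure R).

(** The density [npdf] agrees almost everywhere with the Radon-Nikodym derivative, both having the
    same integral over every measurable set. *)
Lemma ge0_integral_std_normal (f : measurableTypeR R -> \bar R) :
  measurable_fun setT f -> (forall t, 0 <= f t)%E ->
  (\int[std_normal R]_t f t = \int[mu]_t (f t * (npdf t)%:E))%E.
Proof.
move=> mf f0.
have mn : measurable_fun [set: measurableTypeR R] (EFin \o (@npdf R)).
  by apply/measurable_EFinP; exact: measurable_normal_pdf.
have numu := @normal_prob_dominates R 0 1.
rewrite -(Radon_Nikodym_SigmaFinite.change_of_variables numu)//.
have mr := measurable_int _ (Radon_Nikodym_SigmaFinite.f_integrable numu).
apply: ae_eq_integral => //; [exact: emeasurable_funM|exact: emeasurable_funM|].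
apply: ae_eqe_mul2l; apply: integral_ae_eq => //.
  exact: Radon_Nikodym_SigmaFinite.f_integrable numu.
by move=> A _ mA; rewrite -Radon_Nikodym_SigmaFinite.f_integral.
Qed.

Lemma integrable_npdf_growth (f : R -> R) (A : R) : continuous f ->
  (forall t, `|f t| <= A * (1 + `|t|)) ->
  mu.-integrable setT (fun t => (f t * npdf t)%:E).
Proof.
move=> cf fA.
have mf : measurable_fun [set: R] f by exact: continuous_measurable_fun.
have mn : measurable_fun [set: R] (@npdf R).
  by apply: continuous_measurable_fun; exact: continuous_npdf.
have A0 : 0 <= A by have := le_trans (normr_ge0 _) (fA 0); rewrite normr0 addr0 mulr1.
have iB : mu.-integrable setT (fun t => A%:E * ((1 + `|t|) * npdf t)%:E)%E.
  by apply: integrableZl => //; exact: integrable_npdf_abs.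
apply: le_integrable iB => //.
  by apply/measurable_EFinP; exact: measurable_funM.
move=> t _ /=; rewrite ?lee_fin [leRHS]ger0_norm; last first.
  by rewrite mulr_ge0// mulr_ge0 ?addr_ge0// ltW// npdf_gt0.
by rewrite normrM (gtr0_norm (npdf_gt0 _)) mulrA ler_pM2r ?npdf_gt0.
Qed.

Lemma integral_std_normal (f : R -> R) : continuous f ->
  (\int[std_normal R]_t (f t)%:E = \int[mu]_t (f t * npdf t)%:E)%E.
Proof.
move=> cf.
have mf : measurable_fun [set: measurableTypeR R] (EFin \o f).
  by apply/measurable_EFinP; exact: continuous_measurable_fun.
have n0 t : (0 <= (npdf t : R)%:E)%E by rewrite lee_fin ltW ?npdf_gt0.
rewrite [LHS]integralE [RHS]integralE; congr (_ - _)%E.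
  rewrite ge0_integral_std_normal//; last exact: measurable_funepos.
  by apply: eq_integral => t _; rewrite !funeposE maxe_pMl ?mul0e// -EFinM.
rewrite ge0_integral_std_normal//; last exact: measurable_funeneg.
by apply: eq_integral => t _; rewrite !funenegE maxe_pMl ?mul0e// muleC muleN muleC -EFinM.
Qed.
End normal_integral.

Section finite_prob.
Context {R : realType} {k : nat} (H : 'I_k.+1 -> sgraph) (beta : 'I_k.+1 -> R) (n : nat).
Notation P := (@ergm_prob R k H beta n).
Notation pmf := (@ergm_pmf R k H beta n).

Lemma ergm_prob_set1 y : P [set y] = (pmf y)%:E.
Proof. by rewrite /ergm_prob fsbig_set1. Qed.

Lemma ergm_prob_set (S : pred (config n)) :
  P [set y | S y] = (\sum_y pmf y * (S y)%:R)%:E.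
Proof.
rewrite /ergm_prob fsbig_finite//= sumEFin; congr EFin.
rewrite [RHS](eq_bigr (fun y => if S y then pmf y else 0)); last first.
  by move=> y _; case: (S y); rewrite ?mulr1 ?mulr0.
rewrite -big_mkcond -[RHS]big_filter; apply: perm_big; apply: uniq_perm.
- exact: finmap.fset_uniq.
- exact: filter_uniq (index_enum_uniq _).
- move=> y; rewrite in_fset_set; last exact: finite_finset.
  rewrite [RHS](@mem_filter (config n)) [y \in index_enum _]mem_index_enum andbT.
  by apply/idP/idP; rewrite inE.
Qed.

Lemma integral_ergm (f : config n -> R) :
  P.-integrable setT (EFin \o f) /\
  (\int[P]_y (f y)%:E = (\sum_y pmf y * f y)%:E)%E.
Proof.
have fE : EFin \o f = (fun y => \sum_(z : config n) ((f z)%:E * (\1_[set z] y)%:E))%E.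
  apply/funext => y; rewrite /= (bigD1 y)//= big1 ?adde0; last first.
    move=> z zy; rewrite indicE (_ : (y \in [set z]) = false) ?mule0//.
    by apply/negbTE; apply: contra zy; rewrite inE => /= ->.
  by rewrite indicE mem_set// mule1.
have i1 (z : config n) : P.-integrable setT (fun y => (f z)%:E * (\1_[set z] y)%:E)%E.
  by apply: integrableZl => //; exact: integrable_indic.
split.
  by rewrite fE; apply: integrable_sum.
rewrite -[LHS]/(\int[P]_y ((EFin \o f) y))%E fE integral_sum//.
rewrite -sumEFin; apply: eq_bigr => z _.
rewrite integralZl//; last exact: integrable_indic.
by rewrite integral_indic// setIT [X in (_ * X)%E]ergm_prob_set1 mulrC EFinM.
Qed.

End finite_prob.

Section gaussian_mean.
Context {R : realType}.
Notation mu := (@lebesgue_measure R).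
Implicit Types h : R -> R.

Definition gmean h : R := (\int[mu]_t (h t * npdf t))%R.

Lemma Rintegral_npdf : (\int[mu]_t npdf t)%R = 1 :> R.
Proof. by rewrite /Rintegral integral_normal_pdf. Qed.

Lemma gmean_center h (A : R) : continuous h -> (forall t, `|h t| <= A * (1 + `|t|)) ->
  (\int[mu]_t ((h t - gmean h) * npdf t))%R = 0.
Proof.
move=> ch hA.
rewrite (_ : (\int[mu]_t _)%R = (\int[mu]_t (h t * npdf t - gmean h * npdf t))%R); last first.
  by apply: eq_Rintegral => t _; rewrite mulrBl.
rewrite RintegralB//; [|exact: integrable_npdf_growth hA|]; last first.
  by apply: integrable_npdf_growth (@cst_continuous _ _ _) (_ : forall t, _ <= `|gmean h| * _) => t; rewrite ler_peMr// lerDl.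
rewrite RintegralZl//; last exact: integrable_normal_pdf.
by rewrite Rintegral_npdf mulr1 subrr.
Qed.

Lemma integral_std_normal_gmean h (A : R) : continuous h -> (forall t, `|h t| <= A * (1 + `|t|)) ->
  (\int[std_normal R]_t (h t)%:E = (gmean h)%:E)%E.
Proof.
move=> ch hA; rewrite integral_std_normal// /gmean /Rintegral fineK//.
by apply: integrable_fin_num => //; exact: integrable_npdf_growth hA.
Qed.

Definition absmean : R := gmean Num.norm.

Lemma absmean_ge0 : 0 <= absmean.
Proof. by apply: Rintegral_ge0 => t _; rewrite mulr_ge0// ltW// npdf_gt0. Qed.

Lemma lip_growth h : (forall x y, `|h x - h y| <= `|x - y|) ->
  forall t, `|h t| <= (1 + `|h 0|) * (1 + `|t|).
Proof.
move=> hl t; have := hl t 0; rewrite subr0 => ht.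
have : `|h t| <= `|h t - h 0| + `|h 0| by rewrite -{1}(subrK (h 0) (h t)) ler_normD.
by have := normr_ge0 (h 0); have := normr_ge0 t; nra.
Qed.

Lemma lip_continuous h : (forall x y, `|h x - h y| <= `|x - y|) -> continuous h.
Proof.
move=> hl x; apply/cvgrPdist_lt => e e0; near=> t.
by apply: le_lt_trans (hl _ _) _; near: t; exists e.
Unshelve. all: by end_near. Qed.

(** The distance of h(w) to E h(Z) is at most E |w - Z| <= |w| + E |Z|. *)
Lemma lip_gmean h : (forall x y, `|h x - h y| <= `|x - y|) ->
  forall w, `|h w - gmean h| <= (1 + absmean) * (1 + `|w|).
Proof.
move=> hl w; have ch := lip_continuous hl; have hg := lip_growth hl.
have ih := integrable_npdf_growth ch hg.
have inp : mu.-integrable setT (EFin \o (@npdf R)) by exact: integrable_normal_pdf.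
have iabs : mu.-integrable setT (fun t => (`|t| * npdf t)%:E).
  apply: (integrable_npdf_growth (A := 1)) => [|t]; first exact: norm_continuous.
  by rewrite normr_id mul1r lerDr.
have iwn : mu.-integrable setT (EFin \o (fun t => h w * npdf t)).
  by have := integrableZl (measurableT) (h w) inp; apply: eq_integrable.
have iwn' : mu.-integrable setT (EFin \o (fun t => `|w| * npdf t)).
  by have := integrableZl (measurableT) (`|w|) inp; apply: eq_integrable.
have -> : h w - gmean h = (\int[mu]_t (h w * npdf t - h t * npdf t))%R.
  by rewrite RintegralB// RintegralZl// Rintegral_npdf mulr1.
have id : mu.-integrable setT (EFin \o (fun t => h w * npdf t - h t * npdf t)).
  by have := integrableB measurableT iwn ih; apply: eq_integrable.
apply: le_trans (le_normr_Rintegral _ id) _ => //.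
apply: (@le_trans _ _ (\int[mu]_t (`|w| * npdf t + `|t| * npdf t))%R).
  apply: le_Rintegral => //.
  - exact: integrable_norm id.
  - by have := integrableD measurableT iwn' iabs; apply: eq_integrable.
  move=> t _; rewrite -mulrBl -mulrDl normrM (gtr0_norm (npdf_gt0 t)) ler_wpM2r ?(ltW (npdf_gt0 _))//.
  by apply: le_trans (hl _ _) _; exact: ler_normB.
rewrite RintegralD// RintegralZl// Rintegral_npdf mulr1 -/(gmean _) -/absmean.
by have := absmean_ge0; have := normr_ge0 w; nra.
Qed.

End gaussian_mean.

(** * Reduction of the two distances to smooth enough test functions *)

Section distance_bounds.
Context {R : realType} {k : nat} (H : 'I_k.+1 -> sgraph) (beta : 'I_k.+1 -> R) (p : R) (n : nat).
Notation mu := (@lebesgue_measure R).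
Notation pmf := (@ergm_pmf R k H beta n).
Notation W := (@normalized_edges R k H beta p n).
Notation nlaw := (normalized_law H beta p n).

Lemma integral_normalized_law (h : R -> R) : continuous h ->
  (\int[nlaw]_t (h t)%:E = (\sum_y pmf y * h (W y))%:E)%E.
Proof.
move=> ch; have [i1 i2] := integral_ergm H beta (fun y => h (W y)).
rewrite /normalized_law integral_distribution//.
by apply/measurable_EFinP; exact: continuous_measurable_fun.
Qed.

Lemma normalized_law_itv (x : R) :
  nlaw `]-oo, x]%classic = (\sum_y pmf y * (W y <= x)%R%:R)%:E.
Proof.
rewrite -(ergm_prob_set H beta (fun y => W y <= x)%R).
by rewrite /normalized_law /distribution /pushforward; congr ergm_prob; apply/seteqP; split => y /=; rewrite in_itv.
Qed.

Lemma d_Wass_le (eps : R) :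
  (forall (h : R -> R) (m : R), (forall x y, `|h x - h y| <= `|x - y|) ->
     (forall w, `|h w - m| <= (1 + absmean) * (1 + `|w|)) ->
     (\int[mu]_t ((h t - m) * npdf t))%R = 0 ->
     `|\sum_y pmf y * h (W y) - m| <= eps) ->
  (d_Wass nlaw (std_normal R) <= eps%:E)%E.
Proof.
move=> Heps; apply: ge_ereal_sup => _ [h /wass_test_lip hl <-].
have ch := lip_continuous hl; have hg := lip_growth hl.
rewrite integral_normalized_law// (integral_std_normal_gmean ch hg).
rewrite -EFinB abse_EFin lee_fin; apply: Heps => //; first exact: lip_gmean.
exact: gmean_center ch hg.
Qed.

Definition ramp (x e t : R) : R := Num.min 1 (Num.max 0 ((x + e - t) / e)).

Lemma ramp01 x e t : 0 <= ramp x e t <= 1.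
Proof. by rewrite /ramp le_min ler01 le_max lexx/= ge_min lexx. Qed.

Lemma ramp_homo x e : 0 < e -> forall s t, s <= t -> ramp x e t <= ramp x e s.
Proof.
move=> e0 s t st; rewrite /ramp le_min ge_min lexx/= ge_min; apply/orP; right.
rewrite ge_max !le_max lexx/=; apply/orP; right.
by rewrite ler_pM2r ?invr_gt0// lerD2l lerN2.
Qed.

Lemma ramp_ge x e t : 0 < e -> (t <= x)%R%:R <= ramp x e t.
Proof.
move=> e0; have [tx|_] := leP t x; last by case/andP: (ramp01 x e t).
by rewrite /ramp le_min lexx/= le_max; apply/orP; right; rewrite ler_pdivlMr//; lra.
Qed.

Lemma ramp_le x e t : 0 < e -> ramp x e t <= (t <= x + e)%R%:R.
Proof.
move=> e0; have [tx|tx] := leP t (x + e); first by case/andP: (ramp01 x e t).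
rewrite /ramp ge_min; apply/orP; right; rewrite ge_max lexx/=.
by rewrite ler_pdivrMr// mul0r subr_le0 ltW.
Qed.

Lemma continuous_ramp x e : continuous (ramp x e).
Proof.
move=> t.
pose g s := (x + e - s) / e.
have cg : {for t, continuous g} by apply: cvgMl; apply: cvgB; [exact: cvg_cst|exact: cvg_id].
have c0 : {for t, continuous (cst 0 : R -> R)} by exact: cst_continuous.
have c1 : {for t, continuous (cst 1 : R -> R)} by exact: cst_continuous.
exact: continuous_min c1 (continuous_max c0 cg).
Qed.

(** The indicator of a half-line lies between two ramps of width e. As [eps] is uniform over all
    decreasing test functions, e can be taken arbitrarily small; the normal mass lost is at most e
    times the peak of the density. *)
Lemma d_Kol_le (eps : R) :
  (forall (h : R -> R) (m : R), continuous h -> (forall x y, x <= y -> h y <= h x) ->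
     (forall x, 0 <= h x <= 1) ->
     (forall w, `|h w - m| <= 1 + `|w|) ->
     (\int[mu]_t ((h t - m) * npdf t))%R = 0 ->
     `|\sum_y pmf y * h (W y) - m| <= eps) ->
  (d_Kol nlaw (std_normal R) <= eps%:E)%E.
Proof.
move=> Heps.
pose F x := fine (std_normal R `]-oo, x]%classic).
have FE x : std_normal R `]-oo, x]%classic = (F x)%:E by rewrite fineK// fin_num_measure.
have F_itv (x e : R) : 0 < e -> F (x + e) <= F x + e * normal_peak 1.
  move=> e0; have Fle : (std_normal R `]x, (x + e)%R]%classic <= (e * normal_peak 1)%:E)%E.
    apply: (@le_trans _ _ (\int[mu]_(t in `]x, (x + e)%R]) (normal_peak 1)%:E)%E).
      apply: ge0_le_integral => //=.
      - by move=> t _; rewrite lee_fin ltW// npdf_gt0.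
      - by apply/measurable_EFinP/measurable_funTS; exact: measurable_normal_pdf.
      - by move=> t _; rewrite lee_fin npdf_le_peak.
    rewrite integral_cst//= lebesgue_measure_itv/= lte_fin ltrDl e0.
    by rewrite -EFinB -EFinM lee_fin mulrC addrAC subrr add0r.
  rewrite -lee_fin EFinD -!FE.
  rewrite (@itv_bndbnd_setU _ _ _ (BRight x))//; last by rewrite bnd_simp lerDl ltW.
  apply: le_trans (measureU2 _ _ _) _ => //; rewrite leeD2l//.
have hb (h : R -> R) : (forall x, 0 <= h x <= 1) -> forall t : R, `|h t| <= 1 * (1 + `|t|).
  by move=> h01 t; have /andP[a b] := h01 t; rewrite ger0_norm// mul1r; have := normr_ge0 t; lra.
have gmI (h : R -> R) (A : set (measurableTypeR R)) : continuous h -> (forall x : R, 0 <= h x <= 1) -> measurable A ->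
   ((forall t, (\1_A t : R) <= h t) -> fine (std_normal R A) <= gmean h) /\
   ((forall t, h t <= (\1_A t : R)) -> gmean h <= fine (std_normal R A)).
  move=> ch h01 mA.
  have mh : measurable_fun [set: measurableTypeR R] (EFin \o h).
    by apply/measurable_EFinP; exact: continuous_measurable_fun.
  have mI : measurable_fun [set: measurableTypeR R] (EFin \o (\1_A : _ -> R)).
    by apply/measurable_EFinP; exact: measurable_indic.
  split=> hA; rewrite -lee_fin -(integral_std_normal_gmean ch (hb _ h01)) fineK ?fin_num_measure//.
    rewrite -[A in leLHS]setIT -integral_indic//; apply: ge0_le_integral => //=.
    - by move=> t _; rewrite lee_fin.
  rewrite -[A in leRHS]setIT -integral_indic//; apply: ge0_le_integral => //=.
  - by move=> t _; rewrite lee_fin; case/andP: (h01 t).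
  - by move=> t _; rewrite lee_fin.
have indE x t : \1_(`]-oo, x]%classic) t = (t <= x)%R%:R :> R.
  by rewrite indicE mem_setE /= in_itv.
have test x e : 0 < e -> `|\sum_y pmf y * ramp x e (W y) - gmean (ramp x e)| <= eps.
  move=> e0; have c := @continuous_ramp x e; have r01 := ramp01 x e.
  apply: Heps => //; [exact: ramp_homo| |exact: gmean_center c (hb _ r01)].
  move=> w; have [g1 _] := gmI _ set0 c r01 measurable0.
  have [_ g2] := gmI _ setT c r01 measurableT.
  have g1' : 0 <= gmean (ramp x e).
    have := g1 _; rewrite measure0/=; apply => t.
    by rewrite indicE in_set0; case/andP: (r01 t).
  have g2' : gmean (ramp x e) <= 1.
    have := g2 _; rewrite probability_setT/=; apply => t.
    by rewrite indicE in_setT; case/andP: (r01 t).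
  have /andP[a b] := r01 w; rewrite (@le_trans _ _ 1)// ?lerDl//.
  by rewrite ler_norml; apply/andP; split; lra.
apply: ge_ereal_sup => _ [x _ <-].
rewrite normalized_law_itv FE -EFinB abse_EFin lee_fin.
apply/ler_addgt0Pr => d d0.
(* An interval of this length has normal mass at most d. *)
pose e := d / (1 + normal_peak 1).
have P0 := normal_peak_ge0 (1 : R).
have P1 : 0 < 1 + normal_peak (1 : R) by rewrite ltr_wpDr.
have e0 : 0 < e by rewrite divr_gt0.
have ed : e * normal_peak 1 <= d.
  by rewrite /e mulrAC ler_pdivrMr// ler_wpM2l ?(ltW d0)// lerDr.
have pg y := @ergm_pmf_ge0 R k H beta n y.
have up : \sum_y pmf y * (W y <= x)%R%:R <= \sum_y pmf y * ramp x e (W y).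
  by apply: ler_sum => y _; rewrite ler_wpM2l// ramp_ge.
have dn : \sum_y pmf y * ramp (x - e) e (W y) <= \sum_y pmf y * (W y <= x)%R%:R.
  apply: ler_sum => y _; rewrite ler_wpM2l//.
  by have := @ramp_le (x - e) e (W y) e0; rewrite subrK.
have [_ gu] := gmI _ `]-oo, (x + e)]%classic (@continuous_ramp x e) (ramp01 x e) (measurable_itv _).
have [gd _] := gmI _ `]-oo, (x - e)]%classic (@continuous_ramp (x - e) e) (ramp01 (x - e) e) (measurable_itv _).
have gu' : gmean (ramp x e) <= F (x + e) by apply: gu => t; rewrite indE ramp_le.
have gd' : F (x - e) <= gmean (ramp (x - e) e) by apply: gd => t; rewrite indE ramp_ge.
have F1 := F_itv x e e0; have := F_itv (x - e) e e0; rewrite subrK => F2.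
have := test x e e0; rewrite ler_norml => /andP[t1 t2].
have := test (x - e) e e0; rewrite ler_norml => /andP[t3 t4].
by rewrite ler_norml; apply/andP; split; lra.
Qed.

End distance_bounds.

Section from_moment_bounds.
Context {R : realType}.

(** The absolute values and the leading 1 make positivity immediate. [c] is the ratio of the square
    root of N to sigma_n. *)
Definition dist_const (p lam C : R) : R :=
  let B1 := (1 + tail_const) * (1 + absmean) in
  let c := Num.sqrt ((1 - lam) / (p * (1 - p))) in
  1 + `|stein_const p lam C B1 (4^-1 * c ^+ 2)|
  + `|stein_const p lam C (1 + tail_const) (2 * Num.sqrt C * c)|.

Lemma dist_const_gt0 p lam C : 0 < dist_const p lam C.
Proof. by rewrite /dist_const -addrA ltr_pwDl// addr_ge0. Qed.

Variables (k : nat) (H : 'I_k.+1 -> sgraph) (beta : 'I_k.+1 -> R) (n : nat).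
Variables (I : finType) (b : I -> R) (A : I -> {set pairs n}) (p lam C rho : R).
Notation T := (ham b A).
Hypothesis weightE : forall y : config n, ergm_weight H beta y = expR (T y).
Hypothesis varE : Num.sqrt (ergm_var H beta p n) = stein_sd (E := pairs n) p lam.
Hypotheses (n1 : (0 < #|{: pairs n}|)%N) (p01 : 0 < p < 1) (lam01 : 0 <= lam < 1).
Hypotheses (C0 : 0 < C) (rho01 : 0 < rho <= 1).
Hypothesis mb : moment_bounds b A p lam C rho.

Lemma ergm_pmfE (y : config n) : ergm_pmf H beta y = gmass T y.
Proof.
rewrite /ergm_pmf /gmass weightE; congr (_ / _).
by apply: eq_bigr => z _; exact: weightE.
Qed.

Lemma sum_pmfE (f : config n -> R) : \sum_y ergm_pmf H beta y * f y = mean T f.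
Proof. by apply: eq_bigr => y _; rewrite ergm_pmfE. Qed.

Lemma ergm_meanE : ergm_mean H beta n = mean T edges.
Proof.
have [_ i] := integral_ergm H beta (@edge_count R n).
by rewrite /ergm_mean unlock i /= sum_pmfE.
Qed.

Lemma normalized_edgesE : @normalized_edges R k H beta p n = stein_W T p lam.
Proof. by apply/funext => y; rewrite /normalized_edges ergm_meanE varE. Qed.

Lemma ergm_distance_bounds :
  (d_Wass (normalized_law H beta p n) (std_normal R) <=
     (dist_const p lam C * (rho + (stein_sd (E := pairs n) p lam)^-1))%:E)%E /\
  (d_Kol (normalized_law H beta p n) (std_normal R) <=
     (dist_const p lam C * (rho + (stein_sd (E := pairs n) p lam)^-1))%:E)%E.
Proof.
have /andP[lam0 lam1] := lam01.
have [mv mr mq] := mb.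
have tc : 0 < tail_const :> R := tail_const_gt0.
have am : 0 <= absmean :> R := absmean_ge0.
have d0 : 0 <= rho + (stein_sd (E := pairs n) p lam)^-1.
  by rewrite addr_ge0 ?invr_ge0 ?sqrtr_ge0// ltW//; case/andP: rho01.
split; [apply: d_Wass_le => h m hl hm0 gm|apply: d_Kol_le => h m ch hd h01 hm0 gm].
  rewrite normalized_edgesE sum_pmfE.
  have [f df fB] := stein_solution (lip_continuous hl) hm0 gm.
  have w0 (w : R) : 0 <= 1 + `|w| by rewrite addr_ge0.
  apply: le_trans (stein_bound_lip n1 p01 lam1 C0 rho01 mv mr mq
    (B := (1 + tail_const) * (1 + absmean)) df _ _ hl) _.
  - by move=> w; apply: le_trans (fB w) _; nra.
  - move=> w; apply: le_trans (hm0 w) _; rewrite ler_wpM2r//; nra.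
  rewrite ler_wpM2r// /dist_const; set s1 := stein_const _ _ _ _ _; set s2 := stein_const _ _ _ _ _.
  by have := ler_norm s1; have := normr_ge0 s2; lra.
rewrite normalized_edgesE sum_pmfE.
have hm1 w : `|h w - m| <= 1 * (1 + `|w|) by rewrite mul1r.
have [f df fB] := stein_solution ch hm1 gm.
apply: le_trans (stein_bound_mono n1 p01 lam1 C0 rho01 lam0 mv mr mq
  (B := 1 + tail_const) df _ _ hd h01) _.
- by move=> w; apply: le_trans (fB w) _; lra.
- move=> w; apply: le_trans (hm0 w) _; have := normr_ge0 w; nra.
rewrite ler_wpM2r// /dist_const; set s1 := stein_const _ _ _ _ _; set s2 := stein_const _ _ _ _ _.
by have := ler_norm s1; have := normr_ge0 s2; lra.
Qed.

End from_moment_bounds.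

(** * A uniform contraction rate towards an attracting fixed point *)

Section contraction_rate.
Context {R : realType}.
Implicit Types (g : R -> R) (p l : R).

(** Near p the rate is [l]. On the compact remainder x - g x has a positive minimum d, and since x -
    p <= 1 there, subtracting d is at least as good as multiplying by 1 - d. *)
Lemma contraction_rate_right g p l B r : (forall x, {for x, continuous g}) ->
  0 < r -> l < 1 -> B <= p + 1 -> g p = p ->
  (forall x, p <= x -> x < p + r -> g x - p <= l * (x - p)) ->
  (forall x, p < x -> x <= B -> g x < x) ->
  exists2 la, 0 <= la < 1 & forall x, p <= x -> x <= B -> g x - p <= la * (x - p).
Proof.
move=> cg r0 l1 Bp gp near_p below.
pose l0 := Num.max l 0; have l01 : 0 <= l0 < 1 by rewrite le_max lexx orbT gt_max l1 ltr01.
have near0 x : p <= x -> x < p + r -> g x - p <= l0 * (x - p).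
  move=> px xr; apply: le_trans (near_p x px xr) _.
  by rewrite ler_wpM2r ?subr_ge0// le_max lexx.
have [Br|rB] := ltP B (p + r).
  by exists l0 => // x px xB; apply: near0 => //; exact: le_lt_trans xB Br.
have [c cI cmin] : exists2 c, c \in `[p + r, B] & forall t, t \in `[p + r, B] -> c - g c <= t - g t.
  apply: EVT_min => //; apply: continuous_subspaceT => x.
  by apply: cvgB; [exact: cvg_id|exact: cg].
move: cI; rewrite in_itv /= => /andP[cr cB].
have d0 : 0 < c - g c by rewrite subr_gt0 below// (lt_le_trans _ cr)// ltrDl.
have /andP[l00 l0lt1] := l01.
exists (Num.max l0 (1 - (c - g c))).
  by rewrite le_max l00 gt_max l0lt1/= ltrBlDr ltrDl.
move=> x px xB; have xp : 0 <= x - p by rewrite subr_ge0.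
have [xr|rx] := ltP x (p + r).
  by apply: le_trans (near0 x px xr) _; rewrite ler_wpM2r// le_max lexx.
apply: (@le_trans _ _ ((1 - (c - g c)) * (x - p))); last first.
  by rewrite ler_wpM2r// le_max lexx orbT.
have := cmin x; rewrite in_itv /= rx xB => /(_ isT) h.
by nra.
Qed.

Lemma contraction_rate g p l : (forall x, {for x, continuous g}) ->
  is_derive p 1 g l -> l < 1 -> 0 < p < 1 -> g p = p ->
  (forall x, p < x -> x <= 1 -> g x < x) -> (forall x, 0 <= x -> x < p -> x < g x) ->
  exists la, [/\ 0 <= la < 1,
    forall x, p <= x -> x <= 1 -> g x - p <= la * (x - p) &
    forall x, 0 <= x -> x <= p -> p - g x <= la * (p - x)].
Proof.
move=> cg dg l1 /andP[p0 p1] gp above below.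
have e0 : 0 < (1 - l) / 2 by lra.
have [r r0 hr] := is_derive_linear_approx e0 dg; rewrite gp in hr.
pose l' := (1 + l) / 2; have l'1 : l' < 1 by rewrite /l'; lra.
have [|x px xr|//|la1 la1b h1] := @contraction_rate_right g p l' 1 r cg r0 l'1 _ gp.
- by lra.
- have := hr x; rewrite ger0_norm ?subr_ge0// ltrBlDl => /(_ xr).
  by rewrite ler_norml /l' => /andP[_]; lra.
(* Reflection turns the left side of p into the right side of - p. *)
pose g' x := - g (- x).
have [x|||x px xr|x px x0|la2 la2b h2] := @contraction_rate_right g' (- p) l' 0 r _ r0 l'1.
- by apply: cvgN; apply: (@continuous_comp _ _ _ (-%R) g); [exact: opp_continuous|exact: cg].
- by lra.
- by rewrite /g' opprK gp.
- have : `|- x - p| < r by rewrite distrC ger0_norm; lra.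
  move=> /hr; rewrite [`|- x - p|]distrC [`|p - - x|]ger0_norm; last by lra.
  by rewrite ler_norml /l' /g' => /andP[+ _]; lra.
- by rewrite /g' ltrNl below//; lra.
exists (Num.max la1 la2); split.
- by move: la1b la2b => /andP[a b] /andP[c d]; rewrite le_max a gt_max b d.
- move=> x px x1; apply: le_trans (h1 x px x1) _.
  by rewrite ler_wpM2r ?subr_ge0// le_max lexx.
move=> x x0 xp.
have h : g' (- x) - - p <= la2 * (- x - - p) by apply: h2; lra.
rewrite /g' opprK in h.
apply: (@le_trans _ _ (la2 * (p - x))); last first.
  by rewrite ler_wpM2r ?subr_ge0// le_max lexx orbT.
by lra.
Qed.

End contraction_rate.

Lemma is_derive_derive1 (R : realType) (f : R -> R) (x l : R) :
  is_derive x 1 f l -> derive1 f x = l.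
Proof. by move=> [_ <-]; rewrite derive1E. Qed.

(** * The mean-field map of the ERGM in the subcritical region *)

Section subcritical_field.
Context {R : realType} {k : nat} (H : 'I_k.+1 -> sgraph) (beta : 'I_k.+1 -> R).
Hypothesis H1 : single_edge (H ord0).
Hypothesis Hj : forall j, j != ord0 -> no_isolated (H j) /\ (2 <= nedges (H j))%N.
Hypothesis beta_gt0 : forall j, j != ord0 -> 0 < beta j.

Notation m j := (nedges (H j)).
Notation v j := (nverts (H j)).
Notation V := (field H beta).
Notation V' := (field' H beta).
Notation K := (field_const H beta).

Lemma is_derive_field (z : R) : is_derive z 1 V (V' z).
Proof.
pose h (j : 'I_k.+1) (x : R) := (beta j * (2 * (m j)%:R)) *: (id ^+ (m j - 1)) x.
have -> : V = \sum_(j < k.+1) h j.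
  by apply/funext => x; rewrite fieldE fct_sumE; apply: eq_bigr => j _; rewrite /h /= fctE.
have dh j : is_derive z 1 (h j) (beta j * (2 * (m j)%:R) * ((m j - 1)%:R * z ^+ (m j - 2))).
  have := is_deriveZ (beta j * (2 * (m j)%:R)) (is_deriveX (m j - 1) (is_derive_id z 1)).
  move=> d; apply: is_derive_eq d _.
  by rewrite /GRing.scale /= mulr1 -subnS.
exact: is_derive_sum.
Qed.

Lemma phiE (z : R) : phi H beta z = sig (V z). Proof. by []. Qed.

Lemma is_derive_phi (z : R) :
  is_derive z 1 (phi H beta) (sig (V z) * (1 - sig (V z)) * V' z).
Proof. exact: (is_derive1_comp (is_derive_sig (V z)) (is_derive_field z)). Qed.

Lemma continuous_phi (z : R) : {for z, continuous (phi H beta)}.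
Proof. by apply: differentiable_continuous; apply/derivable1_diffP; have [] := is_derive_phi z. Qed.

Lemma derive1_Phi (z : R) : derive1 (Phi H beta) z = V' z / 2.
Proof.
have -> : Phi H beta = 2^-1 \*: V.
  by apply/funext => x; rewrite /= /field /GRing.scale /= mulKf.
by rewrite (is_derive_derive1 (is_deriveZ 2^-1 (is_derive_field z))) mulrC.
Qed.

Lemma exprn_lip d (x y : R) : 0 <= x <= 1 -> 0 <= y <= 1 ->
  `|x ^+ d - y ^+ d| <= d%:R * `|x - y|.
Proof.
move=> /andP[x0 x1] /andP[y0 y1]; rewrite subrXX normrM mulrC ler_wpM2r//.
apply: le_trans (ler_norm_sum _ _ _) _.
apply: (@le_trans _ _ (\sum_(i < d) 1)); last by rewrite sumr_const card_ord.
apply: ler_sum => i _; rewrite ger0_norm ?mulr_ge0 ?exprn_ge0//.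
by rewrite mulr_ile1 ?exprn_ge0// exprn_ile1.
Qed.

Lemma sum_beta_lip (c c' : 'I_k.+1 -> R) (x : R) :
  0 <= x -> (forall j, `|c j - c' j| <= (m j ^ 2)%:R * x) ->
  `|\sum_j beta j * (2 * (m j)%:R) * c j - \sum_j beta j * (2 * (m j)%:R) * c' j| <= K * x.
Proof.
move=> x0 h; rewrite -sumrB; apply: le_trans (ler_norm_sum _ _ _) _.
apply: (@le_trans _ _ (\sum_j `|beta j| * (2 * (m j)%:R) * (m j ^ 2)%:R * x)).
  apply: ler_sum => j _; rewrite -mulrBr !normrM (ger0_norm (ler0n _ 2)) normr_nat -[leRHS]mulrA.
  by rewrite ler_wpM2l ?mulr_ge0.
rewrite -mulr_suml ler_wpM2r//; apply: le_field_const => j.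
rewrite -!mulrA !ler_wpM2l// -natrM ler_nat -expnS leq_pmulr// expn_gt0.
by rewrite (leq_trans _ (system_nverts_ge2 H1 Hj j)).
Qed.

Lemma field_lip (x y : R) : 0 <= x <= 1 -> 0 <= y <= 1 ->
  `|V x - V y| <= K * `|x - y|.
Proof.
move=> x01 y01; rewrite !fieldE; apply: sum_beta_lip => // j.
apply: le_trans (exprn_lip _ x01 y01) _; rewrite ler_wpM2r// ler_nat.
by rewrite expnS expn1 (leq_trans (leq_subr _ _))// leq_pmulr// (system_nedges_gt0 H1 Hj).
Qed.

Lemma field'_lip (x y : R) : 0 <= x <= 1 -> 0 <= y <= 1 ->
  `|V' x - V' y| <= K * `|x - y|.
Proof.
move=> x01 y01; apply: sum_beta_lip => // j.
rewrite -mulrBr normrM normr_nat.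
apply: (@le_trans _ _ ((m j - 1)%:R * ((m j - 2)%:R * `|x - y|))).
  by rewrite ler_wpM2l// exprn_lip.
by rewrite mulrA -natrM ler_wpM2r// ler_nat expnS expn1 leq_mul// leq_subr.
Qed.

Lemma field'_ge0 (z : R) : 0 <= z -> 0 <= V' z.
Proof.
move=> z0; apply: sumr_ge0 => j _.
have [mj|mj] := leqP (m j) 1.
  by rewrite (_ : (m j - 1)%N = 0%N) ?mul0r ?mulr0//; apply/eqP; rewrite subn_eq0.
by rewrite !mulr_ge0// ?exprn_ge0// (beta_ge0 H1 beta_gt0).
Qed.

Lemma field_mono (x y : R) : 0 <= x -> x <= y -> V x <= V y.
Proof.
move=> x0 xy; rewrite !fieldE; apply: ler_sum => j _.
have [mj|mj] := leqP (m j) 1.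
  by rewrite (_ : (m j - 1)%N = 0%N)//; apply/eqP; rewrite subn_eq0.
rewrite ler_wpM2l//; last by rewrite lerXn2r// nnegrE// (le_trans x0).
by rewrite !mulr_ge0// (beta_ge0 H1 beta_gt0).
Qed.

Variable p : R.
Hypothesis p_sub : subcritical H beta p.

Lemma subcritical_slope : V' p * (p * (1 - p)) < 1.
Proof.
have [_ pE _] := p_sub; rewrite (is_derive_derive1 (is_derive_phi p)) -phiE pE.
by rewrite mulrC.
Qed.

(** A sign change of phi x - x away from p would yield a second fixed point; it lies in (0, 1)
    because phi takes its values there. With phi 0 > 0 and phi 1 < 1 this fixes the sign on either
    side of p. *)
Lemma no_other_fixpoint (a b : R) : 0 <= a -> a <= b -> b <= 1 ->
  (p < a \/ b < p) -> ~~ (Num.min (phi H beta a - a) (phi H beta b - b) <= 0 <=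
    Num.max (phi H beta a - a) (phi H beta b - b)).
Proof.
move=> a0 ab b1 ab_p; apply/negP => ivt.
have [_ _ uniq _] := p_sub.
have [|c] := @IVT R (fun x => phi H beta x - x) a b 0 ab _ ivt.
  by apply: continuous_subspaceT => x; apply: cvgB; [exact: continuous_phi|exact: cvg_id].
rewrite in_itv /= => /andP[ac cb] /eqP; rewrite subr_eq0 => /eqP cE.
have cp : c = p.
  by apply: uniq => //; rewrite -cE phiE sig_gt0 sig_lt1.
by case: ab_p; rewrite -cp ltNge ?ac ?cb.
Qed.

Lemma phi_above (x : R) : p < x -> x <= 1 -> phi H beta x < x.
Proof.
have [/andP[p0 _] _ _ _] := p_sub.
move=> px x1; rewrite ltNge; apply/negP => h.
have := no_other_fixpoint (ltW (lt_trans p0 px)) x1 (lexx 1) (or_introl px).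
have h1 : phi H beta 1 - 1 <= 0 by rewrite subr_le0 phiE (ltW (sig_lt1 _)).
by rewrite ge_min le_max h1 subr_ge0 h orbT.
Qed.

Lemma phi_below (x : R) : 0 <= x -> x < p -> x < phi H beta x.
Proof.
have [/andP[_ p1] _ _ _] := p_sub.
move=> x0 xp; rewrite ltNge; apply/negP => h.
have := no_other_fixpoint (lexx 0) x0 (ltW (lt_trans xp p1)) (or_intror xp).
have h0 : 0 <= phi H beta 0 - 0 by rewrite subr0 phiE (ltW (sig_gt0 _)).
have hx : phi H beta x - x <= 0 by rewrite subr_le0.
by rewrite ge_min le_max h0 hx orbT.
Qed.

Lemma subcritical_fixpoint_data : exists la, fixpoint_data K p la V V'.
Proof.
have [p01 pE uniq dphi] := p_sub.
rewrite (is_derive_derive1 (is_derive_phi p)) in dphi.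
have [la [la01 up down]] :=
  contraction_rate continuous_phi (is_derive_phi p) dphi p01 pE phi_above phi_below.
exists la; split => //.
- by move=> x y x0 xy _; exact: field_mono.
- exact: field_lip.
- exact: field'_lip.
- by apply: field'_ge0; case/andP: p01 => /ltW.
- exact: subcritical_slope.
Qed.

End subcritical_field.

(** * Assembling the bounds *)

Section conclusion.
Context {R : realType} {k : nat} (H : 'I_k.+1 -> sgraph) (beta : 'I_k.+1 -> R).
Hypothesis H1 : single_edge (H ord0).
Hypothesis Hj : forall j, j != ord0 -> no_isolated (H j) /\ (2 <= nedges (H j))%N.
Hypothesis beta_gt0 : forall j, j != ord0 -> 0 < beta j.
Variable p : R.
Hypothesis p_sub : subcritical H beta p.

Notation V' := (field' H beta).
Let lam := V' p * (p * (1 - p)).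

Lemma sqrt_ergm_var n : Num.sqrt (ergm_var H beta p n) = stein_sd (E := pairs n) p lam.
Proof.
rewrite /ergm_var /stein_sd card_pairs; congr (Num.sqrt (_ / (1 - _))).
(* The term of the single edge vanishes, its factor m - 1 being 0, which matches the sum over j !=
   [ord0] in [ergm_var]. *)
rewrite /lam /field' mulr_suml [RHS](bigD1 ord0)//= (single_edge_card H1).2 mul0r mulr0 mul0r add0r.
apply: eq_bigr => j /Hj[_ mj].
have -> : p ^+ (nedges (H j) - 1) = p ^+ (nedges (H j) - 2) * p.
  by rewrite -exprSr -subSn// subSS.
move: (p ^+ _) (nedges (H j))%:R (nedges (H j) - 1)%:R => x a c.
by ring.
Qed.

Lemma pairs_card_bounds n : (2 <= n)%N ->
  (0 < #|{: pairs n}|)%N /\ (n ^ 2 <= 4 * #|{: pairs n}| <= 4 * n ^ 2)%N.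
Proof.
move=> n2; rewrite card_pairs bin_gt0; split=> //.
have := bin_ffact n 2; rewrite !ffactnS ffactn0 muln1 /= => E.
have E2 : ('C(n, 2) * 2 = n * n.-1)%N by rewrite -E.
have [n' nE] : exists n', n = n'.+2 by exists (n - 2)%N; lia.
by rewrite nE /= in E2 *; nia.
Qed.

(** Since N >= n^2 / 4, sigma_n is at least n s / 2, and 1 / sigma_n is absorbed by any rate not
    below 1/n. *)
Lemma distances_of_moment_bounds (rho : nat -> R) (C : R) : 0 < C ->
  (forall n, (2 <= n)%N -> n%:R^-1 <= rho n <= 1) ->
  (forall n, (2 <= n)%N ->
     moment_bounds (@copy_weight R k H beta n) (@copy_edges k H n) p lam C (rho n)) ->
  exists2 C', 0 < C' & forall n, (2 <= n)%N ->
    (d_Wass (normalized_law H beta p n) (std_normal R) <= (C' * rho n)%:E)%E /\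
    (d_Kol (normalized_law H beta p n) (std_normal R) <= (C' * rho n)%:E)%E.
Proof.
move=> C0 rho_n mb; have [p01 _ _ _] := p_sub; have /andP[p0 p1] := p01.
have lam1 : lam < 1 := subcritical_slope p_sub.
have lam0 : 0 <= lam.
  by rewrite mulr_ge0 ?(field'_ge0 H1 beta_gt0)// ?mulr_ge0 ?subr_ge0 ?ltW.
pose s := Num.sqrt (p * (1 - p) / (1 - lam)).
have s0 : 0 < s by rewrite sqrtr_gt0 divr_gt0 ?mulr_gt0 ?subr_gt0.
exists (dist_const p lam C * (1 + 2 / s)).
  by rewrite mulr_gt0 ?dist_const_gt0// addr_gt0// divr_gt0.
move=> n n2; have [N0 /andP[N1 _]] := pairs_card_bounds n2.
have n0 : 0 < n%:R :> R by rewrite ltr0n (leq_trans _ n2).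
have /andP[rn r1] := rho_n n n2.
have rho01 : 0 < rho n <= 1 by rewrite r1 andbT (lt_le_trans _ rn)// invr_gt0.
have sdE : n%:R / 2 * s <= stein_sd (E := pairs n) p lam.
  rewrite /stein_sd -(mulrA _ p) -(mulrA _ (p * _)) sqrtrM// ler_wpM2r ?sqrtr_ge0//.
  rewrite -[n%:R / 2]ger0_norm ?divr_ge0// -sqrtr_sqr ler_sqrt// expr_div_n ler_pdivrMr//.
  by rewrite -!natrX -natrM ler_nat mulnC.
have sd0 : 0 < n%:R / 2 * s by rewrite mulr_gt0// divr_gt0.
have inv_sd : (stein_sd (E := pairs n) p lam)^-1 <= 2 / s * rho n.
  apply: (@le_trans _ _ (2 / s * n%:R^-1)); last by rewrite ler_wpM2l// divr_ge0// ltW.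
  have -> : 2 / s * n%:R^-1 = (n%:R / 2 * s)^-1.
    by field; rewrite !gt_eqF.
  by rewrite lef_pV2// posrE// (lt_le_trans sd0).
have le : dist_const p lam C * (rho n + (stein_sd (E := pairs n) p lam)^-1) <=
    dist_const p lam C * (1 + 2 / s) * rho n.
  by rewrite -mulrA ler_wpM2l ?(ltW (dist_const_gt0 _ _ _))// mulrDl mul1r lerD2l.
have lam01 : 0 <= lam < 1 by rewrite lam0.
have [dW dK] := ergm_distance_bounds (weight_ham H beta (n := n)) (sqrt_ergm_var n) N0 p01 lam01 C0
  rho01 (mb n n2).
by split; [apply: le_trans dW _|apply: le_trans dK _]; rewrite lee_fin.
Qed.

End conclusion.

Theorem theorem3p1 (R : realType) (k : nat) (H : 'I_k.+1 -> sgraph)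
    (beta : 'I_k.+1 -> R)
    (H1 : single_edge (H ord0))
    (Hj : forall j, j != ord0 -> no_isolated (H j) /\ (2 <= nedges (H j))%N)
    (beta_gt0 : forall j, j != ord0 -> 0 < beta j)
    (p : R) (p_sub : subcritical H beta p) :
  (exists2 C : R, 0 < C & forall n : nat, (2 <= n)%N ->
     (d_Wass (normalized_law H beta p n) (std_normal R)
        <= (C / n%:R `^ (1 / 4))%:E)%E /\
     (d_Kol (normalized_law H beta p n) (std_normal R)
        <= (C / n%:R `^ (1 / 4))%:E)%E) /\
  (dobrushin H beta ->
   exists2 C : R, 0 < C & forall n : nat, (2 <= n)%N ->
     (d_Wass (normalized_law H beta p n) (std_normal R)
        <= (C / Num.sqrt n%:R)%:E)%E /\
     (d_Kol (normalized_law H beta p n) (std_normal R)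
        <= (C / Num.sqrt n%:R)%:E)%E).
Proof.
have [la fd] := subcritical_fixpoint_data H1 Hj beta_gt0 p_sub.
have K1 := field_const_ge1 H beta.
have mf n n2 := copies_mean_field H1 Hj beta_gt0 (n := n) n2.
have n_gt0 n : (2 <= n)%N -> 0 < n%:R :> R by move=> n2; rewrite ltr0n (leq_trans _ n2).
have n_ge1 n : (2 <= n)%N -> 1 <= n%:R :> R by move=> n2; rewrite ler1n (leq_trans _ n2).
split.
  have [C C0 mb] := subcritical_moment_bounds K1 fd.
  pose l n : R := ln n%:R / 4.
  have l0 n : (2 <= n)%N -> 0 <= l n by move=> n2; rewrite divr_ge0// ln_ge0// n_ge1.
  have l4 n : (2 <= n)%N -> expR (4 * l n) = n%:R.
    by move=> n2; rewrite /l mulrC divfK// lnK// posrE n_gt0.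
  have [n n2|n n2|C' C'0 dist] := distances_of_moment_bounds H1 Hj beta_gt0 p_sub
    (rho := fun n => expR (- l n)) C0.
  - rewrite -(l4 n n2) -expRN !ler_expR -[X in _ && (_ <= X)]expR0 ler_expR.
    by have := l0 n n2; lra.
  - have [N0 /andP[_ N1]] := pairs_card_bounds n2.
    apply: mb (l0 n n2) _ N0 _; first by rewrite l4//; exact: mf.
    rewrite (_ : 8 * l n = 4 * l n + 4 * l n); last by ring.
    by rewrite expRD l4// -natrM ler_nat mulnn -(leq_pmul2l (isT : 0 < 4)%N).
  exists C' => // n n2; rewrite (_ : (n%:R `^ (1 / 4))^-1 = expR (- l n)); first exact: dist.
  by rewrite /powR gt_eqF ?n_gt0// -expRN /l; congr (expR (- _)); rewrite mulrC mul1r.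
move=> dob.
(* [dS] is at most V'(1) = 2 Phi'(1) = 4 kappa, and Phi'(1) < 2 says kappa < 1. *)
pose kappa := derive1 (Phi H beta) 1 / 2.
have kappa1 : kappa < 1 by rewrite /kappa ltr_pdivrMr// mul1r.
have [C C0 mb] := dobrushin_moment_bounds K1 fd kappa1.
have [n n2|n n2|C' C'0 dist] := distances_of_moment_bounds H1 Hj beta_gt0 p_sub
  (rho := fun n => (Num.sqrt n%:R)^-1) C0.
- have s1 : 1 <= Num.sqrt n%:R :> R by rewrite -[leLHS]sqrtr1 ler_sqrt ?n_ge1.
  have s0 : 0 < Num.sqrt n%:R :> R by rewrite (lt_le_trans _ s1).
  rewrite invf_le1// s1 andbT lef_pV2 ?posrE ?n_gt0//.
  by rewrite -[leRHS](sqr_sqrtr (ler0n R n)) expr2 ler_peMl// ltW.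
- have [N0 _] := pairs_card_bounds n2.
  have s0 : 0 < Num.sqrt n%:R :> R by rewrite sqrtr_gt0 n_gt0.
  apply: mb; [| |exact: N0|].
  + rewrite invr_gt0 s0 invf_le1//=.
    by rewrite -[leLHS]sqrtr1 ler_sqrt ?n_ge1.
  + by rewrite exprVn invrK sqr_sqrtr//; exact: mf.
  + move=> e y; apply: le_trans (copies_dS H1 Hj beta_gt0 n2 e y) _.
    by rewrite /kappa derive1_Phi; lra.
by exists C'.
Qed.
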